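(* Let $\varphi$ be an Orlicz N-function satisfying condition Q. Let $\eta(x)$, $x\in\mathbb{R}$, be a real, measurable, mean-square continuous, weakly (second-order) stationary, centered stochastic process on a complete probability space, with spectral measure $F$ and orthogonal random spectral measure $Z$, and suppose that $\eta$ is strictly $\varphi$-sub-Gaussian with determining constant $c_\eta$. Let $K=\{(t,x): a\le t\le b,\ c\le x\le d\}$ with $a\ge 0$, and let $u(t,x)$, $(t,x)\in K$, be a separable modification of the process $$u(t,x)=\int_{\mathbb{R}}\exp\{i\lambda x+i\lambda^3t\}\,Z(d\lambda)$$ (the mean-square solution of $\partial u/\partial t=-\partial^3u/\partial x^3$, $u(0,x)=\eta(x)$). Suppose that for some $\beta\in(0,1]$ $$\int_{\mathbb{R}}|\lambda|^{6\beta}\,F(d\lambda)<\infty,$$ and put $$c(\beta)=2^{1-\beta}\Big(\int_{\mathbb{R}}|\lambda+\lambda^3|^{2\beta}\,F(d\lambda)\Big)^{1/2},\qquad \widetilde\sigma(h)=c_\eta\,c(\beta)\,h^\beta,$$ $$\widetilde\varepsilon_0=\sup_{(t,x)\in K}\tau_\varphi(u(t,x)),\qquad \varkappa=\max(b-a,\,d-c),\qquad \widetilde\theta=\widetilde\sigma(\varkappa)/\widetilde\varepsilon_0 .$$ Then: 1) for every $h>0$, $$\sup_{\substack{(t,x),(s,y)\in K:\\ |t-s|\le h,\ |x-y|\le h}}\tau_\varphi\big(u(t,x)-u(s,y)\big)\le\widetilde\sigma(h);$$ 2) for all $0<\theta<\min(\widetilde\theta,1)$ and all $v>0$, $$P\Big\{\sup_{(t,x)\in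 K}|u(t,x)|>v\Big\}\le 2\exp\Big\{-\varphi^*\Big(\frac{v(1-\theta)}{\widetilde\varepsilon_0}\Big)\Big\}\,\widetilde A_1(\theta\widetilde\varepsilon_0),$$ where $$\widetilde A_1(\theta\widetilde\varepsilon_0)=2^{\frac4\beta-1}\Big(\frac{\big(\varkappa\,(c_\eta c(\beta))^{1/\beta}\big)^2\,4^{2/\beta-1}}{(\theta\widetilde\varepsilon_0)^{2/\beta}}+1\Big);$$ 3) for any $p\in(0,1)$, any $h>0$ and any $v>0$, $$P\Big\{\sup_{\substack{(t,x),(s,y)\in K:\\ |t-s|\le h,\ |x-y|\le h}}|u(t,x)-u(s,y)|>v\Big\}\le 2^{4/\beta}\exp\Big\{-\varphi^*\Big(\frac{v(1-p)^2}{c_\eta\,c(\beta)\,h^\beta\,(3-p)}\Big)\Big\}\Big[\frac{2^{4/\beta-2}\varkappa^2}{p\,h^2}+1\Big].$$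
   Context: Spectral setting: the covariance function of $\eta$ is $B_\eta(x)=\int_{\mathbb{R}}\cos(\lambda x)\,dF(\lambda)$, where the spectral measure $F$ is a finite (symmetric) Borel measure on $\mathbb{R}$. The process has the spectral representation $\eta(x)=\int_{\mathbb{R}}e^{i\lambda x}Z(d\lambda)$ (an $L_2(\Omega)$ stochastic integral), where $Z$ is a complex-valued orthogonal random measure with $\mathsf{E}|Z(d\lambda)|^2=F(d\lambda)$. The integral defining $u$ is an $L_2(\Omega)$ stochastic integral and $u$ is real-valued. Orlicz N-function: a continuous even convex function $\varphi:\mathbb{R}\to\mathbb{R}$ with $\varphi(0)=0$, $\varphi(x)>0$ for $x\ne0$, $\lim_{x\to0}\varphi(x)/x=0$ and $\lim_{x\to\infty}\varphi(x)/x=\infty$. Condition Q: $\liminf_{x\to0}\varphi(x)/x^2=c>0$, where $c=\infty$ is allowed. The Young–Fenchel transform of $\varphi$ is $\varphi^*(x)=\sup_{y\in\mathbb{R}}(xy-\varphi(y))$. A random variable $\zeta$ is $\varphi$-sub-Gaussian if $\mathsf{E}\zeta=0$, $\mathsf{E}\exp\{\lambda\zeta\}$ exists for all $\lambda\in\mathbb{R}$, and there is $a>0$ with $\mathsf{E}\exp\{\lambda\zeta\}\le\exp\{\varphi(\lambda a)\}$ for all $\lambda\in\mathbb{R}$. The space of such variables is a Banach space with the norm $\tau_\varphi(\zeta)=\inf\{a>0:\ \mathsf{E}\exp\{\lambda\zeta\}\le\exp\{\varphi(a\lambda)\}\ \text{for all }\lambda\in\mathbb{R}\}$. A family $\Delta$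 of $\varphi$-sub-Gaussian random variables is strictly $\varphi$-sub-Gaussian if there is a constant $C_\Delta$ (the determining constant) such that for every countable set $I$, all $\zeta_i\in\Delta$ and all real $\lambda_i$, $i\in I$, one has $\tau_\varphi\big(\sum_{i\in I}\lambda_i\zeta_i\big)\le C_\Delta\big(\mathsf{E}(\sum_{i\in I}\lambda_i\zeta_i)^2\big)^{1/2}$. A process is strictly $\varphi$-sub-Gaussian if the family of its values is. Separability of the modification is with respect to the metric space $(K,\rho)$, where $\rho((t,x),(s,y))=\max(|t-s|,|x-y|)$. *)

(* Defs.v *)
From HB Require Import structures.
From mathcomp Require Import all_boot all_order all_algebra.
From mathcomp Require Import complex.
From mathcomp Require Import all_classical all_reals all_analysis.

Set Implicit Arguments.
Unset Strict Implicit.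
Unset Printing Implicit Defensive.

Import Order.TTheory GRing.Theory Num.Theory.
Import numFieldTopology.Exports numFieldNormedType.Exports.

Local Open Scope classical_set_scope.
Local Open Scope ring_scope.
Local Open Scope complex_scope.

Record orlicz_N_function (R : realType) (phi : R -> R) : Prop := {
  orlicz_continuous : continuous phi ;
  orlicz_even : forall x, phi (- x) = phi x ;
  orlicz_convex : forall t x y, 0 <= t <= 1 ->
    phi (t * x + (1 - t) * y) <= t * phi x + (1 - t) * phi y ;
  orlicz_at0 : phi 0 = 0 ;
  orlicz_pos : forall x, x != 0 -> 0 < phi x ;
  orlicz_small : phi x / x @[x --> (0:R)^'] --> (0:R) ;
  orlicz_large : phi x / x @[x --> +oo] --> +oo }.

(* [lime_inf] is taken over the punctured neighbourhoods of 0 and has values in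
   the extended reals, so the value +oo is allowed. *)
Definition condition_Q (R : realType) (phi : R -> R) : Prop :=
  (0 < lime_inf (fun x => (phi x / x ^+ 2)%:E) 0)%E.

Definition young_fenchel (R : realType) (phi : R -> R) (x : R) : \bar R :=
  ereal_sup [set (x * y - phi y)%:E | y in [set: R]].

Section subgaussian.
Context d (T : measurableType d) (R : realType) (P : probability T R).
Variable phi : R -> R.

Record phi_subgaussian (zeta : T -> R) : Prop := {
  subgaussian_integrable : zeta \in Lfun P 1%:E ;
  subgaussian_centered : 'E_P[zeta]%E = 0%E ;
  subgaussian_mgf : forall l : R, (mmt_gen_fun P zeta l < +oo)%E ;
  subgaussian_bound : exists2 a : R, 0 < a &
    forall l : R, (mmt_gen_fun P zeta l <= (expR (phi (l * a)))%:E)%E }.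

(* The value is +oo when no constant a is admissible. *)
Definition tau (zeta : T -> R) : \bar R :=
  ereal_inf [set a%:E | a in [set a : R | 0 < a /\
    forall l : R, (mmt_gen_fun P zeta l <= (expR (phi (a * l)))%:E)%E]].

(* Linear combinations over a countable set I are mean-square convergent series
   indexed by nat; finite combinations are those with finitely many nonzero
   coefficients. *)
Definition strictly_phi_subgaussian (Delta : set (T -> R)) (C : R) : Prop :=
  (forall zeta, Delta zeta -> phi_subgaussian zeta) /\
  forall (zeta : nat -> T -> R) (l : nat -> R) (S : T -> R),
    (forall i, Delta (zeta i)) -> S \in Lfun P 2%:E ->
    (\int[P]_w ((\sum_(i < n) l i * zeta i w - S w) ^+ 2)%:E)%E @[n --> \oo]
      --> 0%E ->
    (tau S <= (C * Num.sqrt (fine 'E_P[fun w => (S w ^+ 2)%R]%E))%:E)%E.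

End subgaussian.

Section processes.
Context d (T : measurableType d) (R : realType) (P : probability T R).

Definition measurable_process (X : R -> T -> R) : Prop :=
  measurable_fun [set: measurableTypeR R * T] (fun p => X p.1 p.2).

Definition second_order (X : R -> T -> R) : Prop :=
  forall x, X x \in Lfun P 2%:E.

Definition centered (X : R -> T -> R) : Prop := forall x, 'E_P[X x]%E = 0%E.

Definition ms_continuous (X : R -> T -> R) : Prop :=
  forall x : R, 'E_P[fun w => ((X y w - X x w) ^+ 2)%R]%E @[y --> x] --> 0%E.

Definition weakly_stationary (X : R -> T -> R) : Prop :=
  (forall x y, 'E_P[X x] = 'E_P[X y])%E /\
  (forall x y h, covariance P (X (x + h)) (X (y + h)) =
                 covariance P (X x) (X y)).

Definition is_spectral_measure (X : R -> T -> R)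
    (F : {finite_measure set (measurableTypeR R) -> \bar R}) : Prop :=
  (forall A : set (measurableTypeR R),
      measurable A -> F [set - x | x in A] = F A) /\
  (forall x y, covariance P (X x) (X y) =
               \int[F]_l (cos (l * (x - y)))%:E)%E.

(* The open sets of K for the metric induced from the ambient space are the
   sets G `&` K with G open. The exceptional set N depends neither on G nor
   on D. *)
Definition separable_on (E : topologicalType) (K : set E) (u : E -> T -> R)
    : Prop :=
  exists (S : set E) (N : set T),
    [/\ countable S, S `<=` K, K `<=` closure S, P.-negligible N &
        forall (G : set E) (D : set R) (w : T), open G -> closed D -> ~ N w ->
          (forall p, (G `&` S) p -> D (u p w)) ->
          (forall p, (G `&` K) p -> D (u p w))].

End processes.

Section complex_L2.
Context (R : realType).

Definition sqnormc (z : R[i]) : R := complex.Re z ^+ 2 + complex.Im z ^+ 2.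

Definition expi (x : R) : R[i] := cos x +i* sin x.

Definition L2c d (T : measurableType d) (mu : {measure set T -> \bar R})
    (f : T -> R[i]) : Prop :=
  (fun x => complex.Re (f x)) \in Lfun mu 2%:E /\
  (fun x => complex.Im (f x)) \in Lfun mu 2%:E.

Definition L2c_cvg d (T : measurableType d) (mu : {measure set T -> \bar R})
    (f_ : nat -> T -> R[i]) (f : T -> R[i]) : Prop :=
  (\int[mu]_x (sqnormc (f_ n x - f x))%:E)%E @[n --> \oo] --> 0%E.

Definition expectationc d (T : measurableType d) (P : probability T R)
    (X : T -> R[i]) : R[i] :=
  fine 'E_P[fun w => complex.Re (X w)]%E +i*
  fine 'E_P[fun w => complex.Im (X w)]%E.

End complex_L2.

Section stochastic_integral.
Context d (T : measurableType d) (R : realType) (P : probability T R).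
Variable F : {finite_measure set (measurableTypeR R) -> \bar R}.
Local Notation borel := (measurable : set (set (measurableTypeR R))).

(* Countable additivity is in L2(P), and E|Z(A)|^2 = F(A). *)
Record orthogonal_random_measure (Z : set R -> T -> R[i]) : Prop := {
  ormeas_L2 : forall A, borel A -> L2c P (Z A) ;
  ormeas_additive : forall A : nat -> set R, (forall n, borel (A n)) ->
    trivIset setT A ->
    L2c_cvg P (fun n w => \sum_(k < n) Z (A k) w) (Z (\bigcup_n A n)) ;
  ormeas_orthogonal : forall A B, borel A -> borel B -> A `&` B = set0 ->
    expectationc P (fun w => Z A w * (Z B w)^*) = 0 ;
  ormeas_structure : forall A, borel A ->
    'E_P[fun w => sqnormc (Z A w)]%E = F A }.

(* X is (a version of) the integral of f against Z: the L2(P)-limit of the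
   integrals sum_k c_k Z(A_k) of simple functions sum_k c_k 1_{A_k} which
   converge to f in L2(F). *)
Definition is_stochastic_integral (Z : set R -> T -> R[i]) (f : R -> R[i])
    (X : T -> R[i]) : Prop :=
  [/\ @L2c _ _ (measurableTypeR R) F f, L2c P X &
  exists (m : nat -> nat) (c : nat -> nat -> R[i]) (A : nat -> nat -> set R),
  [/\ forall n k, borel (A n k),
      @L2c_cvg _ _ (measurableTypeR R) F
        (fun n l => \sum_(k < m n) c n k * (\1_(A n k) l)%:C) f &
      L2c_cvg P (fun n w => \sum_(k < m n) c n k * Z (A n k) w) X]].

End stochastic_integral.

(* Main.v *)
Require Import Defs.
From HB Require Import structures.
From mathcomp Require Import all_boot all_order all_algebra.
From mathcomp Require Import complex.
From mathcomp Require Import all_classical all_reals all_analysis.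
From mathcomp Require Import measurable_realfun ring lra.

Set Implicit Arguments.
Unset Strict Implicit.
Unset Printing Implicit Defensive.

Import Order.TTheory GRing.Theory Num.Theory.
Import numFieldTopology.Exports numFieldNormedType.Exports.

Local Open Scope classical_set_scope.
Local Open Scope ring_scope.
Local Open Scope complex_scope.

(** The solution u(t,x) is the stochastic integral of the wave
    exp(i (l x + l^3 t)), and the values of eta are the integrals of
    exp(i l x). Everything rests on one transfer principle: if the integrand
    of a real integral U is an L2(F)-limit of trigonometric polynomials, then U
    is an L2(P)-limit of linear combinations of values of eta, so that strict
    sub-Gaussianity of eta gives E exp(m U) <= exp(phi(m c_eta |f|)) with |f|
    the L2(F)-norm of the integrand [spectral_exp_bounded]. The passage to the
    limit is lower semicontinuity of the Laplace transform
    [exp_bounded_L2_limit], and the stochastic integral does not increase norms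
    [stochastic_integral_le]. The wave is such a limit: l is replaced by
    J sin(l/J) and then exp(i y) by (1 + i y/J^6)^(J^6) [trig_limit_wave].

    For an increment of u the norm of the integrand is controlled by
    |exp(i a) - exp(i b)|^2 = 4 sin^2((a - b)/2) <= 4 |(a - b)/2|^(2 beta),
    which yields c(beta) h^beta [wave_increment]. This is the first claim.

    The two tail bounds come from chaining [chaining_tail]. Along finer and
    finer nets an index i is approached by its projections, and |U i| is at
    most the sum of the increments over the levels. These are weighted by
    (1 - q) q^k, and the convexity of exp together with a union bound at each
    level gives a bound exp(-m v + phi(m Delta)) with an entropy factor; the
    infimum over m produces the Young-Fenchel transform. With nets adapted to
    the Holder modulus of u this gives the bound for the supremum
    [sup_tail]. For increments, the rectangle is covered by cells such that two
    points at distance at most h share a cell, and the increment is split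
    through the centre of that cell [cell_tail, increment_tail]; the exact
    constants result from elementary inequalities between powers of 16, 9, 3
    and 3/2.

    Chaining controls countable index sets only. For the supremum of |u| the
    separability of u is enough [sup_event_le]. For increments over close pairs
    the increment bound itself makes u almost surely uniformly continuous on a
    countable separating set, hence continuous on the whole rectangle
    [continuous_paths], and a countable dense set of pairs suffices
    [increment_event_le]. *)

(** * Powers, small numbers and level sets *)

Section real_lemmas.
Context (R : realType).

Lemma small_invS (e : R) : 0 < e -> exists n : nat, n.+1%:R^-1 <= e.
Proof.
move=> e0; exists (Num.truncn e^-1).
by rewrite -[leRHS]invrK lef_pV2 ?posrE ?invr_gt0// ltW// truncnS_gt.
Qed.

Lemma le_at_right0 (f : R -> R) (a : R) : continuous f ->
  (forall e, 0 < e -> a <= f e) -> a <= f 0.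
Proof.
move=> cf h; rewrite leNgt; apply/negP => fa.
have := @cvgr_lt _ _ _ (nbhs_filter (0 : R)) f (f 0) (cf 0) a fa.
move=> [e /= e0 he].
have e2 : 0 < e / 2 by rewrite divr_gt0.
have : f (e / 2) < a.
  by apply: he; rewrite /ball_ /= sub0r normrN gtr0_norm// ltr_pdivrMr// ltr_pMr// ltr1n.
by rewrite ltNge h.
Qed.

Lemma powR_le_mono (a b r : R) : 0 <= r -> 0 <= a -> a <= b -> a `^ r <= b `^ r.
Proof.
move=> r0 a0 ab; apply: ge0_ler_powR => //; rewrite nnegrE//.
exact: le_trans ab.
Qed.

Lemma sqr_powR (x s : R) : (x `^ s) ^+ 2 = x `^ (2 * s).
Proof. by rewrite -powR_mulrn ?powR_ge0// -powRrM mulrC. Qed.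

Lemma powR_invK (x s : R) k : s != 0 -> 0 <= x ->
  ((x `^ s^-1) ^+ k) `^ s = x ^+ k.
Proof.
move=> s0 x0; rewrite -(powR_mulrn k (powR_ge0 x s^-1)) -!powRrM.
by rewrite [k%:R * s]mulrC mulrA mulVf// mul1r powR_mulrn.
Qed.

End real_lemmas.

Lemma measurable_norm_gt d (T : measurableType d) (R : realType) (Y : T -> R) v :
  measurable_fun [set: T] Y -> measurable [set w | v < `|Y w|].
Proof.
move=> mY; have mN : measurable_fun [set: T] (fun w => `|Y w|).
  exact: measurableT_comp.
rewrite (_ : [set w | _] = [set: T] `&` (fun w => `|Y w|) @^-1` `]v, +oo[).
  exact: mN.
by rewrite setTI; apply/seteqP; split=> w; rewrite /= in_itv/= andbT.
Qed.

(** * Orlicz functions and the Young-Fenchel transform *)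

Section orlicz_facts.
Context (R : realType) (phi : R -> R) (phiO : orlicz_N_function phi).

Lemma orlicz_ge0 x : 0 <= phi x.
Proof.
have [->|x0] := eqVneq x 0; first by rewrite (orlicz_at0 phiO).
by rewrite ltW // (orlicz_pos phiO).
Qed.

Lemma orlicz_norm x : phi `|x| = phi x.
Proof. by case: (ler0P x) => // _; rewrite (orlicz_even phiO). Qed.

(** By convexity and phi 0 = 0 the function is monotone along rays from the
    origin. *)
Lemma orlicz_le x y : `|x| <= `|y| -> phi x <= phi y.
Proof.
move=> xy; rewrite -(orlicz_norm x) -(orlicz_norm y).
have [y0|y0] := eqVneq `|y| 0.
  by have -> : `|x| = `|y| by apply/eqP; rewrite eq_le xy /= y0.
have yp : 0 < `|y| by rewrite lt_neqAle eq_sym y0 normr_ge0.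
have tt : 0 <= `|x| / `|y| <= 1 by rewrite divr_ge0//= ler_pdivrMr// mul1r.
have := orlicz_convex phiO `|y| 0 tt.
rewrite mulr0 addr0 divfK// (orlicz_at0 phiO) mulr0 addr0 => /le_trans; apply.
by rewrite ler_piMl ?orlicz_ge0//; case/andP: tt.
Qed.

Lemma young_fenchel_mono (x x' : R) : 0 <= x -> x <= x' ->
  (young_fenchel phi x <= young_fenchel phi x')%E.
Proof.
move=> x0 xx'; apply: ge_ereal_sup => _ [y _ <-].
have [y0|y0] := leP 0 y.
  apply: (@le_trans _ _ (x' * y - phi y)%:E).
    by rewrite lee_fin lerD2r ler_wpM2r.
  by apply: ereal_sup_ubound; exists y.
apply: (@le_trans _ _ (x' * 0 - phi 0)%:E).
  rewrite lee_fin mulr0 (orlicz_at0 phiO) subrr.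
  have := orlicz_ge0 y; have : x * y <= 0 by rewrite mulr_ge0_le0// ltW.
  by lra.
by apply: ereal_sup_ubound; exists 0.
Qed.

(** The infimum over y of exp(phi y - x y) is the exponential of minus the
    transform. Negative y may be left out, because there phi y - x y >= 0 and
    y = 0 does better. *)
Lemma young_fenchel_bound (a B x : R) : 0 <= a -> 0 < B -> 0 <= x ->
  (forall y, 0 <= y -> a <= B * expR (phi y - x * y)) ->
  (a%:E <= B%:E * expeR (- young_fenchel phi x))%E.
Proof.
move=> a0 B0 x0 h; have [->|an0] := eqVneq a 0.
  by rewrite mule_ge0// ?lee_fin ?(ltW B0)// expeR_ge0.
have ap : 0 < a by rewrite lt_neqAle eq_sym an0.
have key y : x * y - phi y <= - ln (a / B).
  rewrite lerNr opprB -[leRHS]expRK ler_ln ?posrE ?expR_gt0 ?divr_gt0//.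
  rewrite ler_pdivrMr// mulrC; have [y0|y0] := leP 0 y; first exact: h.
  apply: (le_trans (h 0 (lexx 0))).
  rewrite (orlicz_at0 phiO) mulr0 subrr expR0 mulr1 ler_peMr ?(ltW B0)//.
  rewrite -expR0 ler_expR subr_ge0; apply: (@le_trans _ _ 0).
    by rewrite mulr_ge0_le0// ltW.
  exact: orlicz_ge0.
have : (young_fenchel phi x <= (- ln (a / B))%:E)%E.
  by apply: ge_ereal_sup => _ [y _ <-]; rewrite lee_fin key.
move=> yf; apply: (@le_trans _ _ (B%:E * expeR (ln (a / B))%:E)%E).
  by rewrite /= lnK ?posrE ?divr_gt0// -EFinM lee_fin mulrC divfK// gt_eqF.
apply: lee_wpmul2l; first by rewrite lee_fin ltW.
by rewrite lee_expeR leeNr.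
Qed.

End orlicz_facts.

(** * Chaining *)

Section chain.
Context d (T : measurableType d) (R : realType) (P : probability T R).
Context (phi : R -> R) (phiO : orlicz_N_function phi).

(** For measurable Y and s >= 0 this amounts to tau Y <= s, see [tau_exp_bounded]
    and [exp_bounded_tau]. The inequality itself is what enters integrals, and it
    covers s = 0, which is not an admissible constant in tau. *)
Definition exp_bounded (s : R) (Y : T -> R) : Prop :=
  measurable_fun [set: T] Y /\
  forall l : R, (\int[P]_w (expR (l * Y w))%:E <= (expR (phi (s * l)))%:E)%E.

(** Jensen's inequality for weights of total mass at most 1, the remaining mass
    being placed at 0. The tangent of exp at the mean lies below exp. *)
Lemma exp_weighted_mean n (w a : nat -> R) :
    (forall k, (k < n)%N -> 0 <= w k) -> \sum_(k < n) w k <= 1 ->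
  expR (\sum_(k < n) w k * a k) <=
    \sum_(k < n) w k * expR (a k) + (1 - \sum_(k < n) w k).
Proof.
move=> w0 w1; set s := \sum_(k < n) w k * a k.
have tangent x : expR s * (1 + (x - s)) <= expR x.
  have -> : expR x = expR s * expR (x - s) by rewrite -expRD; congr expR; ring.
  by rewrite ler_pM2l ?expR_gt0// expR_ge1Dx.
have hs : expR s * (1 - s) <= 1 by have := tangent 0; rewrite sub0r expR0.
apply: (@le_trans _ _ (\sum_(k < n) w k * (expR s * (1 + (a k - s))) +
    (1 - \sum_(k < n) w k) * (expR s * (1 - s)))).
  have -> : \sum_(k < n) w k * (expR s * (1 + (a k - s))) =
      expR s * ((\sum_(k < n) w k) * (1 - s) + s).
    rewrite mulr_suml /s -big_split/= mulr_sumr; apply: eq_bigr => k _; ring.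
  by rewrite le_eqVlt; apply/orP; left; apply/eqP; ring.
rewrite lerD//; last by rewrite ler_piMr// subr_ge0.
by apply: ler_sum => k _; rewrite ler_wpM2l// w0.
Qed.

(** The factor 2 comes from exp(c |Y|) <= exp(c Y) + exp(- c Y). *)
Lemma exp_bounded_abs s Y c D : exp_bounded s Y -> (0 <= c :> R) -> 0 <= s ->
  s * c <= D ->
  (\int[P]_w (expR (c * `|Y w|))%:E <= (2 * expR (phi D))%:E)%E.
Proof.
move=> [mY hY] c0 s0 scD.
have mE (l : R) : measurable_fun [set: T] (fun w => expR (l * Y w)).
  by apply: measurableT_comp => //; apply: measurable_funM.
have hE l : `|l| = c -> (\int[P]_w (expR (l * Y w))%:E <= (expR (phi D))%:E)%E.
  move=> lc; apply: (le_trans (hY l)); rewrite lee_fin ler_expR.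
  apply: (orlicz_le phiO); rewrite normrM lc (ger0_norm s0).
  by rewrite (ger0_norm (le_trans _ scD))// mulr_ge0.
apply: (@le_trans _ _ (\int[P]_w ((expR (c * Y w))%:E + (expR (- c * Y w))%:E))%E).
  apply: ge0_le_integral => //.
  - apply/measurable_EFinP; apply: measurableT_comp => //.
    by apply: measurable_funM => //; exact: measurableT_comp.
  - by apply: emeasurable_funD; apply/measurable_EFinP.
  - move=> w _; rewrite -EFinD lee_fin.
    case: (ler0P (Y w)) => _; last by rewrite lerDl expR_ge0.
    by rewrite mulrN mulNr lerDr expR_ge0.
rewrite ge0_integralD//; try by [move=> w _; rewrite lee_fin expR_ge0|exact/measurable_EFinP].
by rewrite mulr2n mulrDl mul1r EFinD leeD//; apply: hE; rewrite ?normrN ger0_norm.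
Qed.

Lemma ge0_integral_EFin_sum (J : Type) (s : seq J) (f : J -> T -> R) :
  (forall j, measurable_fun [set: T] (f j)) -> (forall j w, 0 <= f j w) ->
  (\int[P]_w (\sum_(j <- s) f j w)%:E = \sum_(j <- s) \int[P]_w (f j w)%:E)%E.
Proof.
move=> mf f0; rewrite -ge0_integral_sum//.
- by apply: eq_integral => w _; rewrite sumEFin.
- by move=> j; apply/measurable_EFinP.
- by move=> j w _; rewrite lee_fin.
Qed.

(** Markov's inequality for exp(l * sum_k |Y k (f k)|), although the choice f
    depends on the sample point. Writing the sum as a w-weighted mean of the
    terms (l / w k) |Y k (f k)| lets Jensen's inequality replace the exponential
    of the sum by a mean of exponentials; each of these is at most the sum of
    the exponentials over all of E k, which no longer depends on f. The norm
    w k * D of Y k cancels the division by w k. Subtracting ln (b k) inside the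
    exponential normalises every level to expectation at most 1. *)
Lemma chain_bound (I : eqType) n (E : nat -> seq I) (Y : nat -> I -> T -> R)
    (w N : nat -> R) (D l v : R) (A : set T) :
  0 <= D -> 0 <= l -> measurable A ->
  (forall k, (k < n)%N -> 0 < w k) -> \sum_(k < n) w k <= 1 ->
  (forall k, (k < n)%N -> 0 < N k) ->
  (forall k, (k < n)%N -> (size (E k))%:R <= N k) ->
  (forall k i, (k < n)%N -> i \in E k -> exp_bounded (w k * D) (Y k i)) ->
  (forall om, A om -> exists f : nat -> I, (forall k, (k < n)%N -> f k \in E k) /\
     v <= \sum_(k < n) `|Y k (f k) om|) ->
  (P A <= (expR (\sum_(k < n) w k * ln (2 * N k) + phi (l * D) - l * v))%:E)%E.
Proof.
move=> D0 l0 mA w0 w1 N0 sE bY hA.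
(* b k bounds the expectation of the sum over the net at level k *)
pose b k := 2 * N k * expR (phi (l * D)).
have b0 k : (k < n)%N -> 0 < b k by move=> kn; rewrite !mulr_gt0 ?expR_gt0 ?N0.
pose g k i om := if i \in E k then expR (l / w k * `|Y k i om|) else 0.
have g0 k i om : 0 <= g k i om by rewrite /g; case: ifP => // _; exact: expR_ge0.
have mg (k : 'I_n) i : measurable_fun [set: T] (g k i).
  rewrite /g; have [iE|/negbTE iE] := boolP (i \in E k); last exact: measurable_cst.
  have [mY _] := bY k i (ltn_ord k) iE.
  apply: measurableT_comp => //; apply: measurable_funM => //.
  exact: measurableT_comp.
(* together with the missing mass 1 - W, Psi dominates exp (l * v - q) on A,
   and its expectation is at most W *)
pose Psi om := \sum_(k < n) w k / b k * \sum_(i <- E k) g k i om.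
have Psi0 om : 0 <= Psi om.
  apply: sumr_ge0 => k _; rewrite mulr_ge0 ?divr_ge0 ?(ltW (w0 _ _)) ?(ltW (b0 _ _))//.
  by apply: sumr_ge0.
have mPsi : measurable_fun [set: T] Psi.
  apply: measurable_sum => k; apply: measurable_funM => //.
  by apply: measurable_sum => i; exact: mg.
set W := \sum_(k < n) w k in w1 *.
have intPsi : (\int[P]_om (Psi om)%:E <= W%:E)%E.
  rewrite ge0_integral_EFin_sum; last 2 first.
  - move=> k; apply: measurable_funM => //.
    by apply: measurable_sum => i; exact: mg.
  - move=> k om; rewrite mulr_ge0 ?divr_ge0 ?(ltW (w0 _ _)) ?(ltW (b0 _ _))//.
    by apply: sumr_ge0.
  rewrite -sumEFin; apply: lee_sum => k _.
  have kn := ltn_ord k.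
  under eq_integral do rewrite EFinM.
  rewrite ge0_integralZl//; last 3 first.
  - by apply/measurable_EFinP; apply: measurable_sum => i; exact: mg.
  - by move=> om _; rewrite lee_fin sumr_ge0.
  - by rewrite lee_fin divr_ge0// ltW ?w0 ?b0.
  rewrite ge0_integral_EFin_sum//.
  have : (\sum_(i <- E k) \int[P]_om (g k i om)%:E <= (b k)%:E)%E.
    apply: (@le_trans _ _ (\sum_(i <- E k) (2 * expR (phi (l * D)))%:E)%E).
      rewrite big_seq [leRHS]big_seq; apply: lee_sum => i iE.
      rewrite /g iE; apply: exp_bounded_abs; first exact: (bY k i).
      - by rewrite divr_ge0// ltW// w0.
      - by rewrite mulr_ge0// ltW// w0.
      - by rewrite le_eqVlt; apply/orP; left; apply/eqP; field; rewrite gt_eqF ?w0.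
    rewrite sumEFin lee_fin big_const_seq count_predT iter_addr_0 -[leLHS]mulr_natr.
    by rewrite /b mulrAC ler_wpM2r ?expR_ge0// ler_wpM2l// sE.
  move=> h; apply: (le_trans (lee_wpmul2l _ h)).
    by rewrite lee_fin divr_ge0// ltW ?w0 ?b0.
  by rewrite -EFinM divfK// gt_eqF ?b0.
pose q := \sum_(k < n) w k * ln (b k).
have key om : A om -> expR (l * v - q) <= Psi om + (1 - W).
  move=> /hA[f [fE vf]].
  apply: (@le_trans _ _ (expR (\sum_(k < n) w k *
      (l / w k * `|Y k (f k) om| - ln (b k))))).
    rewrite ler_expR /q.
    under [leRHS]eq_bigr => k _.
      rewrite mulrBr mulrA mulrCA divff ?gt_eqF ?w0// mulr1; over.
    by rewrite sumrB lerB// -mulr_sumr ler_wpM2l.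
  apply: le_trans (@exp_weighted_mean n w
    (fun k => l / w k * `|Y k (f k) om| - ln (b k))
    (fun k kn => ltW (w0 k kn)) w1) _.
  rewrite lerD2r /Psi; apply: ler_sum => k _; have kn := ltn_ord k.
  rewrite -[leRHS]mulrA; apply: ler_wpM2l; first exact/ltW/w0.
  rewrite expRD expRN lnK ?posrE ?b0// mulrC; apply: ler_wpM2l.
    by rewrite invr_ge0 ltW ?b0.
  have -> : expR (l / w k * `|Y k (f k) om|) = g k (f k) om by rewrite /g fE.
  by rewrite (big_rem (f k)) ?fE//= lerDl sumr_ge0.
have PA : ((expR (l * v - q))%:E * P A <= 1)%E.
  rewrite -integral_cst//.
  apply: (@le_trans _ _ (\int[P]_(om in A) (Psi om + (1 - W))%:E)%E).
    apply: ge0_le_integral => //.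
    - by move=> om _; rewrite lee_fin expR_ge0.
    - apply/measurable_EFinP/measurable_funTS; exact: measurable_funD.
  apply: (@le_trans _ _ (\int[P]_om (Psi om + (1 - W))%:E)%E).
    apply: ge0_subset_integral => //.
    - apply/measurable_EFinP; exact: measurable_funD.
    - by move=> om _; rewrite lee_fin addr_ge0// subr_ge0.
  under eq_integral do rewrite EFinD.
  rewrite ge0_integralD//; last 3 first.
  - by move=> om _; rewrite lee_fin.
  - exact/measurable_EFinP.
  - by move=> om _; rewrite lee_fin subr_ge0.
  have -> : (\int[P]_x (1 - W)%:E = (1 - W)%:E)%E.
    by rewrite integral_cst//= probability_setT mule1.
  apply: (le_trans (leeD2r _ intPsi)).
  by rewrite -EFinD lee_fin addrC subrK.
have : (P A <= (expR (q - l * v))%:E)%E.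
  rewrite -[q - _]opprB expRN.
  rewrite -(@fineK _ (P A)) ?fin_num_measure// in PA *.
  by rewrite -EFinM lee_fin in PA; rewrite lee_fin -[leRHS]mul1r ler_pdivlMr ?expR_gt0// mulrC.
move/le_trans; apply; rewrite lee_fin ler_expR lerD2r /q.
apply: (@le_trans _ _ (\sum_(k < n) (w k * ln (2 * N k) + w k * phi (l * D)))).
  apply: ler_sum => k _; rewrite -mulrDr ler_wpM2l ?(ltW (w0 _ _))//.
  by rewrite /b lnM ?posrE ?expR_gt0 ?mulr_gt0 ?N0// expRK.
by rewrite big_split/= lerD2l -mulr_suml ler_piMl// orlicz_ge0.
Qed.

End chain.

Section chaining.
Context d (T : measurableType d) (R : realType) (P : probability T R).
Context (phi : R -> R) (phiO : orlicz_N_function phi).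
Local Notation exp_bounded := (exp_bounded P phi).

Lemma geometric_weights (q : R) n :
  \sum_(k < n) (1 - q) * q ^+ k = 1 - q ^+ n.
Proof.
elim: n => [|n IHn]; first by rewrite big_ord0 expr0 subrr.
by rewrite big_ord_recr/= IHn exprS; ring.
Qed.

(** Bounded by the mean q / (1 - q) of the geometric distribution. *)
Lemma geometric_weights_mean (q : R) n : 0 < q < 1 ->
  \sum_(k < n) (1 - q) * q ^+ k * k%:R <= q / (1 - q).
Proof.
move=> /andP[q0 q1]; have q1' : 1 - q != 0 by rewrite subr_eq0 eq_sym lt_eqF.
suff -> : \sum_(k < n) (1 - q) * q ^+ k * k%:R =
    q / (1 - q) - (n%:R * q ^+ n + q ^+ n.+1 / (1 - q)).
  rewrite gerBl addr_ge0// ?divr_ge0 ?mulr_ge0 ?exprn_ge0 ?(ltW q0)//.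
  by rewrite subr_ge0 ltW.
elim: n => [|n IHn]; first by rewrite big_ord0 mul0r add0r expr1 subrr.
rewrite big_ord_recr/= IHn !exprS -natr1; field.
by rewrite q1'.
Qed.

(** Bernoulli's inequality. *)
Lemma expr_unbounded (rho x : R) : 1 < rho -> exists m, x <= rho ^+ m.
Proof.
move=> r1; have bern m : 1 + m%:R * (rho - 1) <= rho ^+ m.
  elim: m => [|m IHm]; first by rewrite mul0r addr0 expr0.
  rewrite exprSr -natr1; apply: (@le_trans _ _ ((1 + m%:R * (rho - 1)) * rho)).
    rewrite -subr_ge0 (_ : _ - _ = m%:R * (rho - 1) ^+ 2); last by ring.
    by rewrite mulr_ge0// sqr_ge0.
  by rewrite ler_wpM2r// ltW// (lt_trans ltr01).
exists (Num.bound (x / (rho - 1))); apply: le_trans (bern _).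
have r10 : 0 < rho - 1 by rewrite subr_gt0.
have [x0|x0] := leP x 0.
  by apply: (le_trans x0); rewrite addr_ge0// mulr_ge0// ltW.
apply: ler_wpDl => //; rewrite -ler_pdivrMr//; apply/ltW/archi_boundP.
by rewrite divr_ge0// ltW.
Qed.

(** Continuity from below along an enumeration of the index set. *)
Lemma countable_union_le (I : choiceType) (D0 : set I) (B : I -> set T) c :
  countable D0 -> (forall i, D0 i -> measurable (B i)) ->
  (forall s : seq I, (forall i, i \in s -> D0 i) ->
     (P (\big[setU/set0]_(i <- s) B i) <= c)%E) ->
  measurable (\bigcup_(i in D0) B i) /\ (P (\bigcup_(i in D0) B i) <= c)%E.
Proof.
move=> /countable_injP[f injf] mB hB.
pose DN N := [set i | D0 i /\ (f i < N)%N].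
pose F N := \bigcup_(i in DN N) B i.
have finDN N : finite_set (DN N).
  have /eq_finite_set <- : (f @` DN N #= DN N)%card.
    apply: inj_card_eq => i j /set_mem[Di _] /set_mem[Dj _].
    by apply: injf; exact/mem_set.
  by apply: (sub_finite_set _ (finite_II N)) => _ [i [_ fi] <-].
have FE N : exists2 s : seq I, (forall i, i \in s -> D0 i) &
    F N = \big[setU/set0]_(i <- s) B i.
  have /finite_seqP[s sE] := finDN N; exists s; last by rewrite /F sE bigcup_seq.
  move=> i si; have : [set` s] i by [].
  by rewrite -sE => -[].
have mF N : measurable (F N).
  have [s sD ->] := FE N.
  by rewrite big_seq; apply: bigsetU_measurable => i /sD; exact: mB.
have UE : \bigcup_(i in D0) B i = \bigcup_N F N.
  apply/seteqP; split=> [om [i Di Bi]|om [N _ [i [Di _] Bi]]]; last by exists i.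
  by exists (f i).+1 => //; exists i.
have mU : measurable (\bigcup_N F N) by apply: bigcupT_measurable.
rewrite UE; split=> //.
have cF := @nondecreasing_cvg_mu _ _ _ P F mF mU.
have {}cF : (P \o F) x @[x --> \oo] --> P (\bigcup_n F n).
  apply: cF => m n mn; apply/subsetPset => om [i [Di fi] Bi].
  by exists i => //; split=> //; exact: leq_trans mn.
rewrite -(cvg_lim _ cF)//; apply: lime_le; first by apply/cvg_ex; eexists; exact: cF.
by apply: nearW => N /=; have [s sD ->] := FE N; exact: hB.
Qed.

(** The value at i is a telescoping sum along the projections of i to the nets
    of levels k = 0, 1, and so on. The weights are (1 - q) q^k; the increment
    from level k to level k + 1 has norm at most the next weight times Delta.
    The nets grow like rho^k, and the weighted mean of k ln rho is at most
    q / (1 - q) ln rho, whence the power of rho. A finite set of indices is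
    itself used as the net of a high enough level, so the chain stays finite. *)
Lemma chaining_tail (I : choiceType) (D D0 : set I) (U : I -> T -> R)
    (Net : nat -> seq I) (pi : nat -> I -> I) (q A rho Delta v : R) :
  0 < q < 1 -> 1 <= A -> 1 < rho -> 0 < Delta -> 0 <= v ->
  (forall k i, D i -> pi k i \in Net k) -> (forall k i, i \in Net k -> D i) ->
  (forall k, (size (Net k))%:R <= A * rho ^+ k) ->
  (forall i, D i -> exp_bounded ((1 - q) * Delta) (U i)) ->
  (forall k i, D i ->
     exp_bounded ((1 - q) * q ^+ k.+1 * Delta) (fun w => U i w - U (pi k i) w)) ->
  D0 `<=` D -> countable D0 ->
  let E := \bigcup_(i in D0) [set w | v < `|U i w|] in
  measurable E /\
  (P E <= (2 * A * rho `^ (q / (1 - q)))%:E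
          * expeR (- young_fenchel phi (v / Delta)))%E.
Proof.
move=> q01 A1 rho1 Delta0 v0 piN ND sN bU bL D0D cD0 E; have /andP[q0 q1] := q01.
have q1p : 0 < 1 - q by rewrite subr_gt0.
have mB i : D i -> measurable [set w | v < `|U i w|].
  by move=> /bU[mU _]; exact: measurable_norm_gt.
apply: countable_union_le => // [i /D0D|s sD0]; first exact: mB.
have sD i : i \in s -> D i by move=> /sD0/D0D.
set C := \big[setU/set0]_(i <- s) _.
have mC : measurable C.
  by rewrite /C big_seq; apply: bigsetU_measurable => i /sD; exact: mB.
have [m sm] : exists m, (size s)%:R <= A * rho ^+ m.
  have [m hm] := expr_unbounded ((size s)%:R) rho1; exists m.
  apply: (le_trans hm); rewrite ler_peMl// exprn_ge0// ltW//.
  exact: lt_trans rho1.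
(* the given finite set of indices replaces the net of level m, whose size
   bound it also satisfies *)
pose L k := if k == m then s else Net k.
pose Y k i w := if k is j.+1 then U i w - U (pi j i) w else U i w.
pose wt k := (1 - q) * q ^+ k.
pose N k := A * rho ^+ k.
have rho0 : 0 < rho by apply: lt_trans rho1.
have N1 k : 1 <= N k.
  by rewrite -[1]mulr1 ler_pM// exprn_ege1// ltW.
(* the chain f from level 0 up to i at level n *)
have chainP n i w : D i -> exists f : nat -> I, [/\ f n = i,
    forall k, (k < n)%N -> f k \in Net k &
    `|U i w| <= \sum_(k < n.+1) `|Y k (f k) w|].
  elim: n i => [|n IHn] i Di.
    by exists (fun=> i); split=> //; rewrite big_ord1.
  have [f [fn fN fU]] := IHn (pi n i) (ND _ _ (piN n i Di)).
  exists (fun k => if (k <= n)%N then f k else i); split.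
  - by rewrite ltnn.
  - move=> k; rewrite ltnS leq_eqVlt => /orP[/eqP ->|kn].
      by rewrite eqxx/= fn; exact: piN.
    by rewrite kn orbT fN.
  - rewrite big_ord_recr/= ltnn; apply: (@le_trans _ _ (`|U (pi n i) w| +
        `|U i w - U (pi n i) w|)).
      rewrite -[X in `|X| <= _](subrK (U (pi n i) w)) addrC; exact: ler_normD.
    rewrite lerD2r; apply: (le_trans fU); apply: ler_sum => k _.
    by rewrite -ltnS ltn_ord.
have PE : P C = (fine (P C))%:E by rewrite fineK// fin_num_measure.
rewrite PE; apply: (young_fenchel_bound phiO) => //.
- by rewrite fine_ge0.
- by rewrite !mulr_gt0 ?powR_gt0// (lt_le_trans _ A1).
- by rewrite divr_ge0// ltW.
move=> y y0.
have y0' : 0 <= y / Delta by rewrite divr_ge0// ltW.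
have := @chain_bound _ _ _ P phi phiO I m.+1 L Y wt N Delta (y / Delta) v C
   (ltW Delta0) y0' mC.
have wt0 k : 0 < wt k by rewrite mulr_gt0// exprn_gt0.
have wt1 : \sum_(k < m.+1) wt k <= 1.
  by rewrite geometric_weights gerBl exprn_ge0// ltW.
move=> /(_ (fun k _ => wt0 k) wt1 (fun k _ => lt_le_trans ltr01 (N1 k))).
have sL k : (k < m.+1)%N -> (size (L k))%:R <= N k.
  by move=> _; rewrite /L; case: eqVneq => [->|].
have LD k i : i \in L k -> D i.
  by rewrite /L; case: ifP => _; [exact: sD|exact: ND].
have bY k i : (k < m.+1)%N -> i \in L k -> exp_bounded (wt k * Delta) (Y k i).
  move=> _ /LD Di; rewrite /Y /wt; case: k => [|k]; first by rewrite expr0 mulr1; exact: bU.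
  exact: bL.
move=> /(_ sL bY).
have hC om : C om -> exists f : nat -> I,
   (forall k : nat, (k < m.+1)%N -> f k \in L k) /\
   v <= \sum_(k < m.+1) `|Y k (f k) om|.
  rewrite /C -bigcup_seq => -[i /= si vi].
  have [f [fm fN fU]] := chainP m i om (sD _ si).
  exists f; split; last by apply: le_trans fU; exact: ltW.
  move=> k; rewrite ltnS leq_eqVlt => /orP[/eqP ->|km]; first by rewrite /L eqxx fm.
  by rewrite /L (ltn_eqF km) fN.
move=> /(_ hC); rewrite {1}PE lee_fin => /le_trans; apply.
rewrite divfK ?gt_eqF// (_ : y / Delta * v = v / Delta * y); last by ring.
rewrite -addrA [leLHS]expRD; apply: ler_wpM2r; first exact: expR_ge0.
have -> : 2 * A * rho `^ (q / (1 - q)) = expR (ln (2 * A) + q / (1 - q) * ln rho).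
  by rewrite expRD lnK ?posrE ?mulr_gt0 ?(lt_le_trans ltr01 A1)// /powR gt_eqF.
rewrite ler_expR.
under eq_bigr => k _.
  rewrite /N mulrA lnM ?posrE ?exprn_gt0 ?mulr_gt0 ?(lt_le_trans ltr01 A1)//.
  rewrite lnXn// mulrDr -[ln rho *+ k]mulr_natl mulrA; over.
rewrite big_split/= -!mulr_suml lerD//.
  by rewrite ler_piMl// ln_ge0//; lra.
apply: ler_wpM2r; last exact: geometric_weights_mean.
by rewrite ln_ge0 ?ltW.
Qed.

End chaining.

(** * Complex square-integrable functions *)

Section complex_algebra.
Context (R : realType).
Implicit Types z w : R[i].

Lemma ReD z w : complex.Re (z + w) = complex.Re z + complex.Re w.
Proof. by case: z; case: w. Qed.
Lemma ImD z w : complex.Im (z + w) = complex.Im z + complex.Im w.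
Proof. by case: z; case: w. Qed.
Lemma ReN z : complex.Re (- z) = - complex.Re z. Proof. by case: z. Qed.
Lemma ImN z : complex.Im (- z) = - complex.Im z. Proof. by case: z. Qed.
Lemma ReM z w : complex.Re (z * w) =
  complex.Re z * complex.Re w - complex.Im z * complex.Im w.
Proof. by case: z; case: w. Qed.
Lemma ImM z w : complex.Im (z * w) =
  complex.Re z * complex.Im w + complex.Im z * complex.Re w.
Proof. by case: z; case: w. Qed.
Lemma Re_conj z : complex.Re z^* = complex.Re z. Proof. by case: z. Qed.
Lemma Im_conj z : complex.Im z^* = - complex.Im z. Proof. by case: z. Qed.
Definition complexDE := (ReD, ImD, ReN, ImN, ReM, ImM, Re_conj, Im_conj).

Lemma complex_eqP z w : complex.Re z = complex.Re w ->
  complex.Im z = complex.Im w -> z = w.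
Proof. by case: z w => a b [c d] /= -> ->. Qed.

Lemma sqnormc_ge0 z : 0 <= sqnormc z.
Proof. by rewrite addr_ge0// sqr_ge0. Qed.
Lemma sqnormcM z w : sqnormc (z * w) = sqnormc z * sqnormc w.
Proof. by rewrite /sqnormc !complexDE; ring. Qed.
Lemma sqnormcN z : sqnormc (- z) = sqnormc z.
Proof. by rewrite /sqnormc !complexDE !sqrrN. Qed.
Lemma sqnormcX z n : sqnormc (z ^+ n) = sqnormc z ^+ n.
Proof.
elim: n => [|n IHn]; first by rewrite !expr0 /sqnormc/= expr1n expr0n/= addr0.
by rewrite !exprS sqnormcM IHn.
Qed.

(** The triangle inequality for squares. A free parameter instead of a cross term
    keeps limits of norms free of square roots. *)
Lemma sqnormcD_le (e : R) z w : 0 < e ->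
  sqnormc (z + w) <= (1 + e) * sqnormc z + (1 + e^-1) * sqnormc w.
Proof.
move=> e0; rewrite -subr_ge0 /sqnormc !complexDE.
rewrite (_ : _ - _ = e^-1 * ((e * complex.Re z - complex.Re w) ^+ 2 +
  (e * complex.Im z - complex.Im w) ^+ 2)); last by field; rewrite gt_eqF.
by rewrite mulr_ge0 ?addr_ge0 ?sqr_ge0// invr_ge0 ltW.
Qed.

End complex_algebra.

Section L2c_space.
Context d (T : measurableType d) (R : realType) (mu : {measure set T -> \bar R}).
Implicit Types f g : T -> R[i].

(** The squared L2 norm, extended-real valued so that it can be compared without
    integrability conditions. *)
Definition nsq f : \bar R := (\int[mu]_x (sqnormc (f x))%:E)%E.

Lemma Lfun2D (f g : T -> R) : f \in Lfun mu 2%:E -> g \in Lfun mu 2%:E ->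
  (fun x => f x + g x) \in Lfun mu 2%:E.
Proof. by apply: (Lfun_addr_closed _ _).2; rewrite lee1n. Qed.

Lemma Lfun2Z (a : R) (f : T -> R) : f \in Lfun mu 2%:E ->
  (fun x => a * f x) \in Lfun mu 2%:E.
Proof.
move=> Lf; have := @Lfun_scale _ _ _ mu f a 2 (ler1n _ _) Lf.
by rewrite (_ : a \o* f = (fun x => a * f x))//; apply/funext => x /=; rewrite mulrC.
Qed.

Lemma Lfun2_measurable (f : T -> R) : f \in Lfun mu 2%:E ->
  measurable_fun [set: T] f.
Proof. by rewrite inE => /andP[]; rewrite inE. Qed.

Lemma L2cD f g : L2c mu f -> L2c mu g -> L2c mu (fun x => f x + g x).
Proof.
move=> [fr fi] [gr gi]; split.
  by under eq_fun do rewrite ReD; exact: Lfun2D.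
by under eq_fun do rewrite ImD; exact: Lfun2D.
Qed.

Lemma L2cZ (c : R[i]) f : L2c mu f -> L2c mu (fun x => c * f x).
Proof.
move=> [fr fi]; split.
  under eq_fun do rewrite ReM -mulNr.
  by apply: Lfun2D; exact: Lfun2Z.
under eq_fun do rewrite ImM.
by apply: Lfun2D; exact: Lfun2Z.
Qed.

Lemma L2cB f g : L2c mu f -> L2c mu g -> L2c mu (fun x => f x - g x).
Proof.
move=> Lf Lg; have := L2cD Lf (L2cZ (-1) Lg).
by under eq_fun do rewrite mulN1r.
Qed.

Lemma L2c0 : L2c mu (cst 0).
Proof.
have h : (fun _ : T => 0 : R) \in Lfun mu 2%:E.
  have := @finite_norm_cst0 _ _ _ mu 2%:E; rewrite lee1n => /(_ isT) h.
  rewrite inE; apply/andP; split; rewrite inE; last exact: h.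
  exact: measurable_cst.
by split; exact: h.
Qed.

Lemma sqnormc_measurable f : L2c mu f -> measurable_fun [set: T] (fun x => sqnormc (f x)).
Proof.
move=> [/Lfun2_measurable mr /Lfun2_measurable mi].
by apply: measurable_funD; exact: measurable_funX.
Qed.

Lemma nsq_ge0 f : (0 <= nsq f)%E.
Proof. by apply: integral_ge0 => x _; rewrite lee_fin sqnormc_ge0. Qed.

Lemma L2c_integrable f : L2c mu f ->
  mu.-integrable [set: T] (EFin \o (fun x => sqnormc (f x))).
Proof.
move=> [/Lfun2_integrable_sqr fr /Lfun2_integrable_sqr fi].
exact: (@integrableD _ _ _ mu _ measurableT _ _ fr fi).
Qed.

Lemma nsq_fin f : L2c mu f -> nsq f \is a fin_num.
Proof. by move=> /L2c_integrable; exact: integrable_fin_num. Qed.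

Lemma nsqD_le (e : R) f g : 0 < e -> L2c mu f -> L2c mu g ->
  (nsq (fun x => f x + g x)%R <= (1 + e)%:E * nsq f + (1 + e^-1)%:E * nsq g)%E.
Proof.
move=> e0 Lf Lg.
have mf := sqnormc_measurable Lf; have mg := sqnormc_measurable Lg.
have e1 : 0 <= 1 + e by rewrite addr_ge0// ltW.
have e2 : 0 <= 1 + e^-1 by rewrite addr_ge0// invr_ge0 ltW.
rewrite -!ge0_integralZl//; try by
  [move=> x _; rewrite lee_fin sqnormc_ge0 | exact/measurable_EFinP].
rewrite -ge0_integralD//; try by
  [move=> x _; rewrite mule_ge0// lee_fin sqnormc_ge0
  | apply: measurable_funeM; exact/measurable_EFinP].
apply: ge0_le_integral => //.
- by move=> x _; rewrite lee_fin sqnormc_ge0.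
- by apply/measurable_EFinP; exact: sqnormc_measurable (L2cD Lf Lg).
- by apply: emeasurable_funD; apply: measurable_funeM; exact/measurable_EFinP.
- by move=> x _; rewrite -!EFinM -EFinD lee_fin sqnormcD_le.
Qed.

Lemma nsqZ (c : R[i]) f : L2c mu f ->
  nsq (fun x => c * f x) = ((sqnormc c)%:E * nsq f)%E.
Proof.
move=> Lf; rewrite /nsq; under eq_integral do rewrite sqnormcM EFinM.
rewrite ge0_integralZl//.
- exact/measurable_EFinP/sqnormc_measurable.
- by move=> x _; rewrite lee_fin sqnormc_ge0.
- by rewrite lee_fin sqnormc_ge0.
Qed.

Lemma nsqN f : nsq (fun x => - f x) = nsq f.
Proof. by apply: eq_integral => x _; rewrite sqnormcN. Qed.

End L2c_space.

Section inner_product.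
Context d (T : measurableType d) (R : realType) (mu : {measure set T -> \bar R}).
Implicit Types f g : T -> R[i].

(** The inner product of L2, linear in the first argument. *)
Definition cip f g : R[i] :=
  fine (\int[mu]_x (complex.Re (f x * (g x)^*))%:E)%E +i*
  fine (\int[mu]_x (complex.Im (f x * (g x)^*))%:E)%E.

Lemma Lfun2M (f g : T -> R) : f \in Lfun mu 2%:E -> g \in Lfun mu 2%:E ->
  mu.-integrable [set: T] (fun x => (f x * g x)%:E).
Proof. by move=> Lf Lg; apply/Lfun1_integrable; exact: Lfun2_mul_Lfun1. Qed.

Lemma cip_integrable f g : L2c mu f -> L2c mu g ->
  mu.-integrable [set: T] (EFin \o (fun x => complex.Re (f x * (g x)^*))) /\
  mu.-integrable [set: T] (EFin \o (fun x => complex.Im (f x * (g x)^*))).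
Proof.
move=> [fr fi] [gr gi]; split.
- apply: (eq_integrable measurableT _ _ _
    (integrableD measurableT (Lfun2M fr gr) (Lfun2M fi gi))) => x _.
  by rewrite /= !complexDE -EFinD; congr EFin; ring.
- apply: (eq_integrable measurableT _ _ _
    (integrableB measurableT (Lfun2M fi gr) (Lfun2M fr gi))) => x _.
  by rewrite /= !complexDE -EFinB; congr EFin; ring.
Qed.

Lemma cipDl f1 f2 g : L2c mu f1 -> L2c mu f2 -> L2c mu g ->
  cip (fun x => f1 x + f2 x) g = cip f1 g + cip f2 g.
Proof.
move=> L1 L2 Lg; have [r1 i1] := cip_integrable L1 Lg.
have [r2 i2] := cip_integrable L2 Lg.
apply: complex_eqP; rewrite !complexDE /=.
- rewrite -[RHS]fineD ?integrable_fin_num// -integralD//; congr fine.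
  by apply: eq_integral => x _; rewrite /= -EFinD mulrDl ReD.
- rewrite -[RHS]fineD ?integrable_fin_num// -integralD//; congr fine.
  by apply: eq_integral => x _; rewrite /= -EFinD mulrDl ImD.
Qed.

Lemma cipZl (c : R[i]) f g : L2c mu f -> L2c mu g ->
  cip (fun x => c * f x) g = c * cip f g.
Proof.
move=> Lf Lg; have [r i] := cip_integrable Lf Lg.
have Zr (a : R) := integrableZl measurableT a r.
have Zi (a : R) := integrableZl measurableT a i.
apply: complex_eqP; rewrite !complexDE /=.
- transitivity (fine (\int[mu]_x ((complex.Re c)%:E * (complex.Re (f x * (g x)^*))%:E
     - (complex.Im c)%:E * (complex.Im (f x * (g x)^*))%:E))%E).
    congr fine; apply: eq_integral => x _.
    by rewrite -!EFinM -EFinB -mulrA [complex.Re (c * _)]ReM.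
  rewrite integralB//= fineB ?integrable_fin_num//.
  by rewrite !integralZl// !fineM// integrable_fin_num.
- transitivity (fine (\int[mu]_x ((complex.Re c)%:E * (complex.Im (f x * (g x)^*))%:E
     + (complex.Im c)%:E * (complex.Re (f x * (g x)^*))%:E))%E).
    congr fine; apply: eq_integral => x _.
    by rewrite -!EFinM -EFinD -mulrA [complex.Im (c * _)]ImM.
  rewrite integralD//= fineD ?integrable_fin_num//.
  by rewrite !integralZl// !fineM// integrable_fin_num.
Qed.

Lemma cipC f g : L2c mu f -> L2c mu g -> cip g f = (cip f g)^*.
Proof.
move=> Lf Lg; have [r i] := cip_integrable Lf Lg.
apply: complex_eqP; rewrite !complexDE /=.
- by congr fine; apply: eq_integral => x _; rewrite !complexDE; congr EFin; ring.
- rewrite -fineN; congr fine; rewrite -integralN//=.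
    by apply: eq_integral => x _; rewrite !complexDE; congr EFin; ring.
  by apply: integrable_add_def.
Qed.

Lemma cip_nsq f : L2c mu f -> cip f f = (fine (nsq mu f))%:C.
Proof.
move=> Lf; apply: complex_eqP => /=.
- by congr fine; apply: eq_integral => x _; rewrite !complexDE /sqnormc; congr EFin; ring.
- rewrite (_ : (\int[mu]_x _)%E = 0%E)//; apply: integral0_eq => x _.
  by rewrite !complexDE; congr EFin; ring.
Qed.

(** The degenerate case of the Cauchy-Schwarz inequality: a function of norm 0
    vanishes almost everywhere. *)
Lemma cip_null f g : L2c mu f -> L2c mu g -> nsq mu f = 0%E -> cip f g = 0.
Proof.
move=> Lf Lg f0.
have mq := sqnormc_measurable Lf.
have ae0 : ae_eq mu [set: T] (fun x => (sqnormc (f x))%:E) (cst 0%E).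
  apply/ae_eq_integral_abs => //; first exact/measurable_EFinP.
  rewrite -[RHS]f0; apply: eq_integral => x _.
  by rewrite gee0_abs// lee_fin sqnormc_ge0.
have aef : {ae mu, forall x, f x = 0}.
  move: ae0; apply: filterS => x /= /(_ I) [] /eqP.
  rewrite /sqnormc paddr_eq0 ?sqr_ge0// !sqrf_eq0 => /andP[/eqP r0 /eqP i0].
  exact: complex_eqP.
have [r i] := cip_integrable Lf Lg.
have z (h : T -> R[i]) (p : R[i] -> R) : p 0 = 0 -> measurable_fun [set: T] (fun x => p (f x * h x)) ->
    (\int[mu]_x (p (f x * h x))%:E = 0)%E.
  move=> p0 mp; rewrite (ae_eq_integral (cst 0%E))//; first exact: integral0.
  - exact/measurable_EFinP.
  - by move: aef; apply: filterS => x fx _; rewrite fx mul0r p0.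
apply: complex_eqP => /=.
- rewrite (z (fun x => (g x)^*) (fun z => complex.Re z))//.
  by apply/measurable_EFinP; exact: measurable_int r.
- rewrite (z (fun x => (g x)^*) (fun z => complex.Im z))//.
  by apply/measurable_EFinP; exact: measurable_int i.
Qed.

Lemma L2c_sum n (c : nat -> R[i]) (f : nat -> T -> R[i]) :
  (forall k, (k < n)%N -> L2c mu (f k)) ->
  L2c mu (fun x => \sum_(k < n) c k * f k x).
Proof.
elim: n => [|n IHn] Lf.
  by under eq_fun do rewrite big_ord0; exact: L2c0.
under eq_fun do rewrite big_ord_recr/=.
by apply: L2cD; [apply: IHn => k kn; apply: Lf; exact: ltnW|exact/L2cZ/Lf].
Qed.

Lemma cip_suml n (c : nat -> R[i]) (f : nat -> T -> R[i]) g :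
  (forall k, (k < n)%N -> L2c mu (f k)) -> L2c mu g ->
  cip (fun x => \sum_(k < n) c k * f k x) g = \sum_(k < n) c k * cip (f k) g.
Proof.
move=> Lf Lg; elim: n Lf => [|n IHn] Lf.
  rewrite big_ord0; under eq_fun do rewrite big_ord0.
  apply: cip_null => //; first exact: L2c0.
  by apply: integral0_eq => x _; rewrite /sqnormc/= expr0n addr0.
under eq_fun do rewrite big_ord_recr/=.
have Lf' k : (k < n)%N -> L2c mu (f k) by move=> kn; apply: Lf; exact: ltnW.
have Ln : L2c mu (f n) by exact: Lf.
rewrite cipDl ?cipZl ?big_ord_recr/= ?IHn//; last exact: L2cZ.
exact: L2c_sum.
Qed.

Lemma nsq_sum n (c : nat -> R[i]) (f : nat -> T -> R[i]) :
  (forall k, (k < n)%N -> L2c mu (f k)) ->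
  (fine (nsq mu (fun x => \sum_(k < n) c k * f k x)))%:C =
  \sum_(k < n) \sum_(l < n) c k * (c l)^* * cip (f k) (f l).
Proof.
move=> Lf; have L := L2c_sum c Lf.
rewrite -cip_nsq// cip_suml//; apply: eq_bigr => k _.
have Lk : L2c mu (f k) by exact: Lf.
rewrite (cipC L Lk) cip_suml// rmorph_sum mulr_sumr; apply: eq_bigr => l _.
rewrite -[LHS]/(c k * (c l * cip (f l) (f k))^*) (cipC Lk (Lf _ (ltn_ord l))).
by apply: complex_eqP; rewrite !complexDE; ring.
Qed.

End inner_product.

Section nonneg_limits.
Context (R : realType).

Lemma cvge0P (u : nat -> \bar R) : (forall n, (0 <= u n)%E) ->
  u n @[n --> \oo] --> 0%E <->
  (forall e : R, 0 < e -> \forall n \near \oo, (u n < e%:E)%E).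
Proof.
move=> u0; split=> [/fine_cvgP[fu /cvgr0Pnorm_lt h] e e0|h].
  near=> n; have fn : u n \is a fin_num by near: n.
  rewrite -(fineK fn) lte_fin (le_lt_trans (ler_norm _))//.
  by near: n; exact: h.
apply/fine_cvgP; split.
  near=> n; rewrite ge0_fin_numE//; apply: (@lt_trans _ _ 1%:E); last exact: ltry.
  by near: n; exact: h.
apply/cvgr0Pnorm_lt => e e0; near=> n.
rewrite /= ger0_norm ?fine_ge0// -lte_fin fineK; first by near: n; exact: h.
rewrite ge0_fin_numE//; apply: (@lt_trans _ _ 1%:E); last exact: ltry.
by near: n; exact: h.
Unshelve. all: by end_near. Qed.

Lemma le_of_near_mul (x y : R) : 0 <= y ->
  (forall e, 0 < e -> x <= (1 + e) ^+ 2 * y + e) -> x <= y.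
Proof.
move=> y0 h; apply/ler_addgt0Pr => e e0.
pose t := Num.min 1 (e / (3 * y + 1)).
have y1 : 0 < 3 * y + 1 by lra.
have t0 : 0 < t by rewrite lt_min ltr01/= divr_gt0.
have t1 : t <= 1 by rewrite ge_min lexx.
have te : t * (3 * y + 1) <= e by rewrite -ler_pdivlMr// ge_min lexx orbT.
have ty : t ^+ 2 * y <= t * y by rewrite ler_wpM2r// expr2 ler_piMl// ltW.
apply: (le_trans (h t t0)).
rewrite (_ : (1 + t) ^+ 2 * y = y + 2 * (t * y) + t ^+ 2 * y); last by ring.
by rewrite mulrDr mulr1 mulrCA in te; lra.
Qed.

End nonneg_limits.

Section L2_limits.
Context d (T : measurableType d) (R : realType) (mu : {measure set T -> \bar R}).

Lemma L2c_cvgP (f_ : nat -> T -> R[i]) (f : T -> R[i]) :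
  L2c_cvg mu f_ f <-> forall e : R, 0 < e ->
    \forall n \near \oo, (nsq mu (fun x => f_ n x - f x)%R < e%:E)%E.
Proof. by apply: cvge0P => n; exact: nsq_ge0. Qed.

Lemma nsqD2_le f g : L2c mu f -> L2c mu g ->
  (nsq mu (fun x => f x + g x)%R <= 2%:E * nsq mu f + 2%:E * nsq mu g)%E.
Proof.
move=> Lf Lg; have := nsqD_le ltr01 Lf Lg.
by rewrite invr1 (_ : 1 + 1 = 2)//; ring.
Qed.

Lemma L2c_cvgD f_ f g_ g : (forall n, L2c mu (f_ n)) -> L2c mu f ->
  (forall n, L2c mu (g_ n)) -> L2c mu g ->
  L2c_cvg mu f_ f -> L2c_cvg mu g_ g ->
  L2c_cvg mu (fun n x => f_ n x + g_ n x) (fun x => f x + g x).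
Proof.
move=> Lf_ Lf Lg_ Lg /L2c_cvgP cf /L2c_cvgP cg; apply/L2c_cvgP => e e0.
have e4 : 0 < e / 4 by rewrite divr_gt0.
near=> n.
have -> : (fun x => f_ n x + g_ n x - (f x + g x)) =
    (fun x => (f_ n x - f x) + (g_ n x - g x)) by apply/funext => x; ring.
apply: (le_lt_trans (nsqD2_le (L2cB (Lf_ n) Lf) (L2cB (Lg_ n) Lg))).
have hf : (nsq mu (fun x => f_ n x - f x)%R < (e / 4)%:E)%E by near: n; exact: cf.
have hg : (nsq mu (fun x => g_ n x - g x)%R < (e / 4)%:E)%E by near: n; exact: cg.
move: hf hg.
rewrite -(fineK (nsq_fin (L2cB (Lf_ n) Lf))) -(fineK (nsq_fin (L2cB (Lg_ n) Lg))).
by rewrite -!EFinM -EFinD !lte_fin => hf hg; lra.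
Unshelve. all: by end_near. Qed.

Lemma L2c_cvgZ (c : R[i]) f_ f : (forall n, L2c mu (f_ n)) -> L2c mu f ->
  L2c_cvg mu f_ f -> L2c_cvg mu (fun n x => c * f_ n x) (fun x => c * f x).
Proof.
move=> Lf_ Lf /L2c_cvgP cf; apply/L2c_cvgP => e e0.
have c0 : 0 < 1 + sqnormc c by rewrite ltr_pwDl// sqnormc_ge0.
have e4 : 0 < e / (1 + sqnormc c) by rewrite divr_gt0.
near=> n.
under eq_fun do rewrite -mulrBr.
rewrite nsqZ//; last exact: L2cB.
have : (nsq mu (fun x => f_ n x - f x)%R < (e / (1 + sqnormc c))%:E)%E by near: n; exact: cf.
have : (0 <= nsq mu (fun x => f_ n x - f x)%R)%E by exact: nsq_ge0.
rewrite -(fineK (nsq_fin (L2cB (Lf_ n) Lf))) -EFinM lee_fin !lte_fin.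
rewrite ltr_pdivlMr// mulrDr mulr1 mulrC => h0; apply: le_lt_trans.
by rewrite lerDr.
Unshelve. all: by end_near. Qed.

(** Convergence of the norms, in the multiplicative form given by [nsqD_le]. *)
Lemma nsq_near_le (e : R) f_ f : (forall n, L2c mu (f_ n)) -> L2c mu f ->
  L2c_cvg mu f_ f -> 0 < e -> \forall n \near \oo,
  fine (nsq mu f) <= (1 + e) * fine (nsq mu (f_ n)) + e /\
  fine (nsq mu (f_ n)) <= (1 + e) * fine (nsq mu f) + e.
Proof.
move=> Lf_ Lf /L2c_cvgP cf e0.
have ei : 0 < 1 + e^-1 by rewrite ltr_pwDl// invr_ge0 ltW.
have e4 : 0 < e / (1 + e^-1) by rewrite divr_gt0.
near=> n.
have hn : (nsq mu (fun x => f_ n x - f x)%R < (e / (1 + e^-1))%:E)%E by near: n; exact: cf.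
have LB := L2cB (Lf_ n) Lf.
have {}hn : (1 + e^-1) * fine (nsq mu (fun x => f_ n x - f x)) <= e.
  by rewrite mulrC -ler_pdivlMr// -lee_fin fineK ?nsq_fin// ltW.
have key g h : L2c mu g -> L2c mu h -> nsq mu h = nsq mu (fun x => f_ n x - f x) ->
    fine (nsq mu (fun x => g x + h x)) <= (1 + e) * fine (nsq mu g) + e.
  move=> Lg Lh hh; have := nsqD_le e0 Lg Lh.
  rewrite hh -(fineK (nsq_fin Lg)) -(fineK (nsq_fin (L2cD Lg Lh))) -(fineK (nsq_fin LB)).
  by rewrite -!EFinM -EFinD lee_fin => /le_trans; apply; rewrite lerD2l.
split.
- have := @key (f_ n) (fun x => - (f_ n x - f x)) (Lf_ n); rewrite nsqN.
  have LN : L2c mu (fun x => - (f_ n x - f x)).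
    by under eq_fun do rewrite -mulN1r; exact: L2cZ.
  move=> /(_ LN erefl); congr (_ <= _); congr (fine (nsq mu _)).
  by apply/funext => x; rewrite opprB addrC subrK.
- have := @key f (fun x => f_ n x - f x) Lf LB erefl.
  by congr (_ <= _); congr (fine (nsq mu _)); apply/funext => x; rewrite addrC subrK.
Unshelve. all: by end_near. Qed.

End L2_limits.

(** An inequality between norms in two different L2 spaces passes to
    simultaneous limits; it transports the isometry from simple functions to
    the integral. *)
Lemma nsq_limit_le d (T : measurableType d) d' (T' : measurableType d')
    (R : realType) (mu : {measure set T -> \bar R}) (nu : {measure set T' -> \bar R})
    (f_ : nat -> T -> R[i]) f (g_ : nat -> T' -> R[i]) g :
  (forall n, L2c mu (f_ n)) -> L2c mu f -> L2c_cvg mu f_ f ->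
  (forall n, L2c nu (g_ n)) -> L2c nu g -> L2c_cvg nu g_ g ->
  (forall n, (nsq mu (f_ n) <= nsq nu (g_ n))%E) -> (nsq mu f <= nsq nu g)%E.
Proof.
move=> Lf_ Lf cf Lg_ Lg cg h.
rewrite -(fineK (nsq_fin Lf)) -(fineK (nsq_fin Lg)) lee_fin.
apply: le_of_near_mul => [|e e0]; first by rewrite fine_ge0// nsq_ge0.
pose t := Num.min 1 (e / 3).
have t0 : 0 < t by rewrite lt_min ltr01 divr_gt0.
have t1 : t <= 1 by rewrite ge_min lexx.
have te : t * 3 <= e by rewrite -ler_pdivlMr// ge_min lexx orbT.
have [n [[hf _] [_ hg]]] : exists n,
    (fine (nsq mu f) <= (1 + t) * fine (nsq mu (f_ n)) + t /\
     fine (nsq mu (f_ n)) <= (1 + t) * fine (nsq mu f) + t) /\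
    (fine (nsq nu g) <= (1 + t) * fine (nsq nu (g_ n)) + t /\
     fine (nsq nu (g_ n)) <= (1 + t) * fine (nsq nu g) + t).
  near \oo => n; exists n; split.
    by near: n; exact: nsq_near_le.
  by near: n; exact: nsq_near_le.
have := h n; rewrite -(fineK (nsq_fin (Lf_ n))) -(fineK (nsq_fin (Lg_ n))) lee_fin => hn.
have g0 : 0 <= fine (nsq nu g) by rewrite fine_ge0// nsq_ge0.
have te' : t <= e by lra.
have tp : 0 <= 1 + t by lra.
apply: (le_trans hf); apply: (@le_trans _ _ ((1 + t) * ((1 + t) * fine (nsq nu g) + t) + t)).
  by rewrite lerD2r ler_wpM2l// (le_trans hn).
have tt : t * t <= t by rewrite ler_piMl// ltW.
have : (1 + t) ^+ 2 * fine (nsq nu g) <= (1 + e) ^+ 2 * fine (nsq nu g).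
  by rewrite ler_wpM2r// ler_sqr ?nnegrE; lra.
by rewrite mulrDr mulrA -expr2 mulrDl mul1r => ?; lra.
Unshelve. all: by end_near. Qed.

Lemma L2c_cvg_ext d (T : measurableType d) (R : realType)
    (mu : {measure set T -> \bar R}) (f_ g_ : nat -> T -> R[i]) f :
  (forall n x, f_ n x = g_ n x) -> L2c_cvg mu f_ f -> L2c_cvg mu g_ f.
Proof.
move=> fg; suff -> : f_ = g_ by [].
by apply/funext => n; apply/funext => x.
Qed.

Section square_integrable.
Context d (T : measurableType d) (R : realType).

Lemma Lfun2_of_sqr (mu : {measure set T -> \bar R}) (f : T -> R) :
  measurable_fun [set: T] f -> (\int[mu]_x (f x ^+ 2)%:E < +oo)%E ->
  f \in Lfun mu 2%:E.
Proof.
move=> mf h; rewrite inE; apply/andP; split; rewrite inE//=.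
rewrite /finite_norm unlock poweR_lty//.
rewrite (eq_integral (fun x => (f x ^+ 2)%:E))// => x _.
by rewrite /= powR_mulrn// real_normK// num_real.
Qed.

Lemma Lfun2_bounded (mu : {finite_measure set T -> \bar R}) (f : T -> R) (M : R) :
  measurable_fun [set: T] f -> (forall x, `|f x| <= M) -> f \in Lfun mu 2%:E.
Proof.
move=> mf fM; apply: Lfun2_of_sqr => //.
apply: (@le_lt_trans _ _ (\int[mu]_x (cst (M ^+ 2)%:E) x)%E).
  apply: ge0_le_integral => //.
  - by move=> x _; rewrite lee_fin sqr_ge0.
  - by apply/measurable_EFinP; exact: measurable_funX.
  - by move=> x _ /=; rewrite lee_fin -[leLHS]real_normK ?num_real// ler_sqr ?nnegrE ?(le_trans _ (fM x)).
rewrite integral_cst//; have := fin_num_measure mu _ measurableT.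
by rewrite ltey_eq => ?; rewrite fin_numM.
Qed.

End square_integrable.

(** * The stochastic integral is an isometry *)

Section stochastic_isometry.
Context d (T : measurableType d) (R : realType) (P : probability T R).
Context (F : {finite_measure set (measurableTypeR R) -> \bar R}).
Context (Z : set R -> T -> R[i]) (Zo : orthogonal_random_measure P F Z).
Local Notation borel := (measurable : set (set (measurableTypeR R))).
Local Notation "'ind' A" := (fun l : measurableTypeR R => (\1_A l : R)%:C)
  (at level 10).

Let L2Z A : borel A -> L2c P (Z A). Proof. exact: (ormeas_L2 Zo). Qed.

Lemma ormeas_nsq A : borel A -> nsq P (Z A) = F A.
Proof. by move=> /(ormeas_structure Zo); rewrite unlock. Qed.

Lemma ormeas_cip_disj A B : borel A -> borel B -> A `&` B = set0 ->
  cip P (Z A) (Z B) = 0.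
Proof.
move=> mA mB AB; have := ormeas_orthogonal Zo mA mB AB.
by rewrite /expectationc unlock.
Qed.

Lemma nsq_null_sum (f : T -> R[i]) n : L2c P f -> nsq P f = 0%E ->
  nsq P (fun w => \sum_(k < n) f w) = 0%E.
Proof.
move=> Lf f0; under eq_fun => w.
  rewrite sumr_const card_ord -mulr_natl; over.
by rewrite nsqZ// f0 mule0.
Qed.

(** Countable additivity for the sequence A, B, set0, set0, and so on; Z set0 has
    norm F set0 = 0. *)
Lemma ormeas_additive2 A B : borel A -> borel B -> A `&` B = set0 ->
  nsq P (fun w => Z (A `|` B) w - (Z A w + Z B w)) = 0%E.
Proof.
move=> mA mB AB.
have mAB : borel (A `|` B) by exact: measurableU.
have mC n : borel (bigcup2 A B n) by case: n => [|[|n]] //=.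
have tC : trivIset setT (bigcup2 A B) by rewrite -trivIset_bigcup2.
have := ormeas_additive Zo mC tC; rewrite bigcup2E => /L2c_cvgP cv.
have Z0 : nsq P (Z set0) = 0%E by rewrite ormeas_nsq ?measure0.
have LV : L2c P (fun w => Z (A `|` B) w - (Z A w + Z B w)).
  by apply: L2cB; [exact: L2Z|apply: L2cD; exact: L2Z].
apply/eqP; rewrite eq_le nsq_ge0 andbT -(fineK (nsq_fin LV)) lee_fin.
apply/ler_addgt0Pr => e e0; rewrite add0r.
have e2 : 0 < e / 2 by rewrite divr_gt0.
have [n hn] : exists n, (nsq P (fun w =>
    \sum_(k < n.+2) Z (bigcup2 A B k) w - Z (A `|` B) w)%R < (e / 2)%:E)%E.
  have [N _ hN] := cv _ e2; exists N; apply: hN => /=.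
  by rewrite (leq_trans (leqnSn _)) ?leqnSn.
have LS : L2c P (fun w => \sum_(k < n) Z set0 w).
  have := @L2c_sum _ _ _ P n (fun=> 1) (fun=> Z set0)
    (fun _ _ => L2Z (@measurable0 _ _)).
  by under eq_fun do under eq_bigr do rewrite mul1r.
pose g w := \sum_(k < n.+2) Z (bigcup2 A B k) w - Z (A `|` B) w.
have gE : g = (fun w => \sum_(k < n) Z set0 w - (Z (A `|` B) w - (Z A w + Z B w))).
  by apply/funext => w; rewrite /g !big_ord_recl/=; ring.
have Lg : L2c P g by rewrite gE; exact: L2cB.
have : (nsq P (fun w => Z (A `|` B) w - (Z A w + Z B w))%R <=
    2%:E * nsq P (fun w => \sum_(k < n) Z set0 w)%R + 2%:E * nsq P g)%E.
  rewrite -(nsqN P g).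
  have -> : (fun w => Z (A `|` B) w - (Z A w + Z B w)) =
      (fun w => \sum_(k < n) Z set0 w + - g w).
    by apply/funext => w; rewrite gE; ring.
  apply: nsqD2_le => //.
  by under eq_fun do rewrite -mulN1r; exact: L2cZ.
rewrite nsq_null_sum//; last exact: L2Z.
rewrite mule0 add0e -(fineK (nsq_fin LV)) -(fineK (nsq_fin Lg)) -EFinM lee_fin.
move/le_trans; apply; rewrite mulrC -ler_pdivlMr// -lee_fin fineK ?nsq_fin//.
exact: ltW.
Qed.

(** Z A splits into Z (A `&` B) and Z (A `\` B), up to a function of norm 0, and
    the second part is orthogonal to Z B. *)
Lemma ormeas_cip_setI A B : borel A -> borel B ->
  cip P (Z A) (Z B) = cip P (Z (A `&` B)) (Z B).
Proof.
move=> mA mB; have mI : borel (A `&` B) by exact: measurableI.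
have mD : borel (A `\` B) by exact: measurableD.
have ID : A `&` B `&` (A `\` B) = set0.
  by apply/seteqP; split=> // x [[_ ?] []].
have AE : A `&` B `|` A `\` B = A by rewrite setUIDK.
have n0 := ormeas_additive2 mI mD ID; rewrite AE in n0.
pose V w := Z A w - (Z (A `&` B) w + Z (A `\` B) w).
have LV : L2c P V by apply: L2cB; [exact: L2Z|apply: L2cD; exact: L2Z].
have ZE : Z A = (fun w => V w + (Z (A `&` B) w + Z (A `\` B) w)).
  by apply/funext => w; rewrite /V subrK.
have LI := L2Z mI; have LD := L2Z mD; have LB := L2Z mB.
rewrite {1}ZE cipDl//; last exact: L2cD.
rewrite (cip_null LV LB n0) add0r cipDl//.
rewrite (@ormeas_cip_disj (A `\` B) B)// ?addr0//.
by rewrite setDKI.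
Qed.

Lemma ormeas_cip A B : borel A -> borel B ->
  cip P (Z A) (Z B) = (fine (F (A `&` B)))%:C.
Proof.
move=> mA mB; have mI : borel (A `&` B) by exact: measurableI.
have LI := L2Z mI; have LB := L2Z mB.
rewrite ormeas_cip_setI// (cipC LB LI) ormeas_cip_setI//.
rewrite [X in cip P (Z X) _](_ : _ = A `&` B); last first.
  by rewrite setIC -setIA setIid.
by rewrite cip_nsq// conjc_real ormeas_nsq.
Qed.

Lemma L2c_ind A : borel A -> L2c F (ind A).
Proof.
move=> mA; split => /=; last exact: Lfun_cst.
apply: (@Lfun2_bounded _ _ _ F _ 1) => //; first exact: measurable_indic.
by move=> x; rewrite indicE; case: (_ \in _); rewrite ?normr1 ?normr0.
Qed.

Lemma ind_cip A B : borel A -> borel B ->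
  cip F (ind A) (ind B) = (fine (F (A `&` B)))%:C.
Proof.
move=> mA mB; apply: complex_eqP => /=.
- rewrite -(setIT (A `&` B)) -integral_indic//; last exact: measurableI.
  congr fine; apply: eq_integral => x _; rewrite indicI/=.
  by congr EFin; ring.
- rewrite (_ : (\int[F]_x _)%E = 0%E)//; apply: integral0_eq => x _.
  by congr EFin; ring.
Qed.

Lemma L2c_simple n (c : nat -> R[i]) (A : nat -> set R) :
  (forall k, borel (A k)) -> L2c F (fun l => \sum_(k < n) c k * ind (A k) l).
Proof.
by move=> mA; apply: (L2c_sum c (f := fun k => ind (A k))) => k _; exact: L2c_ind.
Qed.

Lemma L2c_simpleZ n (c : nat -> R[i]) (A : nat -> set R) :
  (forall k, borel (A k)) -> L2c P (fun w => \sum_(k < n) c k * Z (A k) w).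
Proof.
by move=> mA; apply: (L2c_sum c (f := fun k => Z (A k))) => k _; exact: L2Z.
Qed.

(** Both sides are the quadratic form in c with Gram matrix F(A_k `&` A_l). The
    sets may overlap, hence [ormeas_cip] rather than orthogonality of disjoint
    sets. *)
Lemma simple_isometry n (c : nat -> R[i]) (A : nat -> set R) :
  (forall k, (k < n)%N -> borel (A k)) ->
  nsq P (fun w => \sum_(k < n) c k * Z (A k) w) =
  nsq F (fun l => \sum_(k < n) c k * ind (A k) l).
Proof.
move=> mA.
have LZ k : (k < n)%N -> L2c P (Z (A k)) by move=> /mA/L2Z.
have LI k : (k < n)%N -> L2c F (ind (A k)) by move=> /mA/L2c_ind.
rewrite -(fineK (nsq_fin (L2c_sum c LZ))).
rewrite -(fineK (nsq_fin (L2c_sum c LI))).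
congr EFin; apply: (@complexI R).
have := nsq_sum c LZ; have := nsq_sum c LI => -> ->.
apply: eq_bigr => k _; apply: eq_bigr => l _.
by rewrite ormeas_cip ?ind_cip//; apply: mA.
Qed.

(** Simple functions have equal norms on both sides, and both norms pass to the
    limit. *)
Lemma stochastic_integral_le f X : is_stochastic_integral P F Z f X ->
  (nsq P X <= nsq F f)%E.
Proof.
move=> [Lf LX [m [c [A [mA cf cX]]]]].
apply: (nsq_limit_le _ LX cX _ Lf cf) => n.
- exact: L2c_simpleZ.
- exact: L2c_simple.
- by rewrite simple_isometry.
Qed.

Lemma stochastic_integralZ (a : R[i]) f X : is_stochastic_integral P F Z f X ->
  is_stochastic_integral P F Z (fun l => a * f l) (fun w => a * X w).
Proof.
move=> [Lf LX [m [c [A [mA cf cX]]]]].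
split; [exact: L2cZ|exact: L2cZ|].
exists m, (fun n k => a * c n k), A; split=> //.
- apply: L2c_cvg_ext (L2c_cvgZ a (fun n => L2c_simple _ _ (mA n)) Lf cf) => n l.
  by rewrite mulr_sumr; apply: eq_bigr => k _; rewrite mulrA.
- apply: L2c_cvg_ext (L2c_cvgZ a (fun n => L2c_simpleZ _ _ (mA n)) LX cX) => n l.
  by rewrite mulr_sumr; apply: eq_bigr => k _; rewrite mulrA.
Qed.

Lemma stochastic_integralD f X g Y : is_stochastic_integral P F Z f X ->
  is_stochastic_integral P F Z g Y ->
  is_stochastic_integral P F Z (fun l => f l + g l) (fun w => X w + Y w).
Proof.
move=> [Lf LX [m [c [A [mA cf cX]]]]] [Lg LY [m' [c' [A' [mA' cg cY]]]]].
split; [exact: L2cD|exact: L2cD|].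
(* the approximating simple functions are concatenated term by term *)
exists (fun n => (m n + m' n)%N),
  (fun n k => if (k < m n)%N then c n k else c' n (k - m n)%N),
  (fun n k => if (k < m n)%N then A n k else A' n (k - m n)%N).
have sumE (V : set R -> R[i]) n :
    \sum_(k < m n + m' n) (if (k < m n)%N then c n k else c' n (k - m n)%N) *
      V (if (k < m n)%N then A n k else A' n (k - m n)%N) =
    \sum_(k < m n) c n k * V (A n k) + \sum_(k < m' n) c' n k * V (A' n k).
  rewrite big_split_ord; congr (_ + _); apply: eq_bigr => k _ /=.
    by rewrite ltn_ord.
  by rewrite ltnNge leq_addr/= addKn.
split=> [n k| |]; first by case: ifP.
- apply: L2c_cvg_ext (L2c_cvgD (fun n => L2c_simple _ _ (mA n)) Lf
    (fun n => L2c_simple _ _ (mA' n)) Lg cf cg) => n l.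
  by rewrite (sumE (fun A => ind A l)).
- apply: L2c_cvg_ext (L2c_cvgD (fun n => L2c_simpleZ _ _ (mA n)) LX
    (fun n => L2c_simpleZ _ _ (mA' n)) LY cX cY) => n l.
  by rewrite (sumE (fun A => Z A l)).
Qed.

Lemma stochastic_integralB f X g Y : is_stochastic_integral P F Z f X ->
  is_stochastic_integral P F Z g Y ->
  is_stochastic_integral P F Z (fun l => f l - g l) (fun w => X w - Y w).
Proof.
move=> fX /(stochastic_integralZ (-1)) gY; have := stochastic_integralD fX gY.
by under eq_fun do rewrite mulN1r; under [X in is_stochastic_integral _ _ _ _ X -> _]eq_fun do rewrite mulN1r.
Qed.

End stochastic_isometry.
(** * Approximating the wave by trigonometric polynomials *)

Section trigonometric_bounds.
Context (R : realType).
Implicit Types a b x y z : R.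

Lemma mean_value0 (f df : R -> R) x :
  (forall y, is_derive y 1 f (df y)) ->
  exists2 c, `|c| <= `|x| & f x - f 0 = df c * x.
Proof.
move=> fd.
have cf (A : set R) : {within A, continuous f}.
  apply: continuous_subspaceT => y; apply: differentiable_continuous.
  by apply/derivable1_diffP; case: (fd y).
have [x0|x0|->] := ltgtP x 0; last by exists 0 => //; rewrite mulr0 subrr.
- have [c + hc] := MVT x0 (fun y _ => fd y) (cf _).
  rewrite in_itv/= => /andP[xc c0]; exists c.
    by rewrite !ltr0_norm// lerN2 ltW.
  by rewrite -[LHS]opprB hc sub0r mulrN opprK.
- have [c + hc] := MVT x0 (fun y _ => fd y) (cf _).
  rewrite in_itv/= => /andP[c0 cx]; exists c; last by rewrite hc subr0.
  by rewrite !gtr0_norm// ltW.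
Qed.

Lemma sin_le_norm x : `|sin x| <= `|x|.
Proof.
have [c _] := mean_value0 x (@is_derive_sin R).
by rewrite sin0 subr0 => ->; rewrite normrM ler_piMl// cos_max.
Qed.

(** For |z| <= 1 the exponent 2 may be lowered to 2 beta, and for |z| > 1 the
    right-hand side exceeds 1. *)
Lemma sin_sqr_le (z beta : R) : 0 < beta <= 1 ->
  sin z ^+ 2 <= `|z| `^ (2 * beta).
Proof.
move=> /andP[b0 b1]; rewrite -(real_normK (num_real (sin z))).
have p2 : (0 : R) <= 2 * beta by rewrite mulr_ge0// ltW.
have [z1|z1] := leP `|z| 1; last first.
  apply: (@le_trans _ _ 1); first by rewrite expr_le1// sin_max.
  by rewrite -[leLHS](powRr0 `|z|) ler_powR// ltW.
have [z0|z0] := eqVneq `|z| 0.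
  by rewrite (normr0_eq0 z0) sin0 normr0 expr0n powR_ge0.
have zp : 0 < `|z| by rewrite lt_neqAle eq_sym z0 normr_ge0.
apply: (@le_trans _ _ (`|z| ^+ 2)); first by rewrite lerXn2r ?nnegrE ?sin_le_norm.
rewrite -powR_mulrn//; apply: ger_powR; first by rewrite zp z1.
by rewrite ler_piMr.
Qed.

Lemma one_minus_cos_le x : `|1 - cos x| <= x ^+ 2.
Proof.
have [c cx] := mean_value0 x (@is_derive_cos R).
rewrite cos0 distrC => ->; rewrite normrM normrN -[leRHS]real_normK ?num_real//.
by rewrite expr2 ler_wpM2r// (le_trans (sin_le_norm c)).
Qed.

Lemma sin_sub_le x : `|x - sin x| <= x ^+ 2.
Proof.
have [c cx] := mean_value0 x (@is_derive_cos R).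
have [c' c'x] := mean_value0 x (@is_derive_sin R).
rewrite sin0 subr0 => ->.
have -> : x - cos c' * x = (1 - cos c') * x by ring.
rewrite normrM -[leRHS]real_normK ?num_real// expr2 ler_wpM2r//.
have [e ec] := mean_value0 c' (@is_derive_cos R).
rewrite cos0 distrC => ->; rewrite normrM normrN (le_trans _ c'x)//.
by rewrite ler_piMl// sin_max.
Qed.

Lemma expiD a b : expi (a + b) = expi a * expi b.
Proof. by apply: complex_eqP; rewrite !complexDE /= ?cosD ?sinD//; ring. Qed.

Lemma expi0 : expi (0 : R) = 1.
Proof. by rewrite /expi cos0 sin0. Qed.

Lemma sqnormc_expi a : sqnormc (expi a) = 1.
Proof. exact: cos2Dsin2. Qed.

Lemma sqnormc_expiB a b : sqnormc (expi a - expi b) = 4 * sin ((a - b) / 2) ^+ 2.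
Proof.
have -> : sqnormc (expi a - expi b) = 2 - 2 * cos (a - b).
  rewrite /sqnormc !complexDE /= cosB.
  have ha := cos2Dsin2 a; have hb := cos2Dsin2 b.
  rewrite (_ : _ + _ = (cos a ^+ 2 + sin a ^+ 2) + (cos b ^+ 2 + sin b ^+ 2)
    - 2 * (cos a * cos b + sin a * sin b)); last by ring.
  by rewrite ha hb.
have -> : cos (a - b) = cos (((a - b) / 2) *+ 2).
  by congr cos; rewrite -mulr_natr; field.
by rewrite cos_mulr2n cos2sin2; set s := sin _; ring.
Qed.

Lemma normcE (z : R[i]) : Normc.normc z = Num.sqrt (sqnormc z).
Proof. by case: z. Qed.

Lemma sqnormcE (z : R[i]) : sqnormc z = Normc.normc z ^+ 2.
Proof. by rewrite normcE sqr_sqrtr// sqnormc_ge0. Qed.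

Lemma normc_ge0 (z : R[i]) : 0 <= Normc.normc z.
Proof. by rewrite normcE sqrtr_ge0. Qed.

Lemma normc_expi a : Normc.normc (expi a) = 1.
Proof. by rewrite normcE sqnormc_expi sqrtr1. Qed.

Lemma normc_le (z : R[i]) x : 0 <= x -> sqnormc z <= x ^+ 2 -> Normc.normc z <= x.
Proof.
move=> x0 zx; rewrite normcE; have -> : x = Num.sqrt (x ^+ 2).
  by rewrite sqrtr_sqr ger0_norm.
by rewrite ler_sqrt ?sqr_ge0.
Qed.

Lemma normc_expiB_le a b : Normc.normc (expi a - expi b) <= `|a - b|.
Proof.
apply: normc_le => //; rewrite sqnormc_expiB real_normK ?num_real//.
have := sin_le_norm ((a - b) / 2).
rewrite -ler_sqr ?nnegrE// !real_normK ?num_real// => h.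
by rewrite (le_trans (ler_wpM2l _ h))// expr_div_n; lra.
Qed.

(** The first-order Taylor expansion of exp(i z). *)
Lemma normc_expi_affine z : Normc.normc (expi z - (1 +i* z)) <= 2 * z ^+ 2.
Proof.
have z2 : 0 <= z ^+ 2 by rewrite sqr_ge0.
apply: normc_le; first by rewrite mulr_ge0.
rewrite /sqnormc !complexDE /=.
have := one_minus_cos_le z; have := sin_sub_le z.
rewrite -ler_sqr ?nnegrE// real_normK ?num_real// => h1.
rewrite -ler_sqr ?nnegrE// real_normK ?num_real// => h2.
have := sqr_ge0 (z ^+ 2).
have -> : (cos z - 1) ^+ 2 = (1 - cos z) ^+ 2 by ring.
have -> : (sin z - z) ^+ 2 = (z - sin z) ^+ 2 by ring.
have -> : (2 * z ^+ 2) ^+ 2 = 4 * (z ^+ 2) ^+ 2 by ring.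
lra.
Qed.

(** Telescoping of u^n - w^n into n terms. *)
Lemma normcX_sub (u w : R[i]) (B : R) n : Normc.normc u <= 1 ->
  (forall k, (k <= n)%N -> Normc.normc w ^+ k <= B) ->
  Normc.normc (u ^+ n - w ^+ n) <= n%:R * B * Normc.normc (u - w).
Proof.
move=> u1; elim: n => [|n IHn] wB.
  by rewrite !expr0 subrr Normc.normc0 !mul0r.
have -> : u ^+ n.+1 - w ^+ n.+1 = u * (u ^+ n - w ^+ n) + (u - w) * w ^+ n.
  by rewrite !exprS; ring.
apply: (le_trans (le_normcD _ _)).
have normcX (y : R[i]) k : Normc.normc (y ^+ k) = Normc.normc y ^+ k.
  by elim: k => [|k IHk]; rewrite ?expr0 ?Normc.normc1// !exprS Normc.normcM IHk.
rewrite !Normc.normcM normcX -natr1 mulrDl mul1r mulrDl lerD//.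
  apply: (@le_trans _ _ (Normc.normc (u ^+ n - w ^+ n))).
    by rewrite ler_piMl// normc_ge0.
  by apply: IHn => k kn; apply: wB; exact: leqW.
by rewrite mulrC ler_wpM2r ?normc_ge0// wB.
Qed.

(** |1 + i y/K|^2 = 1 + y^2/K^2 <= exp(y^2/K^2). *)
Lemma sqnormc_affineX_le y K : (0 < K)%N ->
  sqnormc ((1 +i* (y / K%:R)) ^+ K) <= expR (y ^+ 2 / K%:R).
Proof.
move=> K0; rewrite sqnormcX /sqnormc/= expr1n.
have -> : y ^+ 2 / K%:R = (y / K%:R) ^+ 2 * K%:R.
  by field; rewrite pnatr_eq0 -lt0n.
rewrite expRM_natr lerXn2r ?nnegrE ?expR_ge0 ?addr_ge0 ?sqr_ge0//.
exact: expR_ge1Dx.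
Qed.

(** Euler's limit (1 + i y/K)^K --> exp(i y), with an explicit rate. *)
Lemma normc_expi_powB y K : (0 < K)%N ->
  Normc.normc (expi y - (1 +i* (y / K%:R)) ^+ K) <=
    2 * y ^+ 2 * expR (y ^+ 2 / K%:R) / K%:R.
Proof.
move=> K0; have K0' : K%:R != 0 :> R by rewrite pnatr_eq0 -lt0n.
have Kp : 0 < K%:R :> R by rewrite ltr0n.
set z := y / K%:R; set w : R[i] := 1 +i* z.
have -> : expi y = expi z ^+ K.
  have e n : expi (z * n%:R) = expi z ^+ n.
    elim: n => [|n IHn]; first by rewrite mulr0 expi0 expr0.
    by rewrite exprSr -natr1 mulrDr mulr1 expiD IHn.
  by rewrite -e /z divfK.
have w1 : 1 <= Normc.normc w.
  by rewrite normcE -[leLHS]sqrtr1 ler_sqrt /sqnormc/= expr1n ?lerDl ?addr_ge0 ?sqr_ge0.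
have wB k : (k <= K)%N -> Normc.normc w ^+ k <= expR (y ^+ 2 / K%:R).
  move=> kK; apply: (@le_trans _ _ (Normc.normc w ^+ K)).
    exact: ler_weXn2l.
  apply: (@le_trans _ _ ((Normc.normc w ^+ K) ^+ 2)).
    by rewrite expr2 ler_peMl ?exprn_ge0 ?exprn_ege1// (le_trans ler01).
  by rewrite -exprM mulnC exprM -sqnormcE -sqnormcX; exact: sqnormc_affineX_le.
have e1 : Normc.normc (expi z) <= 1 by rewrite normc_expi.
apply: (le_trans (normcX_sub e1 wB)).
apply: (@le_trans _ _ (K%:R * expR (y ^+ 2 / K%:R) * (2 * z ^+ 2))).
  by rewrite ler_wpM2l ?normc_expi_affine// mulr_ge0 ?expR_ge0.
by rewrite /z le_eqVlt; apply/orP; left; apply/eqP; field.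
Qed.

End trigonometric_bounds.

Section trigonometric_polynomials.
Context (R : realType).

(** The pairs are coefficient and frequency. *)
Definition trigpoly (s : seq (R[i] * R)) (l : R) : R[i] :=
  \sum_(p <- s) p.1 * expi (l * p.2).

Definition is_trigpoly (f : R -> R[i]) : Prop := exists s, f =1 trigpoly s.

Lemma is_trigpoly_expi x : is_trigpoly (fun l => expi (l * x)).
Proof. by exists [:: (1, x)] => l; rewrite /trigpoly big_seq1 mul1r. Qed.

Lemma is_trigpoly_cst c : is_trigpoly (fun=> c).
Proof. by exists [:: (c, 0)] => l; rewrite /trigpoly big_seq1/= mulr0 expi0 mulr1. Qed.

Lemma is_trigpolyD f g : is_trigpoly f -> is_trigpoly g ->
  is_trigpoly (fun l => f l + g l).
Proof.
by move=> [s fs] [s' gs]; exists (s ++ s') => l; rewrite fs gs /trigpoly big_cat.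
Qed.

Lemma is_trigpolyM f g : is_trigpoly f -> is_trigpoly g ->
  is_trigpoly (fun l => f l * g l).
Proof.
move=> [s fs] [s' gs].
exists [seq (p.1 * q.1, p.2 + q.2) | p <- s, q <- s'] => l.
rewrite fs gs /trigpoly big_allpairs_dep mulr_suml; apply: eq_bigr => p _.
rewrite mulr_sumr; apply: eq_bigr => q _ /=.
by rewrite mulrDr expiD; ring.
Qed.

Lemma is_trigpolyX f n : is_trigpoly f -> is_trigpoly (fun l => f l ^+ n).
Proof.
move=> tf; elim: n => [|n IHn].
  by under eq_fun do rewrite expr0; exact: is_trigpoly_cst.
by under eq_fun do rewrite exprS; exact: is_trigpolyM.
Qed.

Lemma is_trigpoly_sin x : is_trigpoly (fun l => (sin (l * x))%:C).
Proof.
have := is_trigpolyM (is_trigpoly_cst (0 +i* (- 2^-1)))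
  (is_trigpolyD (is_trigpoly_expi x)
    (is_trigpolyM (is_trigpoly_cst (-1)) (is_trigpoly_expi (- x)))).
congr is_trigpoly; apply/funext => l.
by apply: complex_eqP; rewrite !complexDE /= mulrN sinN cosN; field.
Qed.

(** With J = j + 1, the cube of l is replaced by the cube of J sin(l/J), which is
    a trigonometric polynomial, and the exponential of i y by the J^6-th Euler
    power. The exponent 6 is chosen because y = t (J sin(l/J))^3 has
    |y| <= |t| J^3, so that y^2 / J^6 <= t^2 uniformly in l and j; this is what
    bounds the powers [wave_approx_le]. *)
Definition wave_approx (x t : R) (j : nat) (l : R) : R[i] :=
  expi (l * x) *
  (1 +i* (t * (j.+1%:R * sin (l / j.+1%:R)) ^+ 3 / (j.+1 ^ 6)%:R)) ^+ (j.+1 ^ 6).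

Lemma is_trigpoly_wave_approx x t j : is_trigpoly (wave_approx x t j).
Proof.
apply: is_trigpolyM; first exact: is_trigpoly_expi.
apply: is_trigpolyX.
have := is_trigpolyD (is_trigpoly_cst 1)
  (is_trigpolyM (is_trigpoly_cst (0 +i* (t * j.+1%:R ^+ 3 / (j.+1 ^ 6)%:R)))
     (is_trigpolyX 3 (is_trigpoly_sin j.+1%:R^-1))).
congr is_trigpoly; apply/funext => l.
have -> : (sin (l / j.+1%:R))%:C ^+ 3 = (sin (l / j.+1%:R) ^+ 3)%:C.
  by rewrite rmorphXn.
by apply: complex_eqP; rewrite !complexDE /=; ring.
Qed.

Lemma wave_approx_le x t j l : sqnormc (wave_approx x t j l) <= expR (t ^+ 2).
Proof.
rewrite sqnormcM sqnormc_expi mul1r.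
have J0 : (0 < j.+1 ^ 6)%N by rewrite expn_gt0.
have J1 : 0 < (j.+1 ^ 6)%:R :> R by rewrite ltr0n.
apply: (le_trans (sqnormc_affineX_le _ J0)); rewrite ler_expR ler_pdivrMr//.
by rewrite exprMn ler_wpM2l ?sqr_ge0// -exprM natrX exprMn ler_piMr ?exprn_ge0//.
Qed.

Lemma wave_approx_dist x t j l :
  Normc.normc (wave_approx x t j l - expi (l * x + l ^+ 3 * t)) <=
    (2 * (t * l ^+ 3) ^+ 2 * expR (t ^+ 2) + 3 * `|t| * l ^+ 4) / j.+1%:R.
Proof.
set J : R := j.+1%:R.
have J1 : 1 <= J by rewrite ler1n.
have J0 : 0 < J by rewrite ltr0n.
set s := J * sin (l / J); pose y := t * s ^+ 3.
have sl : `|s| <= `|l|.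
  rewrite normrM (gtr0_norm J0) -ler_pdivlMl//.
  have -> : J^-1 * `|l| = `|l / J| by rewrite normrM normfV (gtr0_norm J0) mulrC.
  exact: sin_le_norm.
have sJ : `|s - l| <= l ^+ 2 / J.
  have -> : s - l = - (J * (l / J - sin (l / J))) by rewrite /s; field; rewrite gt_eqF.
  rewrite normrN normrM (gtr0_norm J0).
  apply: (le_trans (ler_wpM2l (ltW J0) (sin_sub_le _))).
  by rewrite le_eqVlt; apply/orP; left; apply/eqP; field; rewrite gt_eqF.
have J60 : (0 < j.+1 ^ 6)%N by rewrite expn_gt0.
have JE : (j.+1 ^ 6)%:R = J ^+ 6 :> R by rewrite natrX.
have J6 : J <= J ^+ 6 by rewrite ler_eXnr.
have J6p : 0 < J ^+ 6 by rewrite exprn_gt0.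
have yl : y ^+ 2 <= (t * l ^+ 3) ^+ 2.
  have sl2 : s ^+ 2 <= l ^+ 2.
    rewrite -(real_normK (num_real s)) -(real_normK (num_real l)).
    by rewrite ler_sqr ?nnegrE.
  rewrite (_ : y ^+ 2 = t ^+ 2 * (s ^+ 2) ^+ 3); last by rewrite /y; ring.
  rewrite (_ : (t * l ^+ 3) ^+ 2 = t ^+ 2 * (l ^+ 2) ^+ 3); last by ring.
  by rewrite ler_wpM2l ?sqr_ge0// lerXn2r ?nnegrE ?sqr_ge0.
have yJ : y ^+ 2 / (j.+1 ^ 6)%:R <= t ^+ 2.
  rewrite JE ler_pdivrMr//.
  rewrite (_ : y ^+ 2 = t ^+ 2 * (J ^+ 6 * (sin (l / J) ^+ 2) ^+ 3)); last first.
    by rewrite /y /s; ring.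
  by rewrite ler_wpM2l ?sqr_ge0// ler_piMr ?(ltW J6p)// exprn_ile1 ?sqr_ge0.
rewrite /wave_approx expiD -mulrBr Normc.normcM normc_expi mul1r.
rewrite -/J -/s -/y.
set w := _ ^+ _.
have -> : w - expi (l ^+ 3 * t) = (expi y - expi (l ^+ 3 * t)) - (expi y - w) by ring.
apply: (le_trans (le_normcD _ _)); rewrite normcN addrC mulrDl lerD//.
  apply: (le_trans (normc_expi_powB y J60)).
  rewrite JE; apply: ler_pM.
  - by rewrite mulr_ge0 ?expR_ge0// mulr_ge0 ?sqr_ge0.
  - by rewrite invr_ge0 ltW.
  - apply: ler_pM; rewrite ?expR_ge0 ?ler_expR -?JE//.
      by rewrite mulr_ge0 ?sqr_ge0.
    by rewrite ler_wpM2l.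
  - by rewrite lef_pV2 ?posrE.
apply: (le_trans (normc_expiB_le _ _)).
have -> : y - l ^+ 3 * t = t * ((s - l) * (s ^+ 2 + s * l + l ^+ 2)) by rewrite /y; ring.
rewrite !normrM.
have q : `|s ^+ 2 + s * l + l ^+ 2| <= 3 * l ^+ 2.
  have hl : `|l| ^+ 2 = l ^+ 2 by rewrite real_normK ?num_real.
  have s2 : `|s ^+ 2| <= l ^+ 2 by rewrite normrX -hl ler_sqr ?nnegrE.
  have s3 : `|s * l| <= l ^+ 2 by rewrite normrM -hl expr2 ler_wpM2r.
  have s4 : `|l ^+ 2| <= l ^+ 2 by rewrite ger0_norm ?sqr_ge0.
  apply: (le_trans (ler_normD _ _)); have := ler_normD (s ^+ 2) (s * l); lra.
rewrite (_ : 3 * `|t| * l ^+ 4 / J = `|t| * (l ^+ 2 / J * (3 * l ^+ 2))); last by ring.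
by rewrite ler_wpM2l// ler_pM.
Qed.

End trigonometric_polynomials.

(** * Exponential bounds and the sub-Gaussian norm *)

Section limits_of_bounds.
Context d (T : measurableType d) (R : realType) (P : probability T R).
Context (phi : R -> R) (phiO : orlicz_N_function phi).
Local Notation exp_bounded := (exp_bounded P phi).

Lemma mmt_gen_funE (X : T -> R) (l : R) :
  mmt_gen_fun P X l = (\int[P]_w (expR (l * X w))%:E)%E.
Proof.
by rewrite /mmt_gen_fun unlock; apply: eq_integral => w _ /=; rewrite mulrC.
Qed.

Lemma exp_bounded_le s s' Y : exp_bounded s Y -> 0 <= s -> s <= s' -> exp_bounded s' Y.
Proof.
move=> [mY hY] s0 ss'; split=> // l; apply: (le_trans (hY l)).
rewrite lee_fin ler_expR; apply: orlicz_le => //; rewrite !normrM ler_wpM2r//.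
by rewrite !ger0_norm// (le_trans s0).
Qed.

(** The admissible constants decrease to tau Y, and phi is continuous. *)
Lemma tau_exp_bounded (Y : T -> R) (a : R) : measurable_fun [set: T] Y ->
  0 <= a -> (tau P phi Y <= a%:E)%E -> exp_bounded a Y.
Proof.
move=> mY a0 ta; split=> // l.
have Yfin : (\int[P]_w (expR (l * Y w))%:E)%E \is a fin_num ->
   (\int[P]_w (expR (l * Y w))%:E <= (expR (phi (a * l)))%:E)%E.
  move=> fn; rewrite -(fineK fn) lee_fin -[X in phi (X * l)](addr0 a).
  apply: (le_at_right0 (f := fun e => expR (phi ((a + e) * l)))) => [x|e e0].
    apply: continuous_comp; last exact: continuous_expR.
    apply: continuous_comp; last exact: (orlicz_continuous phiO).
    apply: continuousM; last exact: cst_continuous.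
    by apply: continuousD; [exact: cst_continuous|exact: cvg_id].
  have : (tau P phi Y < (a + e)%:E)%E.
    by apply: (le_lt_trans ta); rewrite lte_fin ltrDl.
  move=> /ereal_inf_lt[_ [a' [a'0 ha'] <-]]; rewrite lte_fin => a'e.
  rewrite -lee_fin fineK// -mmt_gen_funE (le_trans (ha' l))// lee_fin ler_expR.
  apply: orlicz_le => //; rewrite !normrM ler_wpM2r//.
  by rewrite !gtr0_norm// ?ltW// (lt_trans a'0).
apply: Yfin; rewrite ge0_fin_numE; last first.
  by apply: integral_ge0 => w _; rewrite lee_fin expR_ge0.
have : (tau P phi Y < (a + 1)%:E)%E.
  by apply: (le_lt_trans ta); rewrite lte_fin ltrDl.
move=> /ereal_inf_lt[_ [a' [a'0 ha'] <-]] _.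
by rewrite -mmt_gen_funE (le_lt_trans (ha' l))// ltry.
Qed.

Lemma exp_bounded_tau (Y : T -> R) (a : R) : 0 <= a -> exp_bounded a Y ->
  (tau P phi Y <= a%:E)%E.
Proof.
move=> a0 bY; apply/lee_addgt0Pr => e e0; rewrite -EFinD.
have ae : 0 < a + e by rewrite ltr_wpDl.
apply: ereal_inf_lbound; exists (a + e) => //; split=> // l.
have [_ h] := exp_bounded_le bY a0 (ler_wpDr (ltW e0) (lexx a)).
by rewrite mmt_gen_funE.
Qed.

(** The Laplace transform is lower semicontinuous for L2 convergence. On the set
    where |S| <= n the tangent inequality
    exp(l S) (1 + l (g - S)) <= exp(l g) bounds exp(l S) by exp(l g) plus a
    multiple of |g - S|, whose expectation is small; then n tends to infinity by
    monotone convergence. *)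
Lemma exp_bounded_L2_limit (a : R) (S : T -> R) : 0 <= a ->
  measurable_fun [set: T] S ->
  (forall e : R, 0 < e -> exists g : T -> R,
     exp_bounded (a + e) g /\ (\int[P]_w ((g w - S w) ^+ 2)%:E <= e%:E)%E) ->
  exp_bounded a S.
Proof.
move=> a0 mS happ; split=> // l.
pose tr (n : nat) (w : T) := if `|S w| <= n%:R then expR (l * S w) else 0.
have mB n : measurable [set w | `|S w| <= n%:R].
  have mN : measurable_fun [set: T] (fun w => `|S w|) by exact: measurableT_comp.
  rewrite (_ : [set w | _] = [set: T] `&` (fun w => `|S w|) @^-1` `]-oo, n%:R]).
    exact: mN.
  by rewrite setTI; apply/seteqP; split=> w; rewrite /= in_itv/=.
have mE : measurable_fun [set: T] (fun w => expR (l * S w)).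
  by apply: measurableT_comp => //; exact: measurable_funM.
have mtr n : measurable_fun [set: T] (tr n).
  have -> : tr n = (fun w => expR (l * S w) * \1_[set w | `|S w| <= n%:R] w).
    apply/funext => w; rewrite /tr indicE.
    case: ifPn => h; first by rewrite mem_set ?mulr1.
    by rewrite memNset ?mulr0//; exact/negP.
  by apply: measurable_funM => //; exact: measurable_indic.
have tr0 n w : 0 <= tr n w by rewrite /tr; case: ifP => // _; exact: expR_ge0.
have trunc n : (\int[P]_w (tr n w)%:E <= (expR (phi (a * l)))%:E)%E.
  (* the constant in front of |g - S| on the set where |S| <= n *)
  pose c := `|l| * expR (`|l| * n%:R).
  have c0 : 0 <= c by rewrite mulr_ge0 ?expR_ge0.
  (* the squared distance of g and S is at most e^2, so that
     |g - S| <= e + (g - S)^2 / e has expectation at most 2 e *)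
  have bnd (e : R) : 0 < e ->
      (\int[P]_w (tr n w)%:E <= (expR (phi ((a + e ^+ 2) * l)) + c * (e * 2))%:E)%E.
    move=> e0; have [g [[mg bg] gS]] := happ (e ^+ 2) (exprn_gt0 2 e0).
    pose q w := (g w - S w) ^+ 2.
    have mq : measurable_fun [set: T] q by apply: measurable_funX; exact: measurable_funB.
    have q0 w : 0 <= q w by exact: sqr_ge0.
    have mEg : measurable_fun [set: T] (fun w => expR (l * g w)).
      by apply: measurableT_comp => //; exact: measurable_funM.
    apply: (@le_trans _ _ (\int[P]_w ((expR (l * g w))%:E +
        (c * e + c / e * q w)%:E))%E).
      apply: ge0_le_integral => //.
      - by move=> w _; rewrite lee_fin.
      - exact/measurable_EFinP.
      - apply: emeasurable_funD; apply/measurable_EFinP => //.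
        by apply: measurable_funD => //; exact: measurable_funM.
      - move=> w _; rewrite -EFinD lee_fin /tr; case: ifPn => hS; last first.
          by rewrite addr_ge0 ?expR_ge0// addr_ge0// mulr_ge0// ?divr_ge0// ltW.
        have h1 : expR (l * S w) * (1 + (l * g w - l * S w)) <= expR (l * g w).
          have -> : expR (l * g w) = expR (l * S w) * expR (l * g w - l * S w).
            by rewrite -expRD; congr expR; ring.
          by rewrite ler_wpM2l ?expR_ge0// expR_ge1Dx.
        have h2 : expR (l * S w) <= expR (`|l| * n%:R).
          by rewrite ler_expR (le_trans (ler_norm _))// normrM ler_wpM2l.
        have h3 : `|g w - S w| <= e + e^-1 * q w.
          rewrite -subr_ge0; have := sqr_ge0 (`|g w - S w| - e) => h.
          have -> : e + e^-1 * q w - `|g w - S w| =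
              e^-1 * ((`|g w - S w| - e) ^+ 2 + e * `|g w - S w|).
            rewrite /q -(real_normK (num_real (g w - S w))); field.
            by rewrite gt_eqF.
          by rewrite mulr_ge0 ?invr_ge0 ?(ltW e0)// addr_ge0// mulr_ge0// ltW.
        have h4 : expR (l * S w) * (l * S w - l * g w) <= c * (e + e^-1 * q w).
          apply: (@le_trans _ _ (expR (`|l| * n%:R) * (`|l| * `|g w - S w|))).
            apply: (@le_trans _ _ (expR (l * S w) * (`|l| * `|g w - S w|))).
              rewrite ler_wpM2l ?expR_ge0// -mulrBr (le_trans (ler_norm _))//.
              by rewrite normrM distrC.
            by rewrite ler_wpM2r// mulr_ge0.
          rewrite mulrA (mulrC (expR _)) -/c ler_wpM2l//.
        have -> : c * e + c / e * q w = c * (e + e^-1 * q w) by ring.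
        have h5 : expR (l * S w) * (1 + (l * g w - l * S w)) =
          expR (l * S w) - expR (l * S w) * (l * S w - l * g w) by ring.
        by rewrite h5 in h1; lra.
    rewrite ge0_integralD//; try by
      [ exact/measurable_EFinP
      | move=> w _; rewrite lee_fin addr_ge0// mulr_ge0// ?divr_ge0// ltW
      | apply/measurable_EFinP; apply: measurable_funD => //; exact: measurable_funM].
    rewrite EFinD leeD//.
    under eq_integral do rewrite EFinD.
    rewrite ge0_integralD//; try by
      [ move=> w _; rewrite lee_fin mulr_ge0// ?divr_ge0// ltW
      | apply/measurable_EFinP; exact: measurable_funM].
    rewrite integral_cst//= probability_setT mule1.
    under eq_integral do rewrite EFinM.
    rewrite ge0_integralZl//; try by
      [ exact/measurable_EFinP | move=> w _; rewrite lee_fin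
      | rewrite lee_fin divr_ge0// ltW].
    have ce : 0 <= c / e by rewrite divr_ge0// ltW.
    apply: (@le_trans _ _ ((c * e)%:E + (c / e)%:E * (e ^+ 2)%:E)%E).
      by rewrite leeD2l// lee_wpmul2l// lee_fin.
    rewrite -EFinM -EFinD lee_fin le_eqVlt; apply/orP; left; apply/eqP.
    by field; rewrite gt_eqF.
  have fn : (\int[P]_w (tr n w)%:E)%E \is a fin_num.
    rewrite ge0_fin_numE; first by rewrite (le_lt_trans (bnd 1 ltr01))// ltry.
    by apply: integral_ge0 => w _; rewrite lee_fin.
  rewrite -(fineK fn) lee_fin.
  have := @le_at_right0 R (fun e => expR (phi ((a + e ^+ 2) * l)) + c * (e * 2)).
  rewrite expr0n/= addr0 mul0r mulr0 addr0; apply; last first.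
    by move=> e e0; rewrite -lee_fin fineK// bnd.
  move=> x; apply: (@cvgD _ _ _ _ _ (fun e : R => expR (phi ((a + e ^+ 2) * l)))
    (fun e : R => c * (e * 2))); last first.
    by apply: cvgM; [exact: cvg_cst|apply: cvgM; [exact: cvg_id|exact: cvg_cst]].
  apply: (@continuous_comp _ _ _ (fun e : R => phi ((a + e ^+ 2) * l)) expR);
    last exact: continuous_expR.
  apply: (@continuous_comp _ _ _ (fun e : R => (a + e ^+ 2) * l) phi);
    last exact: (orlicz_continuous phiO).
  apply: cvgM; last exact: cvg_cst.
  apply: cvgD; first exact: cvg_cst.
  exact: exprn_continuous.
have cvtr w : limn (fun n => (tr n w)%:E) = (expR (l * S w))%:E.
  apply/cvg_lim => //; apply: cvg_near_cst.
  near=> n; rewrite /tr ifT//.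
  by near: n; exact: nbhs_infty_ger.
have := @cvg_monotone_convergence _ _ _ P _ measurableT (fun n w => (tr n w)%:E).
have -> : (\int[P]_w limn (fun n => (tr n w)%:E))%E = (\int[P]_w (expR (l * S w))%:E)%E.
  by apply: eq_integral => w _; exact: cvtr.
move=> cv; have {}cv : (\int[P]_w (tr n w)%:E)%E @[n --> \oo] -->
    (\int[P]_w (expR (l * S w))%:E)%E.
  apply: cv.
  - by move=> n; exact/measurable_EFinP.
  - by move=> n w _; rewrite lee_fin.
  - move=> w _ m n mn; rewrite lee_fin /tr; case: ifPn => hm.
      by rewrite ifT// (le_trans hm)// ler_nat.
    by case: ifP => // _; exact: expR_ge0.
rewrite -(cvg_lim _ cv)//; apply: lime_le; first by apply/cvg_ex; eexists; exact: cv.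
exact: nearW.
Unshelve. all: by end_near. Qed.

End limits_of_bounds.

(** * Exponential bounds for the wave and its increments *)

Lemma expectationE d (T : measurableType d) (R : realType) (P : probability T R)
  (X : T -> R) : ('E_P[X] = \int[P]_w (X w)%:E)%E.
Proof. by rewrite unlock. Qed.

Section stationary_spectral.
Context d (T : measurableType d) (R : realType) (P : probability T R).
Context (phi : R -> R) (phiO : orlicz_N_function phi).
Context (eta : R -> T -> R).
Context (F : {finite_measure set (measurableTypeR R) -> \bar R}).
Context (Z : set R -> T -> R[i]) (Zo : orthogonal_random_measure P F Z).
Context (c_eta : R).
Hypothesis eta_representation : forall x : R,
  is_stochastic_integral P F Z (fun l => expi (l * x)) (fun w => (eta x w)%:C).
Hypothesis eta_strict : strictly_phi_subgaussian P phi (range eta) c_eta.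
Hypothesis eta_second_order : second_order P eta.
Local Notation exp_bounded := (exp_bounded P phi).

Definition lincomb (s : seq (R * R)) (w : T) : R :=
  \sum_(p <- s) p.1 * eta p.2 w.

Lemma lincomb_Lfun s : lincomb s \in Lfun P 2%:E.
Proof.
elim: s => [|p s IHs].
  rewrite (_ : lincomb _ = cst 0); first exact: Lfun_cst.
  by apply/funext => w; rewrite /lincomb big_nil.
rewrite (_ : lincomb _ = (fun w => p.1 * eta p.2 w + lincomb s w)).
  by apply: Lfun2D => //; exact/Lfun2Z/eta_second_order.
by apply/funext => w; rewrite /lincomb big_cons.
Qed.

(** A finite combination is a series whose coefficients vanish from some index
    on. *)
Lemma lincomb_tau s : (tau P phi (lincomb s) <=
  (c_eta * Num.sqrt (fine (\int[P]_w (lincomb s w ^+ 2)%:E)%E))%:E)%E.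
Proof.
have := eta_strict.2 (fun i => eta (nth (0, 0) s i).2) (fun i => (nth (0, 0) s i).1)
  (lincomb s).
rewrite expectationE; apply.
- by move=> i; exists (nth (0, 0) s i).2.
- exact: lincomb_Lfun.
- apply: cvg_near_cst; near=> n.
  apply: integral0_eq => w _.
  suff -> : \sum_(i < n) (nth (0, 0) s i).1 * eta (nth (0, 0) s i).2 w = lincomb s w.
    by rewrite subrr expr0n.
  have sn : (size s <= n)%N by near: n; exact: nbhs_infty_ge.
  rewrite /lincomb (big_nth (0, 0)) big_mkord.
  rewrite -(subnK sn) addnC big_split_ord/= [X in _ + X]big1 ?addr0// => i _.
  by rewrite nth_default ?leq_addr// mul0r.
Unshelve. all: by end_near. Qed.

Lemma stochastic_integral_trigpoly (s : seq (R[i] * R)) :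
  is_stochastic_integral P F Z (trigpoly s)
    (fun w => \sum_(p <- s) p.1 * (eta p.2 w)%:C).
Proof.
elim: s => [|p s IHs].
  have := stochastic_integralZ Zo 0 (eta_representation 0).
  suff -> : trigpoly [::] = (fun l : R => 0 * expi (l * 0)).
    suff -> : (fun w : T => \sum_(p <- [::]) p.1 * (eta p.2 w)%:C) =
       (fun w => 0 * (eta 0 w)%:C) by [].
    by apply/funext => w; rewrite big_nil mul0r.
  by apply/funext => l; rewrite /trigpoly big_nil mul0r.
have := stochastic_integralD Zo (stochastic_integralZ Zo p.1 (eta_representation p.2)) IHs.
suff -> : trigpoly (p :: s) = (fun l : R => p.1 * expi (l * p.2) + trigpoly s l).
  suff -> : (fun w : T => \sum_(p <- (p :: s)) p.1 * (eta p.2 w)%:C) =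
     (fun w => p.1 * (eta p.2 w)%:C + \sum_(p <- s) p.1 * (eta p.2 w)%:C) by [].
  by apply/funext => w; rewrite big_cons.
by apply/funext => l; rewrite /trigpoly big_cons.
Qed.

Definition trig_limit (f : R -> R[i]) : Prop :=
  exists s_ : nat -> seq (R[i] * R),
    @L2c_cvg _ _ (measurableTypeR R) F (fun n => trigpoly (s_ n)) f.

Lemma L2c_trigpoly s : @L2c _ _ (measurableTypeR R) F (trigpoly s).
Proof. by have [] := stochastic_integral_trigpoly s. Qed.

Lemma trig_limitB f g : @L2c _ _ (measurableTypeR R) F f ->
  @L2c _ _ (measurableTypeR R) F g -> trig_limit f -> trig_limit g ->
  trig_limit (fun l => f l - g l).
Proof.
move=> Lf Lg [s fs] [s' gs].
exists (fun n => s n ++ [seq (- p.1, p.2) | p <- s' n]).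
have Lg' : @L2c _ _ (measurableTypeR R) F (fun l => -1 * g l) by exact: L2cZ.
have gs' := L2c_cvgZ (-1) (fun n => L2c_trigpoly (s' n)) Lg gs.
have := L2c_cvgD (fun n => L2c_trigpoly (s n)) Lf
  (fun n => L2cZ (-1) (L2c_trigpoly (s' n))) Lg' fs gs'.
have -> : (fun l => f l - g l) = (fun l => f l + -1 * g l).
  by apply/funext => l; rewrite mulN1r.
apply: L2c_cvg_ext => n l; rewrite /trigpoly big_cat/= big_map; congr (_ + _).
by rewrite mulr_sumr; apply: eq_bigr => p _; rewrite mulrA mulN1r.
Qed.

(** Dominated convergence: the approximations are bounded uniformly in j and l,
    and F is finite. *)
Lemma trig_limit_wave x t :
  @L2c _ _ (measurableTypeR R) F (fun l => expi (l * x + l ^+ 3 * t)) ->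
  trig_limit (fun l => expi (l * x + l ^+ 3 * t)).
Proof.
move=> Lf; have /choice[s_ sE] := is_trigpoly_wave_approx x t.
exists s_; apply: (@L2c_cvg_ext _ (measurableTypeR R) _ F (wave_approx x t) _ _ sE).
have La j : @L2c _ _ (measurableTypeR R) F (wave_approx x t j).
  by rewrite (_ : wave_approx x t j = trigpoly (s_ j)); [exact: L2c_trigpoly|exact/funext].
pose q j l := sqnormc (wave_approx x t j l - expi (l * x + l ^+ 3 * t)).
pose M := 2 * expR (t ^+ 2) + 2.
have qM j l : q j l <= M.
  have := @sqnormcD_le _ 1 (wave_approx x t j l) (- expi (l * x + l ^+ 3 * t)) ltr01.
  rewrite sqnormcN sqnormc_expi invr1 mulr1 -/(q j l) => /le_trans; apply.
  by have := wave_approx_le x t j l; rewrite /M; lra.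
have q0 j l : 0 <= q j l by exact: sqnormc_ge0.
have mq j : @measurable_fun _ _ (measurableTypeR R) _ setT (q j).
  exact: sqnormc_measurable (L2cB (La j) Lf).
have ptw l : (q j l)%:E @[j --> \oo] --> (0 : \bar R)%E.
  apply/cvge0P => [j|e e0]; first by rewrite lee_fin.
  pose C := 2 * (t * l ^+ 3) ^+ 2 * expR (t ^+ 2) + 3 * `|t| * l ^+ 4.
  have C0 : 0 <= C.
    rewrite addr_ge0//; last by rewrite mulr_ge0 ?exprn_even_ge0// mulr_ge0.
    by rewrite mulr_ge0 ?expR_ge0// mulr_ge0 ?sqr_ge0.
  near=> j; rewrite lte_fin.
  have J1 : 1 <= j.+1%:R :> R by rewrite ler1n.
  have J0 : 0 < j.+1%:R :> R by rewrite ltr0n.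
  apply: (@le_lt_trans _ _ (C ^+ 2 / j.+1%:R)).
    rewrite /q sqnormcE.
    apply: (@le_trans _ _ ((C / j.+1%:R) ^+ 2)).
      by rewrite lerXn2r ?nnegrE ?normc_ge0 ?divr_ge0// wave_approx_dist.
    rewrite expr_div_n ler_wpM2l ?sqr_ge0// lef_pV2 ?posrE ?exprn_gt0//.
    by rewrite ler_eXnr.
  rewrite ltr_pdivrMr// -ltr_pdivrMl// mulrC.
  apply: (@lt_le_trans _ _ j%:R); last by rewrite ler_nat.
  by near: j; exact: nbhs_infty_gtr.
have h1 j : @measurable_fun _ _ (measurableTypeR R) _ setT (fun l => (q j l)%:E).
  exact/measurable_EFinP.
have h4 : (F : {measure set (measurableTypeR R) -> \bar R}).-integrable setT (cst M%:E).
  exact: finite_measure_integrable_cst.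
have h3 : {ae F, forall l : measurableTypeR R, [set: measurableTypeR R] l ->
    (q j l)%:E @[j --> \oo] --> (cst 0%E l : \bar R)}.
  by apply: aeW => l _; exact: ptw.
have h5 : {ae F, forall (l : measurableTypeR R) (j : nat),
    [set: measurableTypeR R] l -> (`|(q j l)%:E| <= cst M%:E l)%E}.
  by apply: aeW => l j _; rewrite gee0_abs ?lee_fin.
have [_ _] := @dominated_convergence _ (measurableTypeR R) _ F setT measurableT
  (fun j l => (q j l)%:E) (cst 0%E) (cst M%:E) h1 (@measurable_cst _ _ _ _ _ _)
  h3 h4 h5.
by rewrite integral0; apply.
Unshelve. all: by end_near. Qed.

(** The transfer principle. The integrals of the trigonometric polynomials
    approximating f have real parts that are linear combinations of values of
    eta, with second moments at most the squared norms of the polynomials; strict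
    sub-Gaussianity bounds them, and [exp_bounded_L2_limit] passes to U. The norm
    condition is asked for c_eta >= 0 only, because for negative c_eta the
    sub-Gaussian norm of every combination is at most 0. *)
Lemma spectral_exp_bounded (U : T -> R) f (b : R) : 0 <= b ->
  is_stochastic_integral P F Z f (fun w => (U w)%:C) -> trig_limit f ->
  (0 <= c_eta -> c_eta * Num.sqrt (fine (@nsq _ (measurableTypeR R) _ F f)) <= b) ->
  exp_bounded b U.
Proof.
move=> b0 fU [s_ sf] cb; have [Lf LU _] := fU.
have mU : measurable_fun [set: T] U by exact: Lfun2_measurable LU.1.
apply: (exp_bounded_L2_limit phiO) => // e e0.
pose N := fine (@nsq _ (measurableTypeR R) _ F f).
have N0 : 0 <= N by rewrite fine_ge0// nsq_ge0.
(* del is the tolerance on the standard deviation that keeps the error of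
   c_eta times it below e, and t the corresponding tolerance on the variance *)
pose del := e / (`|c_eta| + 1).
have c1 : 0 < `|c_eta| + 1 by rewrite ltr_wpDl.
have del0 : 0 < del by rewrite divr_gt0.
pose t := Num.min 1 (del ^+ 2 / (N + 1)).
have N1 : 0 < N + 1 by rewrite ltr_wpDl.
have t0 : 0 < t by rewrite lt_min ltr01 divr_gt0// exprn_gt0.
have tN : t * (N + 1) <= del ^+ 2 by rewrite -ler_pdivlMr// ge_min lexx orbT.
have [n [hn1 hn2]] : exists n,
   (@nsq _ (measurableTypeR R) _ F (fun l => trigpoly (s_ n) l - f l)%R < e%:E)%E /\
   fine (@nsq _ (measurableTypeR R) _ F (trigpoly (s_ n))) <= (1 + t) * N + t.
  have /L2c_cvgP/(_ e e0) A1 := sf.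
  have A2 := nsq_near_le (fun n => L2c_trigpoly (s_ n)) Lf sf t0.
  near \oo => n; exists n; split; near: n => //.
  by apply: filterS A2 => n [].
(* as eta is real, the real part of the integral only sees the real parts of
   the coefficients *)
pose s : seq (R * R) := [seq (complex.Re p.1, p.2) | p <- s_ n].
pose X w := \sum_(p <- s_ n) p.1 * (eta p.2 w)%:C.
have SX : is_stochastic_integral P F Z (trigpoly (s_ n)) X.
  exact: stochastic_integral_trigpoly.
have ReX w : complex.Re (X w) = lincomb s w.
  rewrite /X /lincomb /s big_map; elim: (s_ n) => [|p r IHr].
    by rewrite !big_nil.
  by rewrite !big_cons ReD IHr; congr (_ + _); rewrite !complexDE/= mulr0 subr0.
have LX : L2c P X by have [] := SX.
have Lg := lincomb_Lfun s; have mg := Lfun2_measurable Lg.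
have sub : (\int[P]_w ((lincomb s w - U w) ^+ 2)%:E <= e%:E)%E.
  apply: le_trans (ltW hn1); apply: le_trans (stochastic_integral_le Zo (stochastic_integralB Zo SX fU)).
  apply: ge0_le_integral => //.
  - by move=> w _; rewrite lee_fin sqr_ge0.
  - by apply/measurable_EFinP; apply: measurable_funX; exact: measurable_funB.
  - by apply/measurable_EFinP; exact: sqnormc_measurable (L2cB LX LU).
  - move=> w _; rewrite lee_fin /sqnormc !complexDE ReX/= lerDl; exact: sqr_ge0.
exists (lincomb s); split=> //.
apply: (tau_exp_bounded phiO) => //; first by rewrite addr_ge0// ltW.
apply: (le_trans (lincomb_tau s)); rewrite lee_fin.
set V := fine _.
have [c0|c0] := leP 0 c_eta; last first.
  by rewrite (@le_trans _ _ 0) ?addr_ge0// ?(ltW e0)// mulr_le0_ge0// ?sqrtr_ge0// ltW.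
have VN : V <= (1 + t) * N + t.
  apply: le_trans hn2; rewrite /V; apply: fine_le.
  - have := integrable_fin_num measurableT (Lfun2_integrable_sqr Lg); exact.
  - exact/nsq_fin/L2c_trigpoly.
  - apply: le_trans (stochastic_integral_le Zo SX).
    apply: ge0_le_integral => //.
    + by move=> w _; rewrite lee_fin sqr_ge0.
    + by apply/measurable_EFinP; exact: measurable_funX.
    + by apply/measurable_EFinP; exact: sqnormc_measurable LX.
    + by move=> w _; rewrite lee_fin /sqnormc ReX lerDl sqr_ge0.
have VN' : V <= (Num.sqrt N + del) ^+ 2.
  apply: (le_trans VN); rewrite sqrrD sqr_sqrtr//.
  have : 0 <= Num.sqrt N * del *+ 2 by rewrite mulrn_wge0// mulr_ge0 ?sqrtr_ge0// ltW.
  have : (1 + t) * N + t = N + t * (N + 1) by ring.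
  by move=> -> h; lra.
have sV : Num.sqrt V <= Num.sqrt N + del.
  have sd : 0 <= Num.sqrt N + del by rewrite addr_ge0 ?sqrtr_ge0// ltW.
  by rewrite -(ger0_norm sd) -sqrtr_sqr ler_sqrt ?sqr_ge0.
apply: (le_trans (ler_wpM2l c0 sV)); rewrite mulrDr lerD ?cb//.
rewrite /del mulrCA ler_piMr ?(ltW e0)// ler_pdivrMr// mul1r ger0_norm//.
by rewrite lerDl.
Unshelve. all: by end_near. Qed.

Definition wave_const (beta : R) : R :=
  2 `^ (1 - beta) *
  Num.sqrt (fine (\int[F]_l (`|l + l ^+ 3| `^ (2 * beta))%:E)%E).

Lemma measurable_norm_powR (f : R -> R) (p : R) :
  @measurable_fun _ _ (measurableTypeR R) _ setT f ->
  @measurable_fun _ _ (measurableTypeR R) _ setT (fun l => `|f l| `^ p).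
Proof.
move=> mf; apply: (measurableT_comp (measurable_powR p)).
exact: measurableT_comp.
Qed.

Lemma measurable_cubic :
  @measurable_fun _ _ (measurableTypeR R) _ setT (fun l : R => l + l ^+ 3).
Proof. by apply: measurable_funD => //; exact: measurable_funX. Qed.

(** |l + l^3| is at most 2 for |l| <= 1 and at most 2 |l|^3 otherwise. *)
Lemma wave_moment_fin (beta : R) : 0 < beta <= 1 ->
  (\int[F]_l (`|l| `^ (6 * beta))%:E < +oo)%E ->
  (\int[F]_l (`|l + l ^+ 3| `^ (2 * beta))%:E)%E \is a fin_num.
Proof.
move=> /andP[b0 b1] hF.
rewrite ge0_fin_numE; last by apply: integral_ge0 => l _; rewrite lee_fin powR_ge0.
have m1 := measurable_norm_powR (2 * beta) measurable_cubic.
have m2 : @measurable_fun _ _ (measurableTypeR R) _ setT (fun l : R => `|l| `^ (6 * beta)).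
  exact: (measurable_norm_powR (f := id)).
apply: (@le_lt_trans _ _ (\int[F]_l ((cst 4%:E l) + 4%:E * (`|l| `^ (6 * beta))%:E))%E).
  apply: ge0_le_integral => //.
  - exact/measurable_EFinP.
  - apply: emeasurable_funD => //; apply: measurable_funeM; exact/measurable_EFinP.
  - move=> l _; rewrite -EFinM -EFinD lee_fin.
    have h4 (x : R) : 0 <= x -> (2 * x) `^ (2 * beta) <= 4 * x `^ (2 * beta).
      move=> x0; rewrite powRM// ler_wpM2r ?powR_ge0//.
      apply: (@le_trans _ _ (2 `^ 2%:R)).
        by apply: ler_powR; [rewrite ler1n|rewrite ler_piMr].
      by rewrite powR_mulrn// -natrX.
    have p2 : (0 : R) <= 2 * beta by rewrite mulr_ge0// ltW.
    have := powR_ge0 `|l| (6 * beta) => q0.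
    have tri : `|l + l ^+ 3| <= `|l| + `|l| ^+ 3 by rewrite -normrX ler_normD.
    have [l1|l1] := leP `|l| 1.
      have l3 : `|l| ^+ 3 <= 1 by rewrite exprn_ile1.
      have : `|l + l ^+ 3| `^ (2 * beta) <= (2 * 1) `^ (2 * beta) by apply: powR_le_mono => //; lra.
      move/le_trans/(_ (h4 _ ler01)); rewrite powR1 => h; lra.
    have l3 : `|l| <= `|l| ^+ 3 by rewrite ler_eXnr// ltW.
    have : `|l + l ^+ 3| `^ (2 * beta) <= (2 * `|l| ^+ 3) `^ (2 * beta).
      by apply: powR_le_mono => //; lra.
    move/le_trans/(_ (h4 _ (exprn_ge0 3 (normr_ge0 l)))).
    rewrite -(powR_mulrn 3 (normr_ge0 l)) -powRrM (_ : 3%:R * (2 * beta) = 6 * beta); last by ring.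
    by move=> h; lra.
rewrite ge0_integralD//; try by
  [ move=> l _; rewrite mule_ge0// lee_fin powR_ge0 | move=> l _; rewrite /= lee_fin
  | apply: measurable_funeM; exact/measurable_EFinP].
rewrite integral_cst//= ge0_integralZl//; last exact/measurable_EFinP.
have Ffin : F setT \is a fin_num by exact: fin_num_measure.
apply: lte_add_pinfty.
  by rewrite ltey_eq fin_numM.
by apply: lte_mul_pinfty.
Qed.

(** |exp(i a) - exp(i b)|^2 = 4 sin^2((a - b)/2) and |a - b| <= h |l + l^3|, as l
    and l^3 have the same sign. The factor 4 / 2^(2 beta) is the square of
    2^(1 - beta). *)
Lemma wave_increment (beta t x s y h : R) : 0 < beta <= 1 ->
  (\int[F]_l (`|l| `^ (6 * beta))%:E < +oo)%E ->
  0 <= h -> `|t - s| <= h -> `|x - y| <= h ->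
  @L2c _ _ (measurableTypeR R) F (fun l => expi (l * x + l ^+ 3 * t)) ->
  @L2c _ _ (measurableTypeR R) F (fun l => expi (l * y + l ^+ 3 * s)) ->
  fine (@nsq _ (measurableTypeR R) _ F
     (fun l => expi (l * x + l ^+ 3 * t) - expi (l * y + l ^+ 3 * s))) <=
  (wave_const beta * h `^ beta) ^+ 2.
Proof.
move=> b01 hF h0 ts xy Lx Ly; have /andP[b0 b1] := b01.
have If := wave_moment_fin b01 hF.
set I := (\int[F]_l (`|l + l ^+ 3| `^ (2 * beta))%:E)%E in If.
have I0 : 0 <= fine I by rewrite fine_ge0// integral_ge0// => l _; rewrite lee_fin powR_ge0.
have m1 := measurable_norm_powR (2 * beta) measurable_cubic.
have p2 : (0 : R) <= 2 * beta by rewrite mulr_ge0// ltW.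
pose k := (2 `^ (1 - beta) * h `^ beta) ^+ 2.
have k0 : 0 <= k by exact: sqr_ge0.
have -> : (wave_const beta * h `^ beta) ^+ 2 = k * fine I.
  by rewrite /k /wave_const -/I mulrAC exprMn [_ * h `^ _]mulrC sqr_sqrtr// [h `^ _ * _]mulrC.
rewrite -lee_fin fineK; last exact: nsq_fin (L2cB Lx Ly).
rewrite EFinM fineK// /I -ge0_integralZl//; last exact/measurable_EFinP.
apply: ge0_le_integral => //.
- by move=> l _; rewrite lee_fin sqnormc_ge0.
- by apply/measurable_EFinP; exact: sqnormc_measurable (L2cB Lx Ly).
- by apply: measurable_funeM; exact/measurable_EFinP.
move=> l _; rewrite -EFinM lee_fin sqnormc_expiB.
set z := _ - _.
have zle : `|z / 2| <= 2^-1 * h * `|l + l ^+ 3|.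
  rewrite normrM mulrC [`|2^-1|]ger0_norm// -mulrA ler_wpM2l//.
  have -> : z = l * (x - y) + l ^+ 3 * (t - s) by rewrite /z; ring.
  apply: (le_trans (ler_normD _ _)); rewrite (normrM l) (normrM (l ^+ 3)).
  have -> : `|l + l ^+ 3| = `|l| + `|l ^+ 3|.
    have -> : l + l ^+ 3 = l * (1 + l ^+ 2) by ring.
    rewrite normrM [`|1 + _|]ger0_norm ?addr_ge0 ?sqr_ge0//.
    rewrite mulrDr mulr1; congr (_ + _).
    have -> : l ^+ 3 = l * l ^+ 2 by ring.
    by rewrite normrM [`|l ^+ 2|]ger0_norm ?sqr_ge0.
  by rewrite mulrDr; apply: lerD; rewrite [leRHS]mulrC ler_wpM2l.
have := sin_sqr_le (z / 2) b01 => /(ler_wpM2l (ler0n _ 4))/le_trans; apply.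
have hl0 : 0 <= 2^-1 * h * `|l + l ^+ 3| by rewrite !mulr_ge0.
apply: (@le_trans _ _ (4 * (2^-1 * h * `|l + l ^+ 3|) `^ (2 * beta))).
  by rewrite ler_wpM2l//; apply: ge0_ler_powR; rewrite ?nnegrE.
rewrite powRM//; last by rewrite mulr_ge0.
rewrite mulrA ler_wpM2r ?powR_ge0// powRM// /k exprMn mulrA.
rewrite -[h `^ (2 * beta)]sqr_powR ler_wpM2r ?sqr_ge0//.
rewrite -[(2 `^ (1 - beta)) ^+ 2]powR_mulrn ?powR_ge0// -powRrM.
have -> : (1 - beta) * 2%:R = 2 - 2 * beta by ring.
rewrite powRB; last by rewrite pnatr_eq0 implybT.
rewrite powR_mulrn// -natrX -powRN.
have -> : (2^-1 : R) `^ (2 * beta) = 2 `^ (- (2 * beta)).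
  by rewrite -powR_inv1// -powRrM mulN1r.
by [].
Qed.

(** A negative c_eta is compatible with tau >= 0 only if E eta(0)^2 = F(R)
    vanishes, and then so does the wave constant. *)
Lemma strict_const_ge0 (beta : R) : is_spectral_measure P eta F -> centered P eta ->
  0 <= c_eta * wave_const beta.
Proof.
move=> Fs Ec; have w0 : 0 <= wave_const beta by rewrite mulr_ge0 ?powR_ge0 ?sqrtr_ge0.
have [c0|c0] := leP 0 c_eta; first by rewrite mulr_ge0.
suff -> : wave_const beta = 0 by rewrite mulr0.
have tau0 (Y : T -> R) : (0 <= tau P phi Y)%E.
  by apply: le_ereal_inf_tmp => _ [a [a0 _] <-]; rewrite lee_fin ltW.
have := le_trans (tau0 _) (lincomb_tau [:: (1, 0)]).
rewrite lee_fin nmulr_rge0// => s0.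
have E0 : fine (\int[P]_w (lincomb [:: (1, 0%R)] w ^+ 2)%:E) = 0.
  have : Num.sqrt (fine (\int[P]_w (lincomb [:: (1, 0%R)] w ^+ 2)%:E)) == 0.
    by rewrite eq_le s0 sqrtr_ge0.
  rewrite sqrtr_eq0 => E0; apply/eqP; rewrite eq_le E0 fine_ge0//.
  by apply: integral_ge0 => w _; rewrite lee_fin sqr_ge0.
have L0 := eta_second_order 0.
have FT : F setT = 0%E.
  have := Fs.2 0 0; rewrite covarianceE.
  - rewrite (Ec 0) mule0 sube0 expectationE => e.
    have : (\int[F]_l (cos (l * (0 - 0)))%:E = F setT)%E.
      under eq_integral => l _ do rewrite subrr mulr0 cos0.
      by rewrite integral_cst// mul1e.
    rewrite -e => <-; rewrite -[LHS]fineK.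
      rewrite -[RHS]/(0%:E); congr EFin; rewrite -[RHS]E0; congr fine.
      apply: eq_integral => w _; congr EFin.
      by rewrite /lincomb big_seq1 mul1r expr2.
    apply: integrable_fin_num => //; exact: Lfun2M.
  - exact: (Lfun_subset12 (fin_num_measure P _ measurableT)).
  - exact: (Lfun_subset12 (fin_num_measure P _ measurableT)).
  - exact: Lfun2_mul_Lfun1.
rewrite /wave_const.
have -> : (\int[F]_l (`|l + l ^+ 3| `^ (2 * beta))%:E = 0)%E.
  rewrite (ge0_negligible_integral (N := setT)) ?setDv ?integral_set0//.
  - have m1 := measurable_norm_powR (2 * beta) measurable_cubic.
    exact/measurable_EFinP.
by rewrite sqrtr0 mulr0.
Qed.

Lemma wave_increment_exp_bounded (beta t x s y h : R) (U V : T -> R) :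
  0 < beta <= 1 -> (\int[F]_l (`|l| `^ (6 * beta))%:E < +oo)%E ->
  0 <= c_eta * wave_const beta ->
  0 <= h -> `|t - s| <= h -> `|x - y| <= h ->
  is_stochastic_integral P F Z (fun l => expi (l * x + l ^+ 3 * t))
    (fun w => (U w)%:C) ->
  is_stochastic_integral P F Z (fun l => expi (l * y + l ^+ 3 * s))
    (fun w => (V w)%:C) ->
  exp_bounded (c_eta * wave_const beta * h `^ beta) (fun w => U w - V w).
Proof.
move=> b01 hF cc h0 ts xy IU IV; have [LU _ _] := IU; have [LV _ _] := IV.
have := stochastic_integralB Zo IU IV.
have -> : (fun w => (U w)%:C - (V w)%:C) = (fun w => (U w - V w)%:C).
  by apply/funext => w; rewrite -rmorphB.
move=> IUV; apply: (spectral_exp_bounded _ IUV).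
- by rewrite mulr_ge0 ?powR_ge0.
- by apply: trig_limitB => //; exact: trig_limit_wave.
move=> c0; rewrite -mulrA ler_wpM2l//.
have w0 : 0 <= wave_const beta * h `^ beta.
  by rewrite !mulr_ge0 ?powR_ge0 ?sqrtr_ge0.
rewrite -[leRHS](ger0_norm w0) -sqrtr_sqr ler_sqrt ?sqr_ge0//.
exact: wave_increment.
Qed.

(** The wave has modulus 1, so every value of u has the same variance F(R). *)
Lemma wave_exp_bounded : exists2 M : R, 0 <= M & forall t x (U : T -> R),
  is_stochastic_integral P F Z (fun l => expi (l * x + l ^+ 3 * t))
    (fun w => (U w)%:C) -> exp_bounded M U.
Proof.
pose M := Num.max c_eta 0 * Num.sqrt (fine (F setT)).
have M0 : 0 <= M by rewrite mulr_ge0 ?sqrtr_ge0// le_max lexx orbT.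
exists M => // t x U IU; have [LU _ _] := IU.
apply: (spectral_exp_bounded M0 IU); first exact: trig_limit_wave.
move=> c0; rewrite /M max_l// ler_wpM2l//.
rewrite (_ : nsq _ _ = F setT)// /nsq.
under eq_integral => l _ do rewrite sqnormc_expi.
by rewrite integral_cst// mul1e.
Qed.

End stationary_spectral.

(** * Nets in an interval *)

Section nets.
Context (R : realType).
Implicit Types (lo hi eps t : R) (j : nat).

(** The midpoints of consecutive intervals of length 2 eps starting at lo, cut off
    at hi so that the net stays inside the interval. *)
Definition net_point lo hi eps j : R := Num.min hi (lo + eps * (2 * j%:R + 1)).

Definition net_index lo eps t : nat := Num.truncn ((t - lo) / (2 * eps)).

Definition interval_net lo hi eps : seq R :=
  [seq net_point lo hi eps j | j <- iota 0 (net_index lo eps hi).+1].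

Definition net_proj lo hi eps t : R := net_point lo hi eps (net_index lo eps t).

Lemma size_interval_net lo hi eps : 0 < eps -> lo <= hi ->
  (size (interval_net lo hi eps))%:R <= (hi - lo) / (2 * eps) + 1.
Proof.
move=> e0 lohi; rewrite size_map size_iota -natr1 lerD2r truncn_le.
by rewrite divr_ge0 ?subr_ge0// mulr_ge0// ltW.
Qed.

Lemma interval_net_sub lo hi eps t : 0 < eps -> lo <= hi ->
  t \in interval_net lo hi eps -> lo <= t <= hi.
Proof.
move=> e0 lohi /mapP[j _ ->]; rewrite /net_point ge_min lexx andbT le_min lohi/=.
by rewrite lerDl mulr_ge0 ?ltW// ltr_wpDl// mulr_ge0.
Qed.

Lemma net_proj_mem lo hi eps t : 0 < eps -> lo <= t <= hi ->
  net_proj lo hi eps t \in interval_net lo hi eps.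
Proof.
move=> e0 /andP[lot thi]; apply/mapP; exists (net_index lo eps t) => //.
rewrite mem_iota/= add0n ltnS; apply: le_truncn.
by rewrite ler_wpM2r ?invr_ge0 ?mulr_ge0 ?(ltW e0)// lerD2r.
Qed.

Lemma net_proj_dist lo hi eps t : 0 < eps -> lo <= t <= hi ->
  `|t - net_proj lo hi eps t| <= eps.
Proof.
move=> e0 /andP[lot thi].
have e2 : 0 < 2 * eps by rewrite mulr_gt0.
have x0 : 0 <= (t - lo) / (2 * eps) by rewrite divr_ge0 ?subr_ge0// ltW.
have /andP[] := truncn_itv x0; rewrite -/(net_index lo eps t).
set j := net_index lo eps t.
rewrite ler_pdivlMr// ltr_pdivrMr// -natr1 => h1 h2.
have h : `|t - (lo + eps * (2 * j%:R + 1))| <= eps.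
  by rewrite ler_norml; apply/andP; split; lra.
rewrite /net_proj -/j /net_point; case: (leP hi) => // hh.
by move: h; rewrite !ler_norml => /andP[? ?]; apply/andP; split; lra.
Qed.

End nets.

Lemma size_allpairs_dep_le (R : realType) (S : eqType) (T : eqType) (V : Type)
    (f : S -> T -> V) (s : seq S) (t : S -> seq T) (M : R) :
  (forall x, x \in s -> (size (t x))%:R <= M) ->
  (size [seq f x y | x <- s, y <- t x])%:R <= (size s)%:R * M.
Proof.
elim: s => [|x s IHs] h; first by rewrite mul0r.
rewrite allpairs_cons size_cat size_map natrD.
rewrite [X in _ <= X * M](_ : _ = 1 + (size s)%:R); last by rewrite /= -natr1 addrC.
rewrite mulrDl mul1r lerD//; first by rewrite h// mem_head.
by apply: IHs => y ys; apply: h; rewrite in_cons ys orbT.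
Qed.

(** * Inequalities behind the constants *)

Section real_inequalities.
Context (R : realType).
Implicit Types (a b q r n p x : R).

(** Writing x^r = x x^(r-1) reduces the case r >= 1 to r = 1. All comparisons of
    constants below are of this kind. *)
Lemma powR_ratio_le (c a b r : R) : 0 < a -> 0 < b -> a <= b -> c * a <= b ->
  1 <= r -> c * a `^ r <= b `^ r.
Proof.
move=> a0 b0 ab cab r1.
have E (y : R) : 0 < y -> y `^ r = y * y `^ (r - 1).
  by move=> y0; rewrite mulr_powRB1 ?(ltW y0)// (lt_le_trans ltr01).
rewrite (E a)// (E b)// mulrA.
apply: (@le_trans _ _ (b * a `^ (r - 1))); first by rewrite ler_wpM2r ?powR_ge0.
rewrite ler_wpM2l ?(ltW b0)//; apply: powR_le_mono => //; last exact: ltW.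
by rewrite subr_ge0.
Qed.

Lemma expR1_le3 : expR 1 <= 3 :> R.
Proof.
have h : expR (6^-1) <= (6 / 5 : R).
  have := expR_ge1Dx (- 6^-1 : R); rewrite expRN => h.
  have e0 := expR_gt0 (6^-1 : R).
  have : (1 - 6^-1) * expR (6^-1) <= 1 :> R by rewrite -ler_pdivlMr// div1r.
  by lra.
have -> : expR 1 = expR (6^-1) ^+ 6 :> R by rewrite -expRM_natl divff.
apply: (@le_trans _ _ ((6 / 5) ^+ 6)); last by lra.
by rewrite lerXn2r ?nnegrE ?expR_ge0.
Qed.

(** Since - ln q <= (1 - q) / q, the left-hand side is at most exp(2 r), and
    exp 1 <= 3. *)
Lemma entropy_power_le q r : 0 < q < 1 -> 0 <= r ->
  (q `^ (- (2 * r))) `^ (q / (1 - q)) <= 9 `^ r.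
Proof.
move=> /andP[q0 q1] r0; have q1' : 0 < 1 - q by rewrite subr_gt0.
rewrite -powRrM {1}/powR gt_eqF//.
have lnq : - ln q <= (1 - q) / q.
  rewrite -lnV ?posrE//.
  have -> : (1 - q) / q = q^-1 - 1 by field; rewrite gt_eqF.
  have {1}-> : q^-1 = 1 + (q^-1 - 1) by ring.
  by apply: le_ln1Dx; rewrite ltrBDr addNr invr_gt0.
have -> : - (2 * r) * (q / (1 - q)) * ln q = 2 * r * (q / (1 - q) * - ln q) by ring.
have h : q / (1 - q) * - ln q <= 1.
  apply: (le_trans (ler_wpM2l _ lnq)); first by rewrite divr_ge0 ?ltW.
  by rewrite le_eqVlt; apply/orP; left; apply/eqP; field; rewrite !gt_eqF.
apply: (@le_trans _ _ (expR (1 * (2 * r)))).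
  by rewrite ler_expR mul1r ler_piMr// mulr_ge0.
rewrite expRM powRrM powR_mulrn ?expR_ge0//; apply: powR_le_mono => //.
have := expR1_le3; have := expR_ge0 (1 : R); rewrite expr2 => e0 e3.
by apply: (@le_trans _ _ (3 * 3)); [rewrite ler_pM|rewrite -natrM].
Qed.

Lemma mono_ratio p : 0 < p < 1 -> (1 - p) ^+ 2 / (3 - p) <= 3^-1.
Proof.
move=> /andP[p0 p1]; rewrite ler_pdivrMr; last by lra.
by nra.
Qed.

Lemma mono_ratio_half p : 2^-1 <= p -> p < 1 -> (1 - p) ^+ 2 / (3 - p) <= 6^-1.
Proof.
move=> p0 p1; rewrite ler_pdivrMr; last by lra.
by nra.
Qed.

Lemma pow16_sqr r : 16 `^ r * 16 `^ r = 256 `^ r :> R.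
Proof. by rewrite -powRM// -natrM. Qed.

(** With g the ratio of kappa to the mesh of the coarsest net and e the entropy
    power. It reduces to 18 * 9^r <= 256^r. *)
Lemma sup_numeric g e r : 0 <= g -> 0 <= e -> e <= 9 `^ r -> 1 <= r ->
  2 * (9 / 4 * g ^+ 2) * e <=
  2 * (16 `^ r / 2 * (g ^+ 2 * (16 `^ r / 4) + 1)).
Proof.
move=> g0 e0 e9 r1; set y := 16 `^ r.
have y0 : 0 <= y by exact: powR_ge0.
have h : 18 * e <= y * y.
  rewrite pow16_sqr; apply: (@le_trans _ _ (18 * 9 `^ r)); first by rewrite ler_wpM2l.
  by apply: powR_ratio_le; rewrite -?natrM ?ltr0n ?ler_nat.
have := ler_wpM2l (sqr_ge0 g) h => h5.
rewrite (_ : 2 * (9 / 4 * g ^+ 2) * e = g ^+ 2 * (18 * e) / 4); last by field.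
rewrite (_ : 2 * (y / 2 * _) = g ^+ 2 * (y * y) / 4 + y); last by field.
by lra.
Qed.

(** For a single cell, with n = kappa / h. A square is completed to
    separate the powers of n, and 4 * 27^r <= 256^r. *)
Lemma increment_numeric_small n r : 0 <= n -> 1 <= r ->
  2 * (n / 2 * 3 `^ r + 1) ^+ 2 * 3 `^ r <= 16 `^ r * (16 `^ r / 4 * n ^+ 2 + 1).
Proof.
move=> n0 r1; have n20 : 0 <= n ^+ 2 by exact: sqr_ge0.
have h1 : 4 * 3 `^ r <= 16 `^ r :> R by apply: powR_ratio_le => //; lra.
have h2 : 4 * (3 `^ r) ^+ 3 <= 16 `^ r * 16 `^ r :> R.
  rewrite pow16_sqr -powR_mulrn ?powR_ge0// powRAC powR_mulrn// -natrX.
  by apply: powR_ratio_le; rewrite -?natrM ?ltr0n ?ler_nat.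
have x3 : 0 <= 3 `^ r :> R by exact: powR_ge0.
set x : R := 3 `^ r in x3 h1 h2 *; set y : R := 16 `^ r in h1 h2 *.
apply: (@le_trans _ _ (n ^+ 2 * x ^+ 3 + 4 * x)).
  rewrite -subr_ge0 (_ : _ - _ = 2 * (x * (n / 2 * x - 1) ^+ 2)); last by field.
  by rewrite mulr_ge0// mulr_ge0// sqr_ge0.
have := ler_wpM2l n20 h2; rewrite [leRHS](_ : _ = 4 * (y * (y / 4 * n ^+ 2))); last by field.
by rewrite mulrDr mulr1 mulrCA; lra.
Qed.

(** With n = kappa / h and N cells in each direction; the factor 2 is a lower bound
    for 1 / p when p <= 1/2. *)
Lemma increment_numeric_third N n r : 0 <= N -> N <= n -> 1 <= r ->
  2 * (N * (3 `^ r + 1)) ^+ 2 * 3 `^ r <= 16 `^ r * (16 `^ r / 4 * (n ^+ 2 * 2)).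
Proof.
move=> N0 Nn r1; have n20 : 0 <= n ^+ 2 by exact: sqr_ge0.
have N2n : N ^+ 2 <= n ^+ 2 by rewrite lerXn2r// nnegrE// (le_trans N0).
have h2 : 64 / 9 * (3 `^ r) ^+ 3 <= 16 `^ r * 16 `^ r :> R.
  rewrite pow16_sqr -powR_mulrn ?powR_ge0// powRAC powR_mulrn// -natrX.
  apply: powR_ratio_le; rewrite ?ltr0n ?ler_nat//.
  by rewrite mulrAC ler_pdivrMr// -!natrM ler_nat.
have x1 : 3 <= 3 `^ r :> R by rewrite -[leLHS]powRr1//; apply: ler_powR => //; lra.
set x : R := 3 `^ r in x1 h2 *; set y : R := 16 `^ r in h2 *.
have x0 : 0 <= x by lra.
have h3 : (x + 1) ^+ 2 <= 16 / 9 * x ^+ 2 by clear -x1; nra.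
apply: (@le_trans _ _ (2 * (n ^+ 2 * (16 / 9 * x ^+ 2)) * x)).
  by rewrite ler_wpM2r// ler_wpM2l// exprMn ler_pM// sqr_ge0.
rewrite (_ : 2 * (n ^+ 2 * (16 / 9 * x ^+ 2)) * x = n ^+ 2 * (64 / 9 * x ^+ 3) / 2); last by field.
rewrite (_ : y * (y / 4 * (n ^+ 2 * 2)) = n ^+ 2 * (y * y) / 2); last by field.
by rewrite ler_wpM2r// ler_wpM2l.
Qed.

(** For p > 1/2 nothing is gained from 1 / p, and the chaining ratio 2/3 yields
    the power of 3/2 in place of that of 3. *)
Lemma increment_numeric_twothirds N n r : 0 <= N -> N <= n -> 1 <= r ->
  2 * (N * ((3 / 2) `^ r + 1)) ^+ 2 * ((3 / 2) `^ r) ^+ 4 <=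
  16 `^ r * (16 `^ r / 4 * n ^+ 2).
Proof.
move=> N0 Nn r1; have n20 : 0 <= n ^+ 2 by exact: sqr_ge0.
have N2n : N ^+ 2 <= n ^+ 2 by rewrite lerXn2r// nnegrE// (le_trans N0).
have h2 : 200 / 9 * ((3 / 2) `^ r) ^+ 6 <= 16 `^ r * 16 `^ r :> R.
  rewrite pow16_sqr -powR_mulrn ?powR_ge0// powRAC powR_mulrn ?divr_ge0//.
  by apply: powR_ratio_le => //; lra.
have x1 : 3 / 2 <= (3 / 2) `^ r :> R.
  by rewrite -[leLHS]powRr1 ?divr_ge0//; apply: ler_powR => //; lra.
set x : R := (3 / 2) `^ r in x1 h2 *; set y : R := 16 `^ r in h2 *.
have x0 : 0 <= x by lra.
have h3 : (x + 1) ^+ 2 <= 25 / 9 * x ^+ 2 by clear -x1; nra.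
apply: (@le_trans _ _ (2 * (n ^+ 2 * (25 / 9 * x ^+ 2)) * x ^+ 4)).
  by rewrite ler_wpM2r ?exprn_ge0// ler_wpM2l// exprMn ler_pM// sqr_ge0.
rewrite (_ : 2 * (n ^+ 2 * (25 / 9 * x ^+ 2)) * x ^+ 4 = n ^+ 2 * (200 / 9 * x ^+ 6) / 4); last by field.
rewrite (_ : y * (y / 4 * n ^+ 2) = n ^+ 2 * (y * y) / 4); last by field.
by rewrite ler_wpM2r// ler_wpM2l.
Qed.

End real_inequalities.

(** * Tail bounds over countable index sets *)

Section random_field_tails.
Context disp (T : measurableType disp) (R : realType) (P : probability T R).
Context (phi : R -> R) (phiO : orlicz_N_function phi).
Context (a b c d : R) (le_ab : a <= b) (le_cd : c <= d).
Context (u : R * R -> T -> R) (C beta : R) (C0 : 0 < C) (beta_range : 0 < beta <= 1).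
Local Notation exp_bounded := (exp_bounded P phi).
Local Notation K := (`[a, b] `*` `[c, d] : set (R * R)).
Hypothesis u_increment : forall (h : R) (p q : R * R), 0 <= h -> K p -> K q ->
  `|p.1 - q.1| <= h -> `|p.2 - q.2| <= h ->
  exp_bounded (C * h `^ beta) (fun w => u p w - u q w).
Local Notation r := (beta^-1).
Local Notation kappa := (Num.max (b - a) (d - c)).

Let r1 : 1 <= r.
Proof. by case/andP: beta_range => b0 b1; rewrite -[leLHS]invr1 lef_pV2 ?posrE. Qed.

Let r0 : 0 <= r. Proof. exact: le_trans r1. Qed.

Let beta_neq0 : beta != 0. Proof. by case/andP: beta_range => b0 _; rewrite gt_eqF. Qed.

Lemma rectangleP (p : R * R) : K p <-> (a <= p.1 <= b) /\ (c <= p.2 <= d).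
Proof. by split => -[]; rewrite /= !in_itv/=. Qed.

(** The coarsest net has the mesh hs at which increments have norm theta * eps0, and
    the mesh of level k is hs * theta^(k / beta), so that the norms form the
    geometric sequence required by chaining. As theta * eps0 < C kappa^beta, the
    mesh is smaller than kappa; this absorbs the rounding in the size of the
    nets: x / 2 + 1 <= 3 x / 2 for x >= 1. *)
Lemma sup_tail (S : set (R * R)) (eps0 theta v : R) : 0 < eps0 ->
  (forall p, K p -> exp_bounded eps0 (u p)) -> 0 < theta < 1 ->
  theta * eps0 < C * kappa `^ beta -> 0 < v -> S `<=` K -> countable S ->
  let E := \bigcup_(p in S) [set w | v < `|u p w|] in
  measurable E /\
  (P E <= 2%:E * expeR (- young_fenchel phi (v * (1 - theta) / eps0)%R)
    * (2 `^ (4 / beta - 1) *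
       ((kappa * C `^ r) ^+ 2 * 4 `^ (2 / beta - 1) /
         (theta * eps0) `^ (2 / beta) + 1))%:E)%E.
Proof.
move=> e0 bu th thk v0 SK cS E; have /andP[t0 t1] := th.
have t1' : 0 < 1 - theta by rewrite subr_gt0.
pose hs := (theta * eps0 / C) `^ r.
have te0 : 0 < theta * eps0 by rewrite mulr_gt0.
have hs0 : 0 < hs by rewrite powR_gt0// divr_gt0.
have hsb : C * hs `^ beta = theta * eps0.
  rewrite /hs -powRrM mulVf// powRr1; last by rewrite divr_ge0// ltW.
  by rewrite mulrC divfK// gt_eqF.
have kap0 : 0 <= kappa by rewrite le_max subr_ge0 le_ab.
have hsk : hs < kappa.
  rewrite ltNge; apply/negP => kh; move: thk; rewrite ltNge -hsb.
  by rewrite ler_wpM2l ?(ltW C0)// powR_le_mono// ltW//; case/andP: beta_range.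
pose g := kappa / hs.
have g1 : 1 < g by rewrite /g ltr_pdivlMr// mul1r.
pose q := theta `^ r.
have q0 : 0 < q by rewrite powR_gt0.
have q1 : q < 1.
  have := @gt0_ltr_powR R r (lt_le_trans ltr01 r1) theta 1.
  by rewrite powR1; apply=> //; rewrite nnegrE ltW.
pose ep k := hs * q ^+ k.
have ep0 k : 0 < ep k by rewrite mulr_gt0// exprn_gt0.
pose rho := (q ^+ 2)^-1.
have q2 : q ^+ 2 < 1 by rewrite exprn_ilt1// ltW.
have rho1 : 1 < rho by rewrite invf_gt1// exprn_gt0.
have rhoE : rho = theta `^ (- (2 * r)).
  by rewrite /rho /q sqr_powR powRN.
pose Net k := [seq (x, y) | x <- interval_net a b (ep k), y <- interval_net c d (ep k)].
pose pi k (p : R * R) := (net_proj a b (ep k) p.1, net_proj c d (ep k) p.2).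
pose A := 9 / 4 * g ^+ 2.
have A1 : 1 <= A by rewrite /A; nra.
pose Delta := eps0 / (1 - theta).
have Delta0 : 0 < Delta by rewrite divr_gt0.
have DE : (1 - theta) * Delta = eps0 by rewrite mulrC divfK// gt_eqF.
have piN k i : K i -> pi k i \in Net k.
  move=> /rectangleP[K1 K2]; apply/allpairsP; exists (pi k i).
  by split=> //=; apply: net_proj_mem.
have ND k i : i \in Net k -> K i.
  move=> /allpairsP[[x y] /= [xN yN ->]]; apply/rectangleP => /=.
  split; [exact: (interval_net_sub (ep0 k) le_ab xN)|].
  exact: (interval_net_sub (ep0 k) le_cd yN).
have sN k : (size (Net k))%:R <= A * rho ^+ k.
  rewrite size_allpairs natrM.
  have sz lo hi : lo <= hi -> hi - lo <= kappa ->
      (size (interval_net lo hi (ep k)))%:R <= 3 / 2 * (kappa / ep k).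
    move=> lh hk; apply: (le_trans (size_interval_net (ep0 k) lh)).
    have h1 : (hi - lo) / (2 * ep k) <= 2^-1 * (kappa / ep k).
      have -> : (hi - lo) / (2 * ep k) = 2^-1 * ((hi - lo) / ep k).
        by field; rewrite gt_eqF.
      by rewrite ler_wpM2l// ler_wpM2r// invr_ge0 ltW.
    have h2 : 1 <= kappa / ep k.
      rewrite ler_pdivlMr// mul1r; apply: le_trans (ltW hsk).
      by rewrite /ep ler_piMr ?(ltW hs0)// exprn_ile1// ltW.
    by lra.
  have s1 := sz a b le_ab; have s2 := sz c d le_cd.
  rewrite !le_max !lexx orbT in s1 s2.
  apply: (le_trans (ler_pM _ _ (s1 isT) (s2 isT))) => //.
  rewrite le_eqVlt; apply/orP; left; apply/eqP.
  rewrite /A /g /ep /rho exprVn -exprM mulnC exprM; field.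
  by rewrite !gt_eqF// ?exprn_gt0.
have bL k i : K i -> exp_bounded ((1 - theta) * theta ^+ k.+1 * Delta)
    (fun w => u i w - u (pi k i) w).
  move=> Ki; have /rectangleP[K1 K2] := Ki; have Kp : K (pi k i) by apply: (ND k); exact: piN.
  rewrite mulrAC DE.
  have -> : eps0 * theta ^+ k.+1 = C * ep k `^ beta.
    rewrite /ep powRM ?exprn_ge0 ?(ltW hs0) ?(ltW q0)// mulrA hsb.
    by rewrite powR_invK ?(ltW t0)// exprS; ring.
  by apply: u_increment => //; [exact: ltW|exact: net_proj_dist|exact: net_proj_dist].
have bU i : K i -> exp_bounded ((1 - theta) * Delta) (u i).
  by rewrite DE; exact: bu.
have [mE PE] := chaining_tail phiO th A1 rho1 Delta0 (ltW v0) piN ND sN bU bL SK cS.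
split=> //; apply: (le_trans PE).
have -> : v / Delta = v * (1 - theta) / eps0 by rewrite /Delta invf_div mulrA.
rewrite [leRHS]muleC muleA; apply: lee_wpmul2r; first exact: expeR_ge0.
rewrite -EFinM lee_fin.
have -> : (kappa * C `^ r) ^+ 2 * 4 `^ (2 / beta - 1) / (theta * eps0) `^ (2 / beta) =
    g ^+ 2 * 4 `^ (2 * r - 1).
  have -> : (theta * eps0) `^ (2 / beta) = (hs * C `^ r) ^+ 2.
    rewrite -sqr_powR; congr (_ ^+ 2).
    rewrite /hs -powRM ?divr_ge0 ?(ltW te0) ?(ltW C0)//; congr (_ `^ r).
    by rewrite divfK// gt_eqF.
  have Cr0 : C `^ r != 0 by rewrite gt_eqF// powR_gt0.
  rewrite /g !exprMn; field.
  by rewrite Cr0 gt_eqF.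
have e9 := entropy_power_le th r0.
rewrite -rhoE in e9.
have p4 : 4 `^ (2 * r - 1) = 16 `^ r / 4 :> R.
  rewrite powRB ?pnatr_eq0 ?implybT// powRr1// powRrM powR_mulrn// -natrX.
  by [].
have p2 : 2 `^ (4 / beta - 1) = 16 `^ r / 2 :> R.
  by rewrite powRB ?pnatr_eq0 ?implybT// powRr1// powRrM powR_mulrn// -natrX.
rewrite p4 p2.
rewrite [leRHS]mulrC /A; apply: sup_numeric => //; last exact: powR_ge0.
by rewrite ltW// (lt_trans ltr01).
Qed.

(** A cell is a triple (left end, right end, centre). The distance of the
    two points and the distance to the centre have the same bound h, so that all
    increments within a cell are measured at one scale. *)
Definition covering (lo hi l h : R) (L : seq (R * R * R)) : Prop :=
  (forall i, i \in L -> [/\ lo <= i.1.1 <= i.1.2, i.1.2 <= hi,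
     lo <= i.2 <= hi, i.1.2 - i.1.1 <= l &
     forall t, i.1.1 <= t <= i.1.2 -> `|t - i.2| <= h]) /\
  (forall s t, lo <= s <= hi -> lo <= t <= hi -> `|s - t| <= h ->
     exists i, [/\ i \in L, i.1.1 <= s <= i.1.2 & i.1.1 <= t <= i.1.2]).

(** Two points of a pair in W share a cell in each coordinate, and u p - u q is the
    difference of the increments from p and from q to the centre m of the cell.
    One of these exceeds v / 2 in absolute value. The family indexed by a cell
    and a point of it is then treated by chaining with ratio q, with nets inside
    every cell. *)
Lemma cell_tail (L1 L2 : seq (R * R * R)) (m l h q v : R)
    (W : set ((R * R) * (R * R))) :
  covering a b l h L1 -> covering c d l h L2 ->
  (size L1)%:R <= m -> (size L2)%:R <= m -> 1 <= m -> 0 <= l -> 0 < h ->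
  0 < q < 1 -> 0 < v -> countable W ->
  (forall pq, W pq -> [/\ K pq.1, K pq.2, `|pq.1.1 - pq.2.1| <= h
                & `|pq.1.2 - pq.2.2| <= h]) ->
  let E := \bigcup_(pq in W) [set w | v < `|u pq.1 w - u pq.2 w|] in
  measurable E /\
  (P E <= (2 * (m * (l / (2 * h) * q `^ (- r) + 1)) ^+ 2 *
       (q `^ (- (2 * r))) `^ (q / (1 - q)))%:E
     * expeR (- young_fenchel phi (v * (1 - q) / (2 * (C * h `^ beta)))%R))%E.
Proof.
move=> [L1P L1c] [L2P L2c] s1 s2 m1 l0 h0 q01 v0 cW WK E; have /andP[q0 q1] := q01.
have q1' : 0 < 1 - q by rewrite subr_gt0.
pose I := ((R * R * R) * (R * R * R) * (R * R))%type.
pose D : set I := [set i | [/\ i.1.1 \in L1, i.1.2 \in L2,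
  i.1.1.1.1 <= i.2.1 <= i.1.1.1.2 & i.1.2.1.1 <= i.2.2 <= i.1.2.1.2]].
pose U (i : I) w := u i.2 w - u (i.1.1.2, i.1.2.2) w.
pose z := q `^ r.
have z0 : 0 < z by rewrite powR_gt0.
have z1 : z < 1.
  have := @gt0_ltr_powR R r (lt_le_trans ltr01 r1) q 1.
  by rewrite powR1; apply=> //; rewrite nnegrE ltW.
have zE : q `^ (- r) = z^-1 by rewrite powRN.
pose ep k := h * z ^+ k.+1.
have ep0 k : 0 < ep k by rewrite mulr_gt0// exprn_gt0.
pose rho := (z ^+ 2)^-1.
have rho1 : 1 < rho by rewrite invf_gt1 ?exprn_gt0// exprn_ilt1// ltW.
have rhoE : rho = q `^ (- (2 * r)) by rewrite /rho /z sqr_powR powRN.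
pose cellnet k (i : (R * R * R) * (R * R * R)) :=
  [seq (x, y) | x <- interval_net i.1.1.1 i.1.1.2 (ep k),
                y <- interval_net i.2.1.1 i.2.1.2 (ep k)].
pose Net k : seq I := [seq (i, p) | i <- [seq (i1, i2) | i1 <- L1, i2 <- L2],
                            p <- cellnet k i].
pose pi k (i : I) : I := (i.1, (net_proj i.1.1.1.1 i.1.1.1.2 (ep k) i.2.1,
                               net_proj i.1.2.1.1 i.1.2.1.2 (ep k) i.2.2)).
pose B := l / (2 * h) * q `^ (- r) + 1.
have B1 : 1 <= B by rewrite lerDr mulr_ge0 ?powR_ge0// divr_ge0// mulr_ge0// ltW.
pose A := (m * B) ^+ 2.
have mB1 : 1 <= m * B by rewrite -[leLHS]mulr1 ler_pM.
have A1 : 1 <= A by rewrite exprn_ege1.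
pose Delta := C * h `^ beta / (1 - q).
have Ch0 : 0 < C * h `^ beta by rewrite mulr_gt0// powR_gt0.
have Delta0 : 0 < Delta by rewrite divr_gt0.
have DE : (1 - q) * Delta = C * h `^ beta by rewrite mulrC divfK// gt_eqF.
have DK i : D i -> K i.2.
  move=> [/L1P[/andP[h1 _] h2 _ _ _] /L2P[/andP[h3 _] h4 _ _ _] /andP[h5 h6] /andP[h7 h8]].
  by apply/rectangleP; split; apply/andP; split; [apply: le_trans h5|apply: le_trans h2|
    apply: le_trans h7|apply: le_trans h4].
have DM i : D i -> K (i.1.1.2, i.1.2.2).
  by move=> [/L1P[_ _ h1 _ _] /L2P[_ _ h2 _ _] _ _]; apply/rectangleP.
have piN k i : D i -> pi k i \in Net k.
  case: i => [[i1 i2] t] [/= h1 h2 h3 h4]; apply/allpairsPdep.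
  exists (i1, i2), (pi k (i1, i2, t)).2; split=> //=.
    by apply/allpairsP; exists (i1, i2).
  by apply/allpairsP; exists (pi k (i1, i2, t)).2; split=> //=; exact: net_proj_mem.
have ND k i : i \in Net k -> D i.
  move=> /allpairsPdep[ii [p [/allpairsP[[i1 i2] /= [h1 h2 ->]] hp ->]]].
  move: hp => /allpairsP[[x y] /= [hx hy ->]]; split=> //=.
    by apply: interval_net_sub hx => //; have [/andP[]] := L1P _ h1.
  by apply: interval_net_sub hy => //; have [/andP[]] := L2P _ h2.
have sN k : (size (Net k))%:R <= A * rho ^+ k.
  have rk : rho ^+ k = (z^-1 ^+ k) ^+ 2.
    by rewrite /rho !exprVn -!exprM mulnC.
  pose M := B * z^-1 ^+ k.
  have zk : 1 <= z^-1 ^+ k by rewrite exprn_ege1// invf_ge1// ltW.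
  have sz (i : R * R * R) : i.1.1 <= i.1.2 -> i.1.2 - i.1.1 <= l ->
      (size (interval_net i.1.1 i.1.2 (ep k)))%:R <= M.
    move=> h1 h2; apply: (le_trans (size_interval_net (ep0 k) h1)).
    have -> : (i.1.2 - i.1.1) / (2 * ep k) =
        (i.1.2 - i.1.1) / (2 * h) * z^-1 * z^-1 ^+ k.
      rewrite /ep exprVn exprS; field.
      by rewrite !gt_eqF ?exprn_gt0.
    have -> : M = l / (2 * h) * z^-1 * z^-1 ^+ k + z^-1 ^+ k.
      by rewrite /M /B zE; ring.
    rewrite lerD//.
    rewrite ler_wpM2r ?(le_trans ler01)// ler_wpM2r ?invr_ge0 ?(ltW z0)//.
    by rewrite ler_wpM2r// invr_ge0 mulr_ge0// ltW.
  have szc i : i \in [seq (i1, i2) | i1 <- L1, i2 <- L2] ->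
      (size (cellnet k i))%:R <= M ^+ 2.
    move=> /allpairsP[[i1 i2] [h1 h2 ->]]; rewrite /cellnet size_allpairs natrM expr2.
    have [/andP[_ ?] _ _ ? _] := L1P _ h1; have [/andP[_ ?] _ _ ? _] := L2P _ h2.
    by apply: ler_pM => //; apply: sz.
  apply: (le_trans (size_allpairs_dep_le _ szc)).
  rewrite size_allpairs natrM rk /A /M !exprMn.
  have -> : m ^+ 2 * B ^+ 2 * z^-1 ^+ k ^+ 2 = m * m * (B ^+ 2 * z^-1 ^+ k ^+ 2) by ring.
  by rewrite ler_wpM2r ?ler_pM// mulr_ge0// sqr_ge0.
have bU i : D i -> exp_bounded ((1 - q) * Delta) (U i).
  move=> Di; rewrite DE; have [h1 h2 h3 h4] := Di.
  apply: u_increment; [exact: ltW|exact: DK|exact: DM| |] => /=.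
    by have [_ _ _ _] := L1P _ h1; apply.
  by have [_ _ _ _] := L2P _ h2; apply.
have bL k i : D i -> exp_bounded ((1 - q) * q ^+ k.+1 * Delta)
    (fun w => U i w - U (pi k i) w).
  move=> Di; have Dp : D (pi k i) by apply: (ND k); exact: piN.
  have [h1 h2 h3 h4] := Di.
  have -> : (fun w => U i w - U (pi k i) w) = (fun w => u i.2 w - u (pi k i).2 w).
    by apply/funext => w; rewrite /U /=; ring.
  rewrite mulrAC DE.
  have -> : C * h `^ beta * q ^+ k.+1 = C * ep k `^ beta.
    rewrite /ep powRM ?exprn_ge0 ?(ltW h0) ?(ltW z0)// mulrA.
    by rewrite powR_invK// ltW.
  apply: u_increment; [exact: ltW|exact: DK|exact: DK| |] => /=; exact: net_proj_dist.
(* a common cell is chosen for every pair of W, with a dummy value outside W *)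
have cell (pq : (R * R) * (R * R)) : exists ii : (R * R * R) * (R * R * R),
    W pq -> D (ii, pq.1) /\ D (ii, pq.2).
  have [Wpq|nW] := pselect (W pq); last by exists (((0, 0), 0), ((0, 0), 0)).
  have [/rectangleP[k1 k2] /rectangleP[k3 k4] d1 d2] := WK _ Wpq.
  have [i1 [i1L hs1 ht1]] := L1c _ _ k1 k3 d1.
  have [i2 [i2L hs2 ht2]] := L2c _ _ k2 k4 d2.
  by exists (i1, i2) => _; split.
have [f fP] := choice cell.
pose D0 : set I := (fun pq => (f pq, pq.1)) @` W `|` (fun pq => (f pq, pq.2)) @` W.
have D0D : D0 `<=` D by move=> _ [] [pq Wpq <-]; have [] := fP _ Wpq.
have cD0 : countable D0.
  rewrite /D0 -bigcup2E; apply: bigcup_countable => //.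
  by move=> [|[|n]] _ //=; exact: card_le_trans (card_image_le _ _) cW.
have v2 : 0 <= v / 2 by rewrite divr_ge0// ltW.
have [mE0 PE0] := chaining_tail phiO q01 A1 rho1 Delta0 v2 piN ND sN bU bL D0D cD0.
have mW pq : W pq -> measurable [set w | v < `|u pq.1 w - u pq.2 w|].
  move=> Wpq; have [k1 k2 d1 d2] := WK _ Wpq.
  have [mU _] := u_increment (ltW h0) k1 k2 d1 d2.
  exact: (measurable_norm_gt v mU).
have mE : measurable E.
  have [] := @countable_union_le _ _ _ P _ W _ 1%E cW mW => // s sW.
  apply: probability_le1; rewrite big_seq.
  by apply: bigsetU_measurable => pq /sW; exact: mW.
split=> //; apply: (@le_trans _ _ (P (\bigcup_(i in D0) [set w | v / 2 < `|U i w|]))).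
  apply: le_measure; rewrite ?inE// => w [pq Wpq /= vpq].
  have := ler_normD (U (f pq, pq.1) w) (- U (f pq, pq.2) w).
  have -> : U (f pq, pq.1) w + - U (f pq, pq.2) w = u pq.1 w - u pq.2 w.
    by rewrite /U/=; ring.
  rewrite normrN => tri.
  have [h1|h1] := ltP (v / 2) `|U (f pq, pq.1) w|.
    by exists (f pq, pq.1) => //; left; exists pq.
  exists (f pq, pq.2); first by right; exists pq.
  rewrite /= ltNge; apply/negP => h2; move: vpq; rewrite ltNge => /negP; apply.
  by rewrite (le_trans tri)// [leRHS](splitr v) lerD.
apply: (le_trans PE0).
have -> : v / 2 / Delta = v * (1 - q) / (2 * (C * h `^ beta)).
  by rewrite /Delta; field; rewrite !gt_eqF// powR_gt0.
by rewrite rhoE.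
Qed.

(** If kappa <= h, the whole interval is one cell and its left end serves as
    centre. *)
Lemma covering_single (lo hi h : R) : lo <= hi -> hi - lo <= kappa -> kappa <= h ->
  covering lo hi kappa h [:: (lo, hi, lo)].
Proof.
move=> lohi hk kh; split=> [i|s t hs ht _]; last by exists (lo, hi, lo); rewrite mem_head.
rewrite inE => /eqP ->/=; split=> //; rewrite ?lexx ?lohi// => t /andP[t1 t2].
by rewrite ger0_norm ?subr_ge0//; lra.
Qed.

(** The cell [lo + j h, lo + (j + 2) h] cut off at hi: cells of length 2 h that
    overlap by h, so that two points at distance at most h share one. *)
Definition overlap_cell (lo hi h : R) (j : nat) : R * R * R :=
  (Num.min hi (lo + j%:R * h), Num.min hi (lo + (j%:R + 2) * h),
   Num.min hi (lo + (j%:R + 1) * h)).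

Lemma covering_overlap (lo hi h : R) : lo <= hi -> hi - lo <= kappa -> 0 < h ->
  h <= kappa ->
  covering lo hi (2 * h) h
    [seq overlap_cell lo hi h j | j <- iota 0 (Num.truncn (kappa / h))].
Proof.
move=> lohi hk h0 hkap.
have kh : 1 <= kappa / h by rewrite ler_pdivlMr// mul1r.
have /andP[N1 N2] : (Num.truncn (kappa / h))%:R <= kappa / h <
    (Num.truncn (kappa / h)).+1%:R.
  by apply: truncn_itv; exact: le_trans kh.
have N0 : (0 < Num.truncn (kappa / h))%N by rewrite truncn_gt0.
set N := Num.truncn (kappa / h) in N1 N2 N0 *.
have jh0 (j : nat) : 0 <= j%:R * h by rewrite mulr_ge0// ltW.
split=> [i /mapP[j _ ->]|s t /andP[s1 s2] /andP[t1 t2] st] /=.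
  have := jh0 j => j0.
  rewrite /overlap_cell; split=> /=.
  - by rewrite le_min lohi lerDl j0/= le_min ge_min lexx/= ge_min mulrDl; apply/orP; right; lra.
  - by rewrite ge_min lexx.
  - by rewrite le_min lohi ge_min lexx/= andbT lerDl mulrDl; lra.
  - rewrite !mulrDl mul1r; case: (leP hi (lo + j%:R * h)) => h1; case: (leP hi) => h2; lra.
  - move=> t; rewrite !mulrDl mul1r.
    rewrite le_min ge_min => /andP[/orP[h4|h4] /andP[h5 h6]];
    by case: (leP hi) => h3; rewrite ler_norml; apply/andP; split; lra.
wlog st' : s t s1 s2 t1 t2 st / s <= t.
  move=> H; case: (leP s t) => [|ts]; first exact: H.
  have [i [? ? ?]] := H t s t1 t2 s1 s2 (eq_ind _ (fun x => x <= h) st _ (distrC _ _)) (ltW ts).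
  by exists i.
move: st; rewrite distrC ger0_norm ?subr_ge0// => st.
have x0 : 0 <= (s - lo) / h by rewrite divr_ge0 ?subr_ge0// ltW.
have /andP[] := truncn_itv x0; set j := Num.truncn ((s - lo) / h).
rewrite ler_pdivlMr// ltr_pdivrMr// -natr1 => j1 j2.
have NE : N%:R = N.-1%:R + 1 :> R by rewrite natr1 prednK.
rewrite ltr_pdivrMr// -natr1 in N2.
have [jN|jN] := ltnP j N.
  exists (overlap_cell lo hi h j); split=> /=.
  - by apply: map_f; rewrite mem_iota.
  - by apply/andP; split; rewrite ?ge_min ?le_min ?s2/=; [apply/orP; right|]; lra.
  - by apply/andP; split; rewrite ?ge_min ?le_min ?t2/=; [apply/orP; right|]; lra.
have jN' : N%:R * h <= j%:R * h by rewrite ler_wpM2r ?ler_nat// ltW.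
exists (overlap_cell lo hi h N.-1); split=> /=.
- by apply: map_f; rewrite mem_iota/= add0n prednK.
- by apply/andP; split; rewrite ?ge_min ?le_min ?s2/=; [apply/orP; right|]; nra.
- by apply/andP; split; rewrite ?ge_min ?le_min ?t2/=; [apply/orP; right|]; nra.
Qed.

(** If kappa <= h there is one cell, otherwise about (kappa / h)^2 overlapping ones.
    The chaining ratio is chosen by the inequality
    (1 - p)^2 / (3 - p) <= (1 - q) / 2 needed in the exponent: q = 1/3 always
    satisfies it and is good enough when kappa <= h or p <= 1/2, whereas for
    p > 1/2 also q = 2/3 does, which makes the entropy factor small enough. *)
Lemma increment_tail (p h v : R) (W : set ((R * R) * (R * R))) :
  0 < p < 1 -> 0 < h -> 0 < v -> countable W ->
  (forall pq, W pq -> [/\ K pq.1, K pq.2, `|pq.1.1 - pq.2.1| <= h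
                & `|pq.1.2 - pq.2.2| <= h]) ->
  let E := \bigcup_(pq in W) [set w | v < `|u pq.1 w - u pq.2 w|] in
  measurable E /\
  (P E <= (2 `^ (4 / beta))%:E
     * expeR (- young_fenchel phi (v * (1 - p) ^+ 2 / (C * h `^ beta * (3 - p)))%R)
     * (2 `^ (4 / beta - 2) * kappa ^+ 2 / (p * h ^+ 2) + 1)%:E)%E.
Proof.
move=> p01 h0 v0 cW WK E; have /andP[p0 p1] := p01.
have kap0 : 0 <= kappa by rewrite le_max subr_ge0 le_ab.
have kab : b - a <= kappa by rewrite le_max lexx.
have kcd : d - c <= kappa by rewrite le_max lexx orbT.
pose n := kappa / h.
have n0 : 0 <= n by rewrite divr_ge0// ltW.
have Ch0 : 0 < C * h `^ beta by rewrite mulr_gt0// powR_gt0.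
have n2 : kappa ^+ 2 / (p * h ^+ 2) = n ^+ 2 / p.
  by rewrite /n; field; rewrite !gt_eqF.
have p4 : 2 `^ (4 / beta) = 16 `^ r :> R by rewrite powRrM powR_mulrn// -natrX.
have p2 : 2 `^ (4 / beta - 2) = 16 `^ r / 4 :> R.
  by rewrite powRB ?pnatr_eq0 ?implybT// p4 powR_mulrn// -natrX.
have q16 : 0 <= 16 `^ r :> R by exact: powR_ge0.
have pinv : 1 <= p^-1 by rewrite invf_ge1// ltW.
have goal_from (q m l : R) (L1 L2 : seq (R * R * R)) : 0 < q < 1 ->
    covering a b l h L1 -> covering c d l h L2 ->
    (size L1)%:R <= m -> (size L2)%:R <= m -> 1 <= m -> 0 <= l ->
    (1 - p) ^+ 2 / (3 - p) <= (1 - q) / 2 ->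
    2 * (m * (l / (2 * h) * q `^ (- r) + 1)) ^+ 2 *
       (q `^ (- (2 * r))) `^ (q / (1 - q)) <=
      16 `^ r * (16 `^ r / 4 * (n ^+ 2 / p) + 1) ->
    measurable E /\
    (P E <= (2 `^ (4 / beta))%:E
     * expeR (- young_fenchel phi (v * (1 - p) ^+ 2 / (C * h `^ beta * (3 - p)))%R)
     * (2 `^ (4 / beta - 2) * kappa ^+ 2 / (p * h ^+ 2) + 1)%:E)%E.
  move=> q01 c1 c2 s1 s2 m1 l0 hL hN.
  have [mE PE] := cell_tail c1 c2 s1 s2 m1 l0 h0 q01 v0 cW WK.
  split=> //; apply: (le_trans PE).
  rewrite [leRHS]muleAC -EFinM; apply: lee_pmul.
  - by rewrite lee_fin mulr_ge0 ?powR_ge0// mulr_ge0// sqr_ge0.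
  - exact: expeR_ge0.
  - rewrite lee_fin p4 p2 (_ : _ * kappa ^+ 2 / _ = 16 `^ r / 4 * (n ^+ 2 / p))//.
    by rewrite /n; field; rewrite !gt_eqF.
  rewrite lee_expeR leeN2; apply: young_fenchel_mono => //.
    rewrite divr_ge0//; first by rewrite mulr_ge0 ?sqr_ge0 ?(ltW v0).
    by rewrite mulr_ge0 ?(ltW Ch0)// subr_ge0 (le_trans (ltW p1))// ler1n.
  have -> : v * (1 - p) ^+ 2 / (C * h `^ beta * (3 - p)) =
      v / (C * h `^ beta) * ((1 - p) ^+ 2 / (3 - p)).
    by rewrite [(_ * (3 - p))^-1]invfM; ring.
  have -> : v * (1 - q) / (2 * (C * h `^ beta)) = v / (C * h `^ beta) * ((1 - q) / 2).
    by rewrite [(2 * _)^-1]invfM; ring.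
  by rewrite ler_wpM2l// divr_ge0 ?(ltW v0)// ltW.
have third : 0 < (3^-1 : R) < 1 by rewrite invr_gt0 invf_lt1 ?ltr0n ?ltr1n.
have i3 (s : R) : (3^-1 : R) `^ (- s) = 3 `^ s.
  by rewrite -powR_inv1// -powRrM mulN1r opprK.
have half3 : (3^-1 : R) / (1 - 3^-1) = 2^-1 by field.
have e3 : (3^-1 `^ (- (2 * r))) `^ (3^-1 / (1 - 3^-1)) = 3 `^ r :> R.
  by rewrite half3 i3 -powRrM mulrAC divff// mul1r.
have lam3 : (1 - p) ^+ 2 / (3 - p) <= (1 - 3^-1) / 2.
  by rewrite (_ : (1 - 3^-1) / 2 = 3^-1) ?mono_ratio//; field.
have [hk|kh] := leP kappa h.
  apply: (goal_from 3^-1 1 kappa [:: (a, b, a)] [:: (c, d, c)]) => //.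
  - exact: covering_single.
  - exact: covering_single.
  rewrite e3 i3 mul1r.
  have -> : kappa / (2 * h) = n / 2 by rewrite /n; field; rewrite gt_eqF.
  apply: (le_trans (increment_numeric_small n0 r1)).
  by rewrite ler_wpM2l// lerD2r ler_wpM2l ?divr_ge0// ler_peMr ?sqr_ge0.
have n1 : 1 <= n by rewrite /n ler_pdivlMr// mul1r ltW.
pose N : R := (Num.truncn n)%:R.
have N1 : 1 <= N by rewrite ler1n truncn_gt0.
have Nn : N <= n by rewrite truncn_le.
have sL lo hi : (size [seq overlap_cell lo hi h j | j <- iota 0 (Num.truncn (kappa / h))])%:R <= N.
  by rewrite size_map size_iota.
have cab := covering_overlap le_ab kab h0 (ltW kh).
have ccd := covering_overlap le_cd kcd h0 (ltW kh).
have l1 : 2 * h / (2 * h) = 1 by rewrite divff// mulf_neq0// gt_eqF.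
have h2h : 0 <= 2 * h by rewrite mulr_ge0// ltW.
have [ph|ph] := leP p 2^-1.
  apply: (goal_from 3^-1 N (2 * h) _ _ third cab ccd (sL _ _) (sL _ _)) => //.
  rewrite e3 i3 l1 mul1r.
  have p2' : 2 <= p^-1 by rewrite -[2]invrK lef_pV2 ?posrE.
  apply: (le_trans (increment_numeric_third (le_trans ler01 N1) Nn r1)).
  by rewrite ler_wpM2l// ler_wpDr// ler_wpM2l ?divr_ge0// ler_wpM2l ?sqr_ge0.
have twothird : 0 < (2 / 3 : R) < 1 by rewrite divr_gt0//= ltr_pdivrMr// mul1r ltr_nat.
apply: (goal_from (2 / 3) N (2 * h) _ _ twothird cab ccd (sL _ _) (sL _ _)) => //.
  by rewrite (_ : (1 - 2 / 3) / 2 = 6^-1) ?mono_ratio_half// ?(ltW ph)//; field.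
have i23 (s : R) : (2 / 3 : R) `^ (- s) = (3 / 2) `^ s.
  rewrite (_ : 2 / 3 = (3 / 2)^-1); last by field.
  by rewrite -powR_inv1 ?divr_ge0// -powRrM mulN1r opprK.
have half23 : (2 / 3 : R) / (1 - 2 / 3) = 2 by field.
have e23 : ((2 / 3) `^ (- (2 * r))) `^ (2 / 3 / (1 - 2 / 3)) = ((3 / 2) `^ r) ^+ 4 :> R.
  rewrite half23 i23 -powRrM -powR_mulrn ?powR_ge0// -powRrM; congr (_ `^ _); ring.
rewrite e23 i23 l1 mul1r.
apply: (le_trans (increment_numeric_twothirds (le_trans ler01 N1) Nn r1)).
by rewrite ler_wpM2l// ler_wpDr// ler_wpM2l ?divr_ge0// ler_peMr ?sqr_ge0.
Qed.
End random_field_tails.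

(** * From countable to uncountable index sets *)

Section null_sets.
Context disp (T : measurableType disp) (R : realType) (P : probability T R).

(** The intersection of such sets B, for e = 1 / (n + 1), has probability 0. *)
Lemma negligible_small (A : set T) :
  (forall e : R, 0 < e -> exists B, [/\ measurable B, A `<=` B & (P B <= e%:E)%E]) ->
  P.-negligible A.
Proof.
move=> h.
have [B BP] := choice (fun n : nat => h n.+1%:R^-1 (ltac:(by rewrite invr_gt0))).
have mB : measurable (\bigcap_n B n).
  by apply: bigcapT_measurable => n; have [] := BP n.
exists (\bigcap_n B n); split=> //; last by move=> w Aw n _; have [_ AB _] := BP n; exact: AB.
apply/eqP; rewrite eq_le measure_ge0 andbT; apply/lee_addgt0Pr => e e0.
rewrite add0e; have [n ne] := small_invS e0.
have [mBn _ PBn] := BP n.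
apply: (@le_trans _ _ (P (B n))); last by rewrite (le_trans PBn)// lee_fin.
by apply: le_measure; rewrite ?inE//; exact: bigcap_inf.
Qed.

Lemma complete_measure_le (A B N : set T) : measure_is_complete P ->
  measurable B -> P.-negligible N -> B `<=` A -> A `<=` B `|` N ->
  measurable A /\ (P A <= P B)%E.
Proof.
move=> Pc mB nN BA ABN.
have nD : P.-negligible (A `\` B).
  by apply: negligibleS nN => w [/ABN[]].
have mD : measurable (A `\` B) by exact: Pc.
have AE : A = B `|` (A `\` B).
  by rewrite setUC setDKU.
split; first by rewrite AE; exact: measurableU.
rewrite AE; apply: (le_trans (measureU2 _ _ _)) => //.
by have /(negligibleP _ mD) -> := nD; rewrite adde0.
Qed.

Lemma ereal_sup_event (I : Type) (W : set I) (f : I -> T -> R) (v : R) :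
  [set w | (v%:E < ereal_sup [set (f i w)%:E | i in W])%E] =
  \bigcup_(i in W) [set w | v < f i w].
Proof.
apply/seteqP; split=> [w /= /ereal_sup_gt[_ [i Wi <-]]|w [i Wi /= vf]].
  by rewrite lte_fin => vf; exists i.
apply: (@lt_le_trans _ _ (f i w)%:E); first by rewrite lte_fin.
by apply: ereal_sup_ubound; exists i.
Qed.

End null_sets.

Section countable_dense.
Context (R : realType).

Lemma floor_grid_close (x y : R) n :
  Num.floor (x * n.+1%:R) = Num.floor (y * n.+1%:R) -> `|x - y| <= n.+1%:R^-1.
Proof.
move=> xy; have := floor_itv (x * n.+1%:R); have := floor_itv (y * n.+1%:R).
rewrite xy; set m := Num.floor _; rewrite intrD => /andP[h1 h2] /andP[h3 h4].
have n0 : 0 < n.+1%:R :> R by rewrite ltr0n.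
rewrite -[leRHS]mul1r ler_pdivlMr// -[in leLHS](gtr0_norm n0) -normrM mulrBl.
by rewrite ler_norml; apply/andP; split; lra.
Qed.

(** For every n, one point of W is picked in each cell of the grid of mesh
    1 / (n + 1) that meets W. *)
Lemma countable_dense_subset (W : set ((R * R) * (R * R))) :
  exists Q, [/\ Q `<=` W, countable Q & forall z, W z -> forall e, 0 < e ->
    exists2 z', Q z' & [/\ `|z.1.1 - z'.1.1| <= e, `|z.1.2 - z'.1.2| <= e,
                          `|z.2.1 - z'.2.1| <= e & `|z.2.2 - z'.2.2| <= e]].
Proof.
pose key n (z : (R * R) * (R * R)) := (n,
  ((Num.floor (z.1.1 * n.+1%:R), Num.floor (z.1.2 * n.+1%:R)),
   (Num.floor (z.2.1 * n.+1%:R), Num.floor (z.2.2 * n.+1%:R)))).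
have pick k : exists z, (exists2 z', W z' & key k.1 z' = k) -> W z /\ key k.1 z = k.
  have [[z Wz kz]|nk] := pselect (exists2 z', W z' & key k.1 z' = k).
    by exists z.
  by exists ((0, 0), (0, 0)).
have [g gP] := choice pick.
pose D := [set k | exists2 z', W z' & key k.1 z' = k].
exists (g @` D); split=> [_ [k Dk <-]||z Wz e e0].
- by have [] := gP _ Dk.
- exact: card_le_trans (card_image_le _ _) (countableP _).
have [n ne] := small_invS e0.
have Dk : D (key n z) by exists z.
exists (g (key n z)); first by exists (key n z).
have [_ [k1 k2 k3 k4]] := gP _ Dk.
by split; apply: (le_trans _ ne); apply: floor_grid_close.
Qed.

End countable_dense.

Section path_regularity.
Context disp (T : measurableType disp) (R : realType) (P : probability T R).
Context (phi : R -> R) (phiO : orlicz_N_function phi).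
Context (a b c d : R) (le_ab : a <= b) (le_cd : c <= d).
Context (u : R * R -> T -> R) (C beta : R) (C0 : 0 < C) (beta_range : 0 < beta <= 1).
Local Notation K := (`[a, b] `*` `[c, d] : set (R * R)).
Hypothesis u_increment : forall (h : R) (p q : R * R), 0 <= h -> K p -> K q ->
  `|p.1 - q.1| <= h -> `|p.2 - q.2| <= h ->
  exp_bounded P phi (C * h `^ beta) (fun w => u p w - u q w).
Local Notation r := (beta^-1).
Local Notation Kh h := [set pq : (R * R) * (R * R) | [/\ K pq.1, K pq.2,
  `|pq.1.1 - pq.2.1| <= h & `|pq.1.2 - pq.2.2| <= h]].

(** The bound on the transform by its value at the slope y = 1 gives exponential
    decay in h^(- beta), which beats the power h^(-2). *)
Lemma increment_bound_vanishes (v e A B : R) : 0 < v -> 0 < e -> 0 <= A -> 0 <= B ->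
  exists2 h, 0 < h &
    (A%:E * expeR (- young_fenchel phi (v / h `^ beta)%R) * (B / h ^+ 2 + 1)%:E
     <= e%:E)%E.
Proof.
move=> v0 e0 A0 B0; have /andP[b0 b1] := beta_range.
have r1 : 1 <= r by rewrite -[leLHS]invr1 lef_pV2 ?posrE.
pose m := (Num.truncn (2 * r)).+2.
have mr : 2 * r <= m.-1%:R by rewrite ltW// truncnS_gt.
have m0 : 0 < m%:R :> R by rewrite ltr0n.
pose G := A * (B + 1) * expR (phi 1) * (m%:R / v) ^+ m.
have G0 : 0 <= G.
  by rewrite mulr_ge0 ?exprn_ge0 ?divr_ge0 ?(ltW v0)// mulr_ge0 ?expR_ge0// mulr_ge0 ?addr_ge0.
pose y := G / e + 1.
have y1 : 1 <= y by rewrite lerDr divr_ge0// ltW.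
have y0 : 0 < y by exact: lt_le_trans y1.
(* y is h^(- beta); at this value the bound is at most G / y *)
exists (y^-1 `^ r); first by rewrite powR_gt0// invr_gt0.
have yi0 : 0 <= y^-1 by rewrite invr_ge0 ltW.
have bn0 : beta != 0 by rewrite gt_eqF.
have := powR_invK 1 bn0 yi0; rewrite !expr1 => ->; rewrite invrK.
rewrite sqr_powR -powR_inv1 ?(ltW y0)// -powRrM mulN1r powRN invrK.
have hY : (expeR (- young_fenchel phi (v * y)%R) <= (expR (phi 1 - v * y))%:E)%E.
  rewrite -[leRHS]/(expeR (phi 1 - v * y)%:E) lee_expeR leeNl -EFinN.
  by apply: ereal_sup_ubound; exists 1 => //; rewrite mulr1 opprB.
have hE : (v * y / m%:R) ^+ m <= expR (v * y).
  have -> : expR (v * y) = expR (v * y / m%:R) ^+ m.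
    by rewrite -expRM_natr divfK// gt_eqF.
  rewrite lerXn2r ?nnegrE ?expR_ge0 ?divr_ge0 ?mulr_ge0 ?(ltW v0) ?(ltW y0)//.
  by apply: le_trans (expR_ge1Dx _); rewrite lerDr.
have yr : y `^ (2 * r) <= y ^+ m.-1.
  by rewrite -powR_mulrn ?(ltW y0)//; apply: ler_powR.
apply: (@le_trans _ _ (A%:E * (expR (phi 1 - v * y))%:E * (B * y `^ (2 * r) + 1)%:E)%E).
  apply: lee_wpmul2r; first by rewrite lee_fin addr_ge0// mulr_ge0// powR_ge0.
  by apply: lee_wpmul2l => //; rewrite lee_fin.
rewrite -!EFinM lee_fin expRD expRN.
have w0 : 0 < v * y / m%:R by rewrite divr_gt0// mulr_gt0.
apply: (@le_trans _ _ (A * (expR (phi 1) / (v * y / m%:R) ^+ m) *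
    ((B + 1) * y ^+ m.-1))).
  apply: ler_pM.
  - by rewrite mulr_ge0// divr_ge0 ?expR_ge0.
  - by rewrite addr_ge0// mulr_ge0// powR_ge0.
  - rewrite ler_wpM2l// ler_wpM2l ?expR_ge0// lef_pV2 ?posrE ?expR_gt0//.
    by rewrite exprn_gt0.
  - rewrite [leRHS]mulrDl [1 * _]mul1r; apply: lerD; first by rewrite ler_wpM2l.
    by rewrite exprn_ege1.
have -> : A * (expR (phi 1) / (v * y / m%:R) ^+ m) * ((B + 1) * y ^+ m.-1) = G / y.
  rewrite /G -[in LHS](mulrC y) -(mulrA y) exprMn -[v / _]invf_div exprVn -/m.
  rewrite [y ^+ m](exprS y m.-1); field.
  by rewrite !gt_eqF ?exprn_gt0// divr_gt0.
by rewrite ler_pdivrMr// /y mulrDr mulr1 mulrCA divff ?gt_eqF// mulr1 lerDl ltW.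
Qed.

(** The tail bound for increments over pairs at distance at most h tends to 0 with
    h, so for every threshold 1 / (n + 1) the event that it is exceeded for all h
    is null. *)
Lemma modulus_on_countable (S : set (R * R)) : S `<=` K -> countable S ->
  exists2 N, P.-negligible N & forall w, ~ N w -> forall e, 0 < e ->
    exists2 h, 0 < h & forall p q, S p -> S q ->
      `|p.1 - q.1| <= h -> `|p.2 - q.2| <= h -> `|u p w - u q w| <= e.
Proof.
move=> SK cS.
pose E (h v : R) := \bigcup_(pq in Kh h `&` S `*` S) [set w | v < `|u pq.1 w - u pq.2 w|].
pose N v := \bigcap_(h in [set h : R | 0 < h]) E h v.
have nN v : 0 < v -> P.-negligible (N v).
  move=> v0; apply: negligible_small => e e0.
  have h12 : 0 < (2^-1 : R) < 1 by rewrite invr_gt0 invf_lt1 ?ltr0n ?ltr1n.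
  pose A : R := 2 `^ (4 / beta).
  pose B : R := 2 `^ (4 / beta - 2) * (Num.max (b - a) (d - c)) ^+ 2 / 2^-1.
  have A0 : 0 <= A by exact: powR_ge0.
  have B0 : 0 <= B by rewrite divr_ge0// mulr_ge0 ?powR_ge0 ?sqr_ge0.
  have k0 : 0 < v * (1 - 2^-1) ^+ 2 / (C * (3 - 2^-1)).
    by rewrite divr_gt0 ?mulr_gt0 ?exprn_gt0//; lra.
  have [h h0 hB] := increment_bound_vanishes k0 e0 A0 B0.
  have cSS : countable (Kh h `&` S `*` S).
    apply: (@sub_countable _ _ _ (S `*` S)); last exact: countableX.
    by apply: subset_card_le => z [].
  have [mE PE] := increment_tail phiO le_ab le_cd C0 beta_range u_increment
    h12 h0 v0 cSS (@subIsetl _ _ _).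
  exists (E h v); split=> //; first by move=> w; apply.
  apply: (le_trans PE); apply: le_trans hB.
  rewrite le_eqVlt; apply/orP; left; apply/eqP; congr (_ * expeR (- young_fenchel _ _) * _%:E)%E.
    by field; rewrite !gt_eqF ?powR_gt0//; lra.
  by rewrite /B; field; rewrite gt_eqF.
exists (\bigcup_n N n.+1%:R^-1).
  by apply: negligible_bigcup => n; apply: nN; rewrite invr_gt0.
move=> w Nw e e0; have [n ne] := small_invS e0.
apply: contrapT => /forall2NP H; apply: Nw; exists n => // h /= h0.
have [//|/existsNP[p /existsNP[q H1]]] := H h.
move: H1 => /not_implyP[Sp /not_implyP[Sq /not_implyP[d1 /not_implyP[d2 /negP]]]].
rewrite -ltNge => eu; exists (p, q); last exact: le_lt_trans eu.
by split; split=> //; exact: SK.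
Qed.

Hypothesis P_complete : measure_is_complete P.
Hypothesis u_separable : separable_on P K u.

(** Separability transfers the modulus of continuity from S to the rectangle in
    two steps, because it concerns one point at a time: first one of the two
    points is released from S, then the other. *)
Lemma continuous_paths : exists2 N, P.-negligible N & forall w, ~ N w ->
  forall p e, K p -> 0 < e -> exists2 h, 0 < h & forall q, K q ->
    `|p.1 - q.1| <= h -> `|p.2 - q.2| <= h -> `|u p w - u q w| <= e.
Proof.
have [S [N [cS SK _ nN sep]]] := u_separable.
have [N' nN' mod] := modulus_on_countable SK cS.
exists (N `|` N'); first exact: negligibleU.
move=> w /not_orP[Nw N'w] p e Kp e0.
have [h h0 hP] := mod w N'w e e0.
pose G : set (R * R) := [set z | `|p.1 - z.1| < h / 2] `&` [set z | `|p.2 - z.2| < h / 2].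
have oG : open G.
  apply: openI.
    rewrite (_ : [set z | _] = fst @^-1` (ball p.1 (h / 2))) //.
    by apply: open_comp => [z _|]; [exact: cvg_fst|exact: ball_open].
  rewrite (_ : [set z | _] = snd @^-1` (ball p.2 (h / 2))) //.
  by apply: open_comp => [z _|]; [exact: cvg_snd|exact: ball_open].
have cD (x : R) : closed [set y : R | `|y - x| <= e].
  rewrite (_ : [set y | _] = `[x - e, x + e]%classic); first exact: itv_closed.
  by apply/seteqP; split=> y; rewrite /= in_itv/= ler_distl.
have GG z z' : G z -> G z' -> `|z.1 - z'.1| <= h /\ `|z.2 - z'.2| <= h.
  move=> [/= h1 h2] [/= h3 h4]; split.
    rewrite (_ : _ - _ = (z.1 - p.1) + (p.1 - z'.1)); last by ring.
    by rewrite (le_trans (ler_normD _ _))// (distrC z.1); lra.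
  rewrite (_ : _ - _ = (z.2 - p.2) + (p.2 - z'.2)); last by ring.
  by rewrite (le_trans (ler_normD _ _))// (distrC z.2); lra.
have step s z : (G `&` S) s -> (G `&` K) z -> `|u z w - u s w| <= e.
  move=> [Gs Ss] zGK; apply: (sep G _ w oG (cD (u s w)) Nw _ z zGK) => z' [Gz' Sz'].
  by have [? ?] := GG _ _ Gz' Gs; exact: hP.
have Gp : G p by split; rewrite /= subrr normr0 divr_gt0.
exists (h / 4) => [|q Kq d1 d2]; first by rewrite divr_gt0.
have Gq : G q by split; [apply: le_lt_trans d1 _|apply: le_lt_trans d2 _]; lra.
apply: (sep G _ w oG (cD (u q w)) Nw _ p) => // s Gs /=.
by rewrite distrC; apply: step.
Qed.

(** By continuity a strict inequality at a pair of W persists at the nearby pairs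
    of a countable dense subset, outside a null set. *)
Lemma increment_event_le (W : set ((R * R) * (R * R))) (v : R) (M : \bar R) :
  (forall pq, W pq -> K pq.1 /\ K pq.2) ->
  (forall Q, Q `<=` W -> countable Q ->
    let E := \bigcup_(pq in Q) [set w | v < `|u pq.1 w - u pq.2 w|] in
    measurable E /\ (P E <= M)%E) ->
  let E := \bigcup_(pq in W) [set w | v < `|u pq.1 w - u pq.2 w|] in
  measurable E /\ (P E <= M)%E.
Proof.
move=> WK hQ E; have [Q [QW cQ Qd]] := countable_dense_subset W.
have [mQ PQ] := hQ Q QW cQ.
have [N nN cont] := continuous_paths.
suff [mE PE] : measurable E /\
    (P E <= P (\bigcup_(pq in Q) [set w | (v < `|u pq.1 w - u pq.2 w|)%R]))%E.
  by split=> //; exact: le_trans PQ.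
apply: (complete_measure_le P_complete mQ nN) => [w [pq Qpq vu]|w [[p q] Wpq /= vu]].
  by exists pq => //; exact: QW.
have [Nw|Nw] := pselect (N w); [by right|left].
have [Kp Kq] := WK _ Wpq.
pose e := (`|u p w - u q w| - v) / 3.
have e0 : 0 < e by rewrite divr_gt0// subr_gt0.
have [h1 h10 H1] := cont w Nw p e Kp e0.
have [h2 h20 H2] := cont w Nw q e Kq e0.
have hm : 0 < Num.min h1 h2 by rewrite lt_min h10.
have [[p' q'] Q' [/= d1 d2 d3 d4]] := Qd _ Wpq _ hm.
have [Kp' Kq'] := WK _ (QW _ Q').
exists (p', q') => //=.
rewrite !le_min in d1 d2 d3 d4.
case/andP: d1 => d1 _; case/andP: d2 => d2 _.
case/andP: d3 => _ d3; case/andP: d4 => _ d4.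
have := H1 p' Kp' d1 d2; have := H2 q' Kq' d3 d4.
have : `|u p w - u q w| <=
    `|u p w - u p' w| + `|u p' w - u q' w| + `|u q w - u q' w|.
  rewrite (distrC (u q w)) (_ : u p w - u q w =
    (u p w - u p' w) + (u p' w - u q' w) + (u q' w - u q w)); last by ring.
  by rewrite (le_trans (ler_normD _ _))// lerD2r ler_normD.
move=> i1 i2 i3.
have eE : `|u p w - u q w| = 3 * e + v by rewrite /e mulrC divfK// subrK.
by rewrite eE in i1; lra.
Qed.

End path_regularity.

(** Separability with the whole space as open set and [-v, v] as closed set. *)
Lemma sup_event_le disp (T : measurableType disp) (R : realType)
    (P : probability T R) (X : topologicalType) (K : set X) (u : X -> T -> R)
    (v : R) (M : \bar R) :
  measure_is_complete P -> separable_on P K u ->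
  (forall S, S `<=` K -> countable S ->
    let E := \bigcup_(p in S) [set w | v < `|u p w|] in
    measurable E /\ (P E <= M)%E) ->
  (P (\bigcup_(p in K) [set w | (v < `|u p w|)%R]) <= M)%E.
Proof.
move=> P_complete [S [N [cS SK _ nN sep]]] hS.
have [mS PS] := hS S SK cS.
apply: le_trans PS; apply: (complete_measure_le P_complete mS nN _ _).2.
  by move=> w [p Sp vu]; exists p => //; exact: SK.
move=> w [p Kp /= vu]; have [Nw|Nw] := pselect (N w); [by right|left].
apply: contrapT => nS; move: vu; rewrite ltNge => /negP; apply.
have cD : closed [set x : R | `|x| <= v].
  rewrite (_ : [set y | _] = `[- v, v]%classic); first exact: itv_closed.
  by apply/seteqP; split=> y; rewrite /= in_itv/= ler_norml.
apply: (sep setT _ w openT cD Nw _ p) => // s [_ Ss] /=.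
by rewrite leNgt; apply/negP => vs; apply: nS; exists s.
Qed.
(** * Tail bounds for the solution of the equation *)

Theorem theorem6p1 (disp : measure_display) (Omega : measurableType disp)
    (R : realType) (P : probability Omega R) (phi : R -> R)
    (eta : R -> Omega -> R)
    (F : {finite_measure set (measurableTypeR R) -> \bar R})
    (Z : set R -> Omega -> R[i])
    (c_eta a b c d : R) (u : R * R -> Omega -> R) (beta : R)
    (P_complete : measure_is_complete P)
    (phi_orlicz : orlicz_N_function phi)
    (phi_Q : condition_Q phi)
    (eta_measurable : measurable_process eta)
    (eta_second_order : second_order P eta)
    (eta_ms_continuous : ms_continuous P eta)
    (eta_stationary : weakly_stationary P eta)
    (eta_centered : centered P eta)
    (F_spectral : is_spectral_measure P eta F)
    (Z_orthogonal : orthogonal_random_measure P F Z)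
    (eta_representation : forall x : R,
      is_stochastic_integral P F Z (fun l => expi (l * x))
        (fun w => (eta x w)%:C))
    (eta_strict : strictly_phi_subgaussian P phi (range eta) c_eta)
    (a_ge0 : 0 <= a) (le_ab : a <= b) (le_cd : c <= d) :
  let K : set (R * R) := `[a, b] `*` `[c, d] in
  forall
    (u_integral : forall t x : R, K (t, x) ->
      is_stochastic_integral P F Z (fun l => expi (l * x + l ^+ 3 * t))
        (fun w => (u (t, x) w)%:C))
    (u_separable : separable_on P K u)
    (beta_range : 0 < beta <= 1)
    (F_moment : (\int[F]_l (`|l| `^ (6 * beta))%:E < +oo)%E),
  let c_beta : R := 2 `^ (1 - beta) *
    Num.sqrt (fine (\int[F]_l (`|l + l ^+ 3| `^ (2 * beta))%:E)%E) in
  let sigma (h : R) : R := c_eta * c_beta * h `^ beta in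
  let eps0 : R := fine (ereal_sup [set tau P phi (u p) | p in K]) in
  let kappa : R := Num.max (b - a) (d - c) in
  let theta0 : R := sigma kappa / eps0 in
  let Kh (h : R) : set ((R * R) * (R * R)) :=
    [set pq | [/\ K pq.1, K pq.2, `|pq.1.1 - pq.2.1| <= h
                & `|pq.1.2 - pq.2.2| <= h]] in
  let A1 (e : R) : R := 2 `^ (4 / beta - 1) *
    ((kappa * (c_eta * c_beta) `^ beta^-1) ^+ 2 * 4 `^ (2 / beta - 1)
       / e `^ (2 / beta) + 1) in
  [/\
    forall h : R, 0 < h ->
      (ereal_sup [set tau P phi (fun w => u pq.1 w - u pq.2 w)%R
                 | pq in Kh h] <= (sigma h)%:E)%E,
    forall theta v : R, 0 < theta -> theta < Num.min theta0 1 -> 0 < v ->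
      (P [set w | v%:E < ereal_sup [set `|u p w|%:E | p in K]]
       <= 2%:E * expeR (- young_fenchel phi (v * (1 - theta) / eps0)%R)
          * (A1 (theta * eps0)%R)%:E)%E
  & forall p h v : R, 0 < p -> p < 1 -> 0 < h -> 0 < v ->
      (P [set w | v%:E < ereal_sup [set `|u pq.1 w - u pq.2 w|%:E
                                   | pq in Kh h]]
       <= (2 `^ (4 / beta))%:E
          * expeR (- young_fenchel phi
              (v * (1 - p) ^+ 2 / (c_eta * c_beta * h `^ beta * (3 - p)))%R)
          * (2 `^ (4 / beta - 2) * kappa ^+ 2 / (p * h ^+ 2) + 1)%:E)%E ].
Proof.
move=> K u_integral u_separable beta_range F_moment c_beta sigma eps0 kappa theta0 Kh A1.
pose C := c_eta * c_beta.
have C0 : 0 <= C := strict_const_ge0 eta_strict eta_second_order beta F_spectral eta_centered.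
have incr h p q : 0 <= h -> K p -> K q -> `|p.1 - q.1| <= h -> `|p.2 - q.2| <= h ->
    exp_bounded P phi (C * h `^ beta) (fun w => u p w - u q w).
  case: p q => [t x] [s y] h0 Kp Kq d1 d2.
  exact: (wave_increment_exp_bounded phi_orlicz Z_orthogonal eta_representation
    eta_strict eta_second_order beta_range F_moment C0 h0 d1 d2
    (u_integral _ _ Kp) (u_integral _ _ Kq)).
have incr_pos C' : C <= C' -> forall h p q, 0 <= h -> K p -> K q ->
    `|p.1 - q.1| <= h -> `|p.2 - q.2| <= h ->
    exp_bounded P phi (C' * h `^ beta) (fun w => u p w - u q w).
  move=> CC h p q h0 Kp Kq d1 d2.
  apply: (exp_bounded_le phi_orlicz (incr h p q h0 Kp Kq d1 d2)).
    by rewrite mulr_ge0 ?powR_ge0.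
  by rewrite ler_wpM2r ?powR_ge0.
(* a crude bound that makes the supremum of the norms finite *)
have [M M0 bM] := wave_exp_bounded phi_orlicz Z_orthogonal eta_representation
  eta_strict eta_second_order.
have uM p : K p -> exp_bounded P phi M (u p).
  by case: p => t x Kp; exact: bM (u_integral _ _ Kp).
have kap0 : 0 <= kappa by rewrite le_max subr_ge0 le_ab.
have mu p : K p -> measurable_fun setT (u p) by move=> /uM[].
have sup_tau : (ereal_sup [set tau P phi (u p) | p in K] <= M%:E)%E.
  by apply: ge_ereal_sup => _ [p Kp <-]; apply: exp_bounded_tau => //; exact: uM.
split=> [h h0|theta v t0 tt v0|p h v p0 p1 h0 v0].
- apply: ge_ereal_sup => _ [[p q] [/= Kp Kq d1 d2] <-].
  apply: exp_bounded_tau => //; first by rewrite mulr_ge0 ?powR_ge0.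
  by apply: incr => //; exact: ltW.
- have /andP[tt0 t1] : (theta < theta0) && (theta < 1) by rewrite -lt_min.
  have sig0 : 0 <= sigma kappa by rewrite mulr_ge0 ?powR_ge0.
  have th0 : 0 < theta0 by exact: lt_trans tt0.
  (* theta0 would be at most 0 otherwise, the inverse of 0 being 0 *)
  have e0 : 0 < eps0.
    by rewrite ltNge; apply/negP => e0; move: th0; rewrite ltNge mulr_ge0_le0// invr_le0.
  have sup_fin : ereal_sup [set tau P phi (u p) | p in K] \is a fin_num.
    move: e0; rewrite /eps0; case: (ereal_sup _) sup_tau => //=.
    by rewrite ltxx.
  have b_eps p : K p -> exp_bounded P phi eps0 (u p).
    move=> Kp; apply: tau_exp_bounded => //; [exact: mu|exact: ltW|].
    by rewrite /eps0 fineK//; apply: ereal_sup_ubound; exists p.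
  have te : theta * eps0 < C * kappa `^ beta by rewrite -ltr_pdivlMr.
  have Cgt : 0 < C.
    rewrite lt_neqAle C0 andbT; apply/eqP => C00; move: te.
    by rewrite -C00 mul0r ltNge mulr_ge0// ltW.
  rewrite ereal_sup_event; apply: sup_event_le u_separable _ => // S SK cS.
  by apply: (sup_tail phi_orlicz le_ab le_cd Cgt beta_range incr e0 b_eps _ te v0 SK cS); rewrite t0.
rewrite ereal_sup_event.
have p01 : 0 < p < 1 by rewrite p0.
(* path regularity needs a positive constant, whereas C may vanish *)
have C10 : 0 < C + 1 by rewrite ltr_wpDl.
have incr1 := incr_pos (C + 1) (ler_wpDr ler01 (lexx C)).
have WK pq : Kh h pq -> K pq.1 /\ K pq.2 by move=> [].
have [Cgt|C00] := ltP 0 C.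
  apply: (increment_event_le phi_orlicz le_ab le_cd C10 beta_range incr1 P_complete u_separable WK _).2.
  move=> Q QW cQ.
  exact: (increment_tail phi_orlicz le_ab le_cd Cgt beta_range incr p01 h0 v0 cQ QW).
(* if C = 0 then the argument of the transform is a division by 0, that is 0,
   and the right-hand side is at least 1 *)
have CE : c_eta * c_beta = 0 by apply/eqP; rewrite eq_le C0 C00.
have [mE _] : measurable (\bigcup_(pq in Kh h) [set w | v < `|u pq.1 w - u pq.2 w|]) /\
    (P (\bigcup_(pq in Kh h) [set w | (v < `|u pq.1 w - u pq.2 w|)%R]) <= +oo)%E.
  apply: (increment_event_le phi_orlicz le_ab le_cd C10 beta_range incr1 P_complete u_separable WK).
  move=> Q QW cQ; split; last by rewrite leey.
  exact: (increment_tail phi_orlicz le_ab le_cd C10 beta_range incr1 p01 h0 v0 cQ QW).1.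
apply: (le_trans (probability_le1 P mE)).
have yf0 : (young_fenchel phi 0 <= 0)%E.
  apply: ge_ereal_sup => _ [y _ <-]; rewrite lee_fin mul0r sub0r oppr_le0.
  exact: orlicz_ge0.
rewrite CE !mul0r invr0 mulr0 -[X in (X <= _)%E]mule1.
have one_le : (1 <= expeR (- young_fenchel phi 0))%E.
  by rewrite -expeR0 lee_expeR leeNr oppe0.
apply: lee_pmul => //.
  rewrite -[leLHS]mule1; apply: lee_pmul => //.
  by rewrite lee_fin -[leLHS](powRr0 2) ler_powR ?ler1n// divr_ge0//; case/andP: beta_range => /ltW.
rewrite lee_fin lerDr divr_ge0//; first by rewrite mulr_ge0 ?powR_ge0 ?sqr_ge0.
by rewrite mulr_ge0 ?sqr_ge0 ?(ltW p0).
Qed.
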